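(* Let $\mathcal B$ be a bi-infinite ordered Bratteli diagram satisfying the standing assumptions, with a state $\nu_r,\nu_s$. For all $m<n$ there is a short exact sequence of $C^*$-algebras $$0\to\bigoplus_{v\in V_n}A^Y_{m,n,v}\otimes C_0(0,\nu_s(v))\to B_{m,n}\to C^*(G_{m,n})\to0.$$
   Context: A bi-infinite ordered Bratteli diagram $\mathcal B=(V,E,r,s,\le_r,\le_s)$ consists of pairwise disjoint finite nonempty sets $V_n,E_n$ ($n\in\mathbb Z$), $V=\bigcup_nV_n$, $E=\bigcup_nE_n$, surjections $r:E_n\to V_n$, $s:E_n\to V_{n-1}$, and partial orders $\le_s,\le_r$ on $E$ such that $e,f$ are $\le_s$-comparable iff $s(e)=s(f)$ and $\le_r$-comparable iff $r(e)=r(f)$. For $m<n$, $E_{m,n}$ is the set of paths $p=(p_{m+1},\dots,p_n)$, $p_i\in E_i$, $r(p_i)=s(p_{i+1})$; $s(p)=s(p_{m+1})$, $r(p)=r(p_n)$. On $E_{m,n}$, $p<_sq$ means that for some $i$, $p_j=q_j$ for $j<i$ and $p_i<_sq_i$; $p<_rq$ means that for some $i$, $p_j=q_j$ for $j>i$ and $p_i<_rq_i$. Edges or paths are $s$-maximal, $s$-minimal, $r$-maximal, $r$-minimal if they are so for the corresponding order. $S_s(p)$ denotes the immediate $\le_s$-successor of $p$ in $E_{m,n}$. $X_{\mathcal B}$ is the space of bi-infinite paths $x=(x_n)_{n\in\mathbb Z}$, $x_n\in E_n$, $r(x_n)=s(x_{n+1})$, with the relative product topology. For $v\in V_n$, $X_v^+$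 (resp. $X_v^-$) is the set of one-sided paths $(x_{n+1},x_{n+2},\dots)$ starting at $v$ (resp. $(\dots,x_{n-1},x_n)$ ending at $v$). $x_{(n,\infty)}=(x_{n+1},x_{n+2},\dots)$, $x_{(m,n]}=(x_{m+1},\dots,x_n)$. Juxtaposition denotes concatenation (also of sets). $x_v^{s\text{-}max},x_v^{s\text{-}min}\in X_v^+$ are the unique paths all of whose edges are $s$-maximal, resp. $s$-minimal. The orders $\le_s,\le_r$ on $X_{\mathcal B}$ (and $\le_s$ on $X_v^+$) are defined by the same formulas as on $E_{m,n}$. $X^{ext}_{\mathcal B}$ is the set of $x\in X_{\mathcal B}$ all of whose edges are $r$-maximal, or all $r$-minimal, or all $s$-maximal, or all $s$-minimal. $\partial_rX_{\mathcal B}$ is the set of $x$ having an immediate successor or predecessor in $(X_{\mathcal B},\le_r)$; such $x$ has only one of these, denoted $\Delta_r(x)$. $\partial_sX_{\mathcal B}$, $\Delta_s$ are defined in the same way using $\le_s$. $\Sigma_{\mathcal B}=\{x\in\partial_sX_{\mathcal B}\cap\partial_rX_{\mathcal B}\mid\Delta_s\Delta_r(x)\ne\Delta_r\Delta_s(x)\}$, $Y_{\mathcal B}=X_{\mathcal B}\setminus(X^{ext}_{\mathcal B}\cup\Sigma_{\mathcal B})$. Standing assumptions: (i) finite rank: $\sup_n\#V_n<\infty$; (ii) strongly simple: for every $m$ there are $l<m<n$ such that there are at least two paths from every vertex of $V_l$ to every vertex of $V_m$ and at least two from every vertex of $V_m$ to every vertex of $V_n$; (iii) $X^{ext}_{\mathcal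 B}\cap\partial_sX_{\mathcal B}=\emptyset=X^{ext}_{\mathcal B}\cap\partial_rX_{\mathcal B}$. A state is a pair $\nu_r,\nu_s:V\to[0,\infty)$, neither identically zero, with $\nu_r(v)=\sum_{r(e)=v}\nu_r(s(e))$, $\nu_s(v)=\sum_{s(e)=v}\nu_s(r(e))$. $\nu_s$ also denotes the measure on $X_v^+$ with $\nu_s(pX^+_{r(p)})=\nu_s(r(p))$ for finite paths $p$ with $s(p)=v$, and $\varphi_s^v(x)=\nu_s\{y\in X_v^+\mid y\le_sx\}\in[0,\nu_s(v)]$. $T^+(X_{\mathcal B})$ is right tail equivalence: the union over $N\in\mathbb Z$ of $T^+_N(X_{\mathcal B})=\{(x,y)\mid x_n=y_n\ \forall n>N\}$, with the inductive limit topology and Haar system of measures $\nu_r^x$ on the classes $T^+(x)$ determined by $\nu_r^x(X^-_{s(p)}px_{(n,\infty)})=\nu_r(s(p))$ for $p\in E_{m,n}$, $r(p)=r(x_n)$. $T^+(Y_{\mathcal B})$ is its restriction to $Y_{\mathcal B}$ and $C^*_\lambda(T^+(Y_{\mathcal B}))$ is the reduced groupoid $C^*$-algebra, in which $C_c(T^+(Y_{\mathcal B}))$ has product $(f\cdot g)(x,y)=\int f(x,z)g(z,y)\,d\nu_r^x(z)$ and involution $f^*(x,y)=\overline{f(y,x)}$. $E^Y_{m,n}$ is the set of $p\in E_{m,n}$ that are neither $s$-maximal, $s$-minimal, $r$-maximal nor $r$-minimal and with $X^-_{s(p)}pX^+_{r(p)}\subseteq Y_{\mathcal B}$. For $p,q\in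 E^Y_{m,n}$ with $r(p)=r(q)$, $a_{p,q}\in C_c(T^+(Y_{\mathcal B}))$ takes the value $\nu_r(s(p))^{-1/2}\nu_r(s(q))^{-1/2}$ at $(x,y)$ with $x_{(m,n]}=p$, $y_{(m,n]}=q$, $x_{(n,\infty)}=y_{(n,\infty)}$, and $0$ elsewhere; for $f\in C(X^+_{r(p)})$, $(a_{p,q}\otimes f)(x,y)=f(x_{(n,\infty)})a_{p,q}(x,y)$. For $v\in V_n$, $A^Y_{m,n,v}=\mathrm{span}\{a_{p,q}\mid p,q\in E^Y_{m,n},\ r(p)=r(q)=v\}$. $E^s_{m,n}$ is the set of pairs $p=(p^1,p^2)$ with $p^1,p^2\in E^Y_{m,n}$, $p^2=S_s(p^1)$; $r(p)=(r(p^1),r(p^2))$. $G_{m,n}=\{(p,q)\in E^s_{m,n}\times E^s_{m,n}\mid r(p)=r(q)\}$, a finite equivalence relation, with $C^*(G_{m,n})$ its groupoid algebra (functions on $G_{m,n}$ with convolution). $\alpha_i((p^1,p^2),(q^1,q^2))=(p^i,q^i)$. $B_{m,n}\subseteq C^*_\lambda(T^+(Y_{\mathcal B}))$ is the $C^*$-algebra of all $a=\sum_{p,q\in E^Y_{m,n},\,r(p)=r(q)}a_{p,q}\otimes f_{p,q}$, $f_{p,q}\in C(X^+_{r(p)})$, such that: (a) each $f_{p,q}=g_{p,q}\circ\varphi_s^{r(p)}$ with $g_{p,q}:[0,\nu_s(r(p))]\to\mathbb C$ continuous; (b) for $(p,q)\in G_{m,n}$, $f_{p^1,q^1}(x^{s\text{-}max}_{r(p^1)})=f_{p^2,q^2}(x^{s\text{-}min}_{r(p^2)})$;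 (c) $f_{p,q}(x^{s\text{-}max}_{r(p)})=0$ if $(p,q)\notin\alpha_1(G_{m,n})$; (d) $f_{p,q}(x^{s\text{-}min}_{r(p)})=0$ if $(p,q)\notin\alpha_2(G_{m,n})$. An element $a_{p,q}\otimes g$ of $A^Y_{m,n,v}\otimes C[0,\nu_s(v)]$ is identified with $a_{p,q}\otimes(g\circ\varphi_s^v)$. *)

(* Defs.v *)
From HB Require Import structures.
From mathcomp Require Import all_boot all_order all_algebra.
From mathcomp Require Import all_classical all_reals all_analysis.
From mathcomp Require Import complex.

Set Implicit Arguments.
Unset Strict Implicit.
Unset Printing Implicit Defensive.

Import Order.TTheory GRing.Theory Num.Theory.
Import numFieldNormedType.Exports.

Local Open Scope classical_set_scope.
Local Open Scope ring_scope.
Local Open Scope complex_scope.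

(** * Star-algebras and C*-algebras *)

(* A star-algebra is presented as a subset [sa_set] of an ambient complex
   vector space, with a product and an involution that are only meaningful on
   that subset. *)
Record staralg (R : realType) := StarAlg {
  sa_car :> lmodType R[i] ;
  sa_set : set sa_car ;
  sa_mul : sa_car -> sa_car -> sa_car ;
  sa_star : sa_car -> sa_car
}.

Section CStarAlgebras.
Variable R : realType.
Implicit Types A B C : staralg R.

Record is_star_algebra A : Prop := {
  sa_zero : sa_set (0 : A) ;
  sa_add : forall x y : A, sa_set x -> sa_set y -> sa_set (x + y) ;
  sa_scale : forall (c : R[i]) (x : A), sa_set x -> sa_set (c *: x) ;
  sa_mul_in : forall x y : A, sa_set x -> sa_set y -> sa_set (sa_mul x y) ;
  sa_star_in : forall x : A, sa_set x -> sa_set (sa_star x) ;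
  sa_mulA : forall x y z : A, sa_set x -> sa_set y -> sa_set z ->
    sa_mul x (sa_mul y z) = sa_mul (sa_mul x y) z ;
  sa_mul_linl : forall (c : R[i]) (x y z : A),
    sa_set x -> sa_set y -> sa_set z ->
    sa_mul (c *: x + y) z = c *: sa_mul x z + sa_mul y z ;
  sa_mul_linr : forall (c : R[i]) (x y z : A),
    sa_set x -> sa_set y -> sa_set z ->
    sa_mul z (c *: x + y) = c *: sa_mul z x + sa_mul z y ;
  sa_star_lin : forall (c : R[i]) (x y : A), sa_set x -> sa_set y ->
    sa_star (c *: x + y) = conjc c *: sa_star x + sa_star y ;
  sa_starM : forall x y : A, sa_set x -> sa_set y ->
    sa_star (sa_mul x y) = sa_mul (sa_star y) (sa_star x) ;
  sa_starK : forall x : A, sa_set x -> sa_star (sa_star x) = x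
}.

Record is_cstar_norm A (N : A -> R) : Prop := {
  cn_ge0 : forall x : A, sa_set x -> 0 <= N x ;
  cn_eq0 : forall x : A, sa_set x -> N x = 0 -> x = 0 ;
  cn_scale : forall (c : R[i]) (x : A), sa_set x ->
    N (c *: x) = Normc.normc c * N x ;
  cn_triangle : forall x y : A, sa_set x -> sa_set y ->
    N (x + y) <= N x + N y ;
  cn_mul : forall x y : A, sa_set x -> sa_set y ->
    N (sa_mul x y) <= N x * N y ;
  cn_cstar : forall x : A, sa_set x -> N (sa_mul (sa_star x) x) = N x ^+ 2 ;
  cn_complete : forall u : nat -> A, (forall k, sa_set (u k)) ->
    (forall e : R, 0 < e -> exists k0 : nat, forall j k : nat,
      (k0 <= j)%N -> (k0 <= k)%N -> N (u j - u k) < e) ->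
    exists2 l : A, sa_set l & (fun k => N (u k - l)) @ \oo --> (0 : R)
}.

(* A complete C*-norm on a star-algebra is unique when it exists. *)
Definition is_cstar_algebra A : Prop :=
  is_star_algebra A /\ exists N : A -> R, is_cstar_norm N.

Record star_hom A B (f : A -> B) : Prop := {
  sh_in : forall x : A, sa_set x -> sa_set (f x) ;
  sh_lin : forall (c : R[i]) (x y : A), sa_set x -> sa_set y ->
    f (c *: x + y) = c *: f x + f y ;
  sh_mul : forall x y : A, sa_set x -> sa_set y ->
    f (sa_mul x y) = sa_mul (f x) (f y) ;
  sh_star : forall x : A, sa_set x -> f (sa_star x) = sa_star (f x)
}.

(* 0 -> A -> B -> C -> 0 is a short exact sequence of C*-algebras. *)
Record cstar_short_exact A B C (iota : A -> B) (pi : B -> C) : Prop := {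
  se_A : is_cstar_algebra A ;
  se_B : is_cstar_algebra B ;
  se_C : is_cstar_algebra C ;
  se_iota : star_hom iota ;
  se_pi : star_hom pi ;
  se_inj : forall x y : A, sa_set x -> sa_set y -> iota x = iota y -> x = y ;
  se_surj : forall z : C, sa_set z -> exists2 y : B, sa_set y & pi y = z ;
  se_exact : forall y : B, sa_set y ->
    (pi y = 0 <-> exists2 x : A, sa_set x & iota x = y)
}.

Definition lin_span (L : lmodType R[i]) (S : set L) : set L :=
  [set x | exists k (c : 'I_k -> R[i]) (u : 'I_k -> L),
    (forall i, S (u i)) /\ x = \sum_(i < k) c i *: u i].

(* C_0(0,c), each function being extended by 0 outside the interval. *)
Definition C0_itv (c : R) : set (R -> R[i]) :=
  [set g | continuous (g : R -> R[i]^o) /\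
    forall t, ~ (0 < t /\ t < c) -> g t = 0].

Definition elem_tensor (L : lmodType R[i]) (a : L) (g : R -> R[i]) : R -> L :=
  fun t => g t *: a.

(* The tensor product of S with C_0(0,c), realised inside the functions from
   R to L.  When S is finite-dimensional the algebraic tensor product is
   already complete. *)
Definition tensor_C0 (L : lmodType R[i]) (S : set L) (c : R) : set (R -> L) :=
  lin_span [set h | exists2 a, S a & exists2 g, C0_itv c g & h = elem_tensor a g].

End CStarAlgebras.

(** * Orders *)

Section Orders.
Variables (T : Type) (lt : T -> T -> Prop) (A : set T).

Definition maximal_in (x : T) : Prop := A x /\ forall y, A y -> ~ lt x y.
Definition minimal_in (x : T) : Prop := A x /\ forall y, A y -> ~ lt y x.
Definition imm_succ (x y : T) : Prop :=
  [/\ A x, A y, lt x y & forall z, A z -> ~ (lt x z /\ lt z y)].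

End Orders.

(** * Bi-infinite ordered Bratteli diagrams *)

(* V_n and E_n are the level sets of vlevel and elevel; this makes them
   pairwise disjoint with unions V and E.  The base point of [edge] is only
   used as a default value (E is nonempty anyway). *)
Record bratteli := Bratteli {
  vertex : choiceType ;
  edge : pointedType ;
  vlevel : vertex -> int ;
  elevel : edge -> int ;
  rng : edge -> vertex ;
  src : edge -> vertex ;
  le_r : rel edge ;
  le_s : rel edge ;
  vertices_finite : forall n, finite_set [set v | vlevel v = n] ;
  vertices_nonempty : forall n, [set v | vlevel v = n] !=set0 ;
  edges_finite : forall n, finite_set [set e | elevel e = n] ;
  edges_nonempty : forall n, [set e | elevel e = n] !=set0 ;
  rng_level : forall e, vlevel (rng e) = elevel e ;
  src_level : forall e, vlevel (src e) = elevel e - 1 ;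
  rng_surj : forall v, exists e, rng e = v ;
  src_surj : forall v, exists e, src e = v ;
  le_r_order : [/\ reflexive le_r, antisymmetric le_r & transitive le_r] ;
  le_s_order : [/\ reflexive le_s, antisymmetric le_s & transitive le_s] ;
  le_r_comparable : forall e f, (le_r e f \/ le_r f e) <-> rng e = rng f ;
  le_s_comparable : forall e f, (le_s e f \/ le_s f e) <-> src e = src f
}.

Section Diagram.
Variable B : bratteli.
Local Notation V := (vertex B).
Local Notation E := (edge B).
Local Notation r := (@rng B).
Local Notation s := (@src B).

Definition level_vertices (n : int) : set V := [set v | vlevel v = n].

Definition lt_r (e f : E) : Prop := le_r e f /\ e <> f.
Definition lt_s (e f : E) : Prop := le_s e f /\ e <> f.

Definition edge_smax (e : E) := maximal_in lt_s setT e.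
Definition edge_smin (e : E) := minimal_in lt_s setT e.
Definition edge_rmax (e : E) := maximal_in lt_r setT e.
Definition edge_rmin (e : E) := minimal_in lt_r setT e.

(** ** Finite paths *)

(* E_{m,n} for m < n; the sequence lists p_{m+1}, ..., p_n. *)
Definition paths (m n : int) : set (seq E) :=
  [set p | [seq elevel e | e <- p] = [seq m + i%:Z | i <- iota 1 `|n - m|%N]
           /\ sorted (fun e f => r e == s f) p].

Definition psrc (p : seq E) : V := s (head point p).
Definition prng (p : seq E) : V := r (last point p).

Definition plt_s (p q : seq E) : Prop :=
  exists i, [/\ (i < size p)%N, take i p = take i q
              & lt_s (nth point p i) (nth point q i)].
Definition plt_r (p q : seq E) : Prop :=
  exists i, [/\ (i < size p)%N, drop i.+1 p = drop i.+1 q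
              & lt_r (nth point p i) (nth point q i)].

(** ** Infinite paths *)

(* Points of the ambient product E^Z, of which X_B is a subset. *)
Definition bipath : Type := int -> E.
HB.instance Definition _ := Pointed.on bipath.

(* Points of E^N, with the product of the discrete topologies. A path
   (x_{n+1}, x_{n+2}, ...) is encoded as the sequence k |-> x_{n+1+k}. *)
Definition ray : Type := prod_topology (fun _ : nat => discrete_topology E).
HB.instance Definition _ := Pointed.on ray.
HB.instance Definition _ := Topological.on ray.

Definition X_ : set bipath :=
  [set x | forall n, elevel (x n) = n /\ r (x n) = s (x (n + 1))].

Definition Xplus (v : V) : set ray :=
  [set w | s (w 0%N) = v /\ forall k, r (w k) = s (w k.+1)].

(* x_{(m,n]} and x_{(n,oo)} *)
Definition segment (m n : int) (x : bipath) : seq E :=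
  [seq x (m + i%:Z) | i <- iota 1 `|n - m|%N].
Definition tail (n : int) (x : bipath) : ray := fun k => x (n + k.+1%:Z).

Definition xlt_s (x y : bipath) : Prop :=
  exists i, (forall j, j < i -> x j = y j) /\ lt_s (x i) (y i).
Definition xlt_r (x y : bipath) : Prop :=
  exists i, (forall j, i < j -> x j = y j) /\ lt_r (x i) (y i).
Definition wle_s (x y : ray) : Prop :=
  x = y \/ exists i, (forall j, (j < i)%N -> x j = y j) /\ lt_s (x i) (y i).

Definition ray_smax (v : V) : ray :=
  get [set w : ray | Xplus v w /\ forall k, edge_smax (w k)].
Definition ray_smin (v : V) : ray :=
  get [set w : ray | Xplus v w /\ forall k, edge_smin (w k)].

Definition Xext : set bipath :=
  [set x | X_ x /\
    [\/ forall n, edge_rmax (x n), forall n, edge_rmin (x n),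
        forall n, edge_smax (x n) | forall n, edge_smin (x n)]].

Definition neighbours (lt : bipath -> bipath -> Prop) (x : bipath) :
    set bipath := [set y | imm_succ lt X_ x y \/ imm_succ lt X_ y x].
Definition bdry_r : set bipath := [set x | neighbours xlt_r x !=set0].
Definition bdry_s : set bipath := [set x | neighbours xlt_s x !=set0].
Definition Delta_r (x : bipath) : bipath := get (neighbours xlt_r x).
Definition Delta_s (x : bipath) : bipath := get (neighbours xlt_s x).

Definition Sigma_ : set bipath :=
  [set x | [/\ bdry_s x, bdry_r x
             & Delta_s (Delta_r x) <> Delta_r (Delta_s x)]].

Definition Y_ : set bipath := X_ `\` (Xext `|` Sigma_).

(** ** Standing assumptions *)

Definition finite_rank : Prop :=
  exists K : nat, forall n, (level_vertices n #<= `I_K)%card.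

Definition two_paths (m n : int) : Prop :=
  forall v w, level_vertices m v -> level_vertices n w ->
  exists p q, [/\ paths m n p, paths m n q, p <> q,
                  psrc p = v /\ prng p = w & psrc q = v /\ prng q = w].

Definition strongly_simple : Prop :=
  forall m, exists l n, [/\ l < m, m < n, two_paths l m & two_paths m n].

Definition standing_assumptions : Prop :=
  [/\ finite_rank, strongly_simple,
      Xext `&` bdry_s = set0 & Xext `&` bdry_r = set0].

(** ** Right tail equivalence *)

Definition tail_equiv (x y : bipath) : Prop :=
  [/\ X_ x, X_ y & exists N : int, forall n, N < n -> x n = y n].

(* T^+(Y_B); in curried form, [tail_equivY x] is the class T^+(x) in Y_B. *)
Definition tail_equivY (x : bipath) : set bipath :=
  [set y | [/\ Y_ x, Y_ y & tail_equiv x y]].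

(** ** The sets E^Y_{m,n}, E^s_{m,n} and G_{m,n} *)

Definition EY (m n : int) : set (seq E) :=
  [set p | [/\ paths m n p,
     ~ maximal_in plt_s (paths m n) p, ~ minimal_in plt_s (paths m n) p,
     ~ maximal_in plt_r (paths m n) p /\ ~ minimal_in plt_r (paths m n) p
   & forall x, X_ x -> segment m n x = p -> Y_ x]].

Definition ppair : Type := (seq E * seq E)%type.

Definition Es (m n : int) : set ppair :=
  [set p | [/\ EY m n p.1, EY m n p.2 & imm_succ plt_s (paths m n) p.1 p.2]].

Definition G_ (m n : int) (p q : ppair) : Prop :=
  [/\ Es m n p, Es m n q & prng p.1 = prng q.1 /\ prng p.2 = prng q.2].

(* (p,q) belongs to alpha_i(G_{m,n}) *)
Definition alpha1_G (m n : int) (p q : seq E) : Prop :=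
  exists P Q, [/\ G_ m n P Q, P.1 = p & Q.1 = q].
Definition alpha2_G (m n : int) (p q : seq E) : Prop :=
  exists P Q, [/\ G_ m n P Q, P.2 = p & Q.2 = q].

(** ** Measurable structures *)

Definition bicylinders : set (set bipath) :=
  [set A | exists n e, A = [set x | x n = e]].
Definition raycylinders : set (set ray) :=
  [set A | exists n e, A = [set x | x n = e]].

Definition bipath_mspace := g_sigma_algebraType bicylinders.
Definition ray_mspace := g_sigma_algebraType raycylinders.

(** * States, measures and convolution algebras *)

Section States.
Variable R : realType.

Record is_state (nu_r nu_s : V -> R) : Prop := {
  state_r_ge0 : forall v, 0 <= nu_r v ;
  state_s_ge0 : forall v, 0 <= nu_s v ;
  state_r_neq0 : exists v, nu_r v <> 0 ;
  state_s_neq0 : exists v, nu_s v <> 0 ;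
  state_rE : forall v, nu_r v = \sum_(e \in [set e | r e = v]) nu_r (s e) ;
  state_sE : forall v, nu_s v = \sum_(e \in [set e | s e = v]) nu_s (r e)
}.

(* mu v is the measure nu_s on X_v^+, seen as a measure on E^N carried by
   X_v^+. *)
Definition is_ray_measure (nu_s : V -> R)
    (mu : V -> {measure set ray_mspace -> \bar R}) : Prop :=
  forall v, mu v (~` Xplus v) = 0%E /\
    forall m n p, m < n -> paths m n p -> psrc p = v ->
      mu v [set w | Xplus v w /\ [seq w i | i <- iota 0 (size p)] = p]
      = (nu_s (prng p))%:E.

(* haar x is the measure nu_r^x on T^+(x), seen as a measure on E^Z carried by
   T^+(x). *)
Definition is_haar_system (nu_r : V -> R)
    (haar : bipath -> {measure set bipath_mspace -> \bar R}) : Prop :=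
  forall x, X_ x -> haar x (~` tail_equiv x) = 0%E /\
    forall m n p, m < n -> paths m n p -> prng p = r (x n) ->
      haar x [set y | [/\ X_ y, segment m n y = p & tail n y = tail n x]]
      = (nu_r (psrc p))%:E.

Definition phi_s (mu : V -> {measure set ray_mspace -> \bar R}) (v : V)
    (w : ray) : R :=
  fine (mu v [set y | Xplus v y /\ wle_s y w]).

(* Functions on T^+(Y_B), extended by 0 to all pairs of points. *)
Definition kernel : lmodType R[i] := bipath -> bipath -> R[i].

Section Convolution.
Variable haar : bipath -> {measure set bipath_mspace -> \bar R}.

Definition Cintegral (x : bipath) (f : bipath -> R[i]) : R[i] :=
  (\int[haar x]_(z in tail_equivY x) complex.Re (f z))
  +i* (\int[haar x]_(z in tail_equivY x) complex.Im (f z)).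

Definition conv (f g : kernel) : kernel :=
  fun x y => Cintegral x (fun z => f x z * g z y).

Definition kstar (f : kernel) : kernel := fun x y => conjc (f y x).

(* The reduced norm is the supremum over x in Y_B of the operator norms of the
   left regular representations on L^2(T^+(x), nu_r^x). *)
Definition L2norm_sq (x : bipath) (xi : bipath -> R[i]) : \bar R :=
  (\int[haar x]_(z in tail_equivY x) ((Normc.normc (xi z)) ^+ 2)%:E)%E.

Definition left_reg (x : bipath) (a : kernel) (xi : bipath -> R[i]) :
    bipath -> R[i] :=
  fun y => Cintegral x (fun z => a y z * xi z).

Definition L2_unit_ball (x : bipath) : set (bipath -> R[i]) :=
  [set xi |
    [/\ measurable_fun setT ((fun z => complex.Re (xi z)) : bipath_mspace -> R),
        measurable_fun setT ((fun z => complex.Im (xi z)) : bipath_mspace -> R)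
      & (L2norm_sq x xi <= 1)%E]].

Definition reduced_norm (a : kernel) : R :=
  Num.sqrt (fine (ereal_sup [set t | exists x xi,
    [/\ Y_ x, L2_unit_ball x xi & t = L2norm_sq x (left_reg x a xi)]])).

End Convolution.

Section Algebras.
Variables (nu_r nu_s : V -> R).
Variable haar : bipath -> {measure set bipath_mspace -> \bar R}.
Variable mu : V -> {measure set ray_mspace -> \bar R}.
Variables (m n : int).

Definition a_ (p q : seq E) : kernel := fun x y =>
  if `[< [/\ tail_equivY x y, segment m n x = p, segment m n y = q
           & tail n x = tail n y] >]
  then ((Num.sqrt (nu_r (psrc p)))^-1 * (Num.sqrt (nu_r (psrc q)))^-1)%:C
  else 0.

(* a_{p,q} (x) f *)
Definition a_tensor (p q : seq E) (f : ray -> R[i]) : kernel :=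
  fun x y => f (tail n x) * a_ p q x y.

Definition AY (v : V) : set kernel :=
  lin_span [set a | exists p q,
    [/\ EY m n p, EY m n q, prng p = v, prng q = v & a = a_ p q]].

Definition pairsY : set ppair :=
  [set pq | [/\ EY m n pq.1, EY m n pq.2 & prng pq.1 = prng pq.2]].

Record B_coefficients (f : seq E -> seq E -> ray -> R[i]) : Prop := {
  B_cont : forall p q, pairsY (p, q) ->
    {within Xplus (prng p), continuous (f p q : ray -> R[i]^o)} ;
  B_factor : forall p q, pairsY (p, q) ->
    exists2 g : R -> R[i],
      {within `[0, nu_s (prng p)], continuous (g : R -> R[i]^o)}
    & forall w, Xplus (prng p) w -> f p q w = g (phi_s mu (prng p) w) ;
  B_glue : forall p q, G_ m n p q ->
    f p.1 q.1 (ray_smax (prng p.1)) = f p.2 q.2 (ray_smin (prng p.2)) ;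
  B_max : forall p q, pairsY (p, q) -> ~ alpha1_G m n p q ->
    f p q (ray_smax (prng p)) = 0 ;
  B_min : forall p q, pairsY (p, q) -> ~ alpha2_G m n p q ->
    f p q (ray_smin (prng p)) = 0
}.

Definition B_mn : staralg R := StarAlg
  [set a : kernel | exists2 f, B_coefficients f &
     a = \sum_(pq \in pairsY) a_tensor pq.1 pq.2 (f pq.1 pq.2)]
  (conv haar) kstar.

(* The direct sum over v in V_n of A^Y_{m,n,v} (x) C_0(0, nu_s(v)): families of
   functions R -> A^Y_{m,n,v}, with pointwise operations. *)
Definition sum_car : lmodType R[i] := V -> R -> kernel.

Definition sum_AY_C0 : staralg R := @StarAlg R sum_car
  [set h | (forall v, level_vertices n v -> tensor_C0 (AY v) (nu_s v) (h v)) /\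
           (forall v, ~ level_vertices n v -> h v = 0)]
  (fun h k v t => conv haar (h v t) (k v t))
  (fun h v t => kstar (h v t)).

Definition sum_inj (v : V) (h : R -> kernel) : sum_car :=
  fun w => if w == v then h else 0.

(* C^*(G_{m,n}), with functions on G_{m,n} extended by 0. *)
Definition groupoid_car : lmodType R[i] := ppair -> ppair -> R[i].

Definition CstarG : staralg R := @StarAlg R groupoid_car
  [set h | forall p q, ~ G_ m n p q -> h p q = 0]
  (fun h k p q => \sum_(z \in [set z | G_ m n p z /\ G_ m n z q]) h p z * k z q)
  (fun h p q => conjc (h q p)).

End Algebras.
End States.
End Diagram.

(* Main.v *)
(* An element [sum a_{p,q} (x) f_{p,q}] acts on L^2 of a right tail class as the
   direct sum, over the countably many tails w = x_{(n,oo)} met by the class, of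
   the matrices (f_{p,q}(w))_{p,q}, in the orthonormal family of the functions
   nu_r(s(p))^{-1/2} 1_{[p w]}.  Its reduced norm is therefore the supremum over w
   of the norms of these matrices, so the C*-identity is that of matrices, and a
   star-algebra of coefficient families closed under uniform convergence is a
   C*-algebra.

   Strong simplicity makes nu_r and nu_s strictly positive and makes the
   nu_s-mass of cylinders shrink to 0.  Hence phi_s^v is continuous with dense
   image in [0, nu_s(v)], and maps x_v^{s-min} to 0 and x_v^{s-max} to nu_s(v), so
   that g is determined by g o phi_s^v and this passes to uniform limits.

   The quotient map sends f to the values f_{p^1,q^1}(x^{s-max}).  By uniqueness of
   immediate successors, conditions (c) and (d) restrict a matrix product at an
   end of the interval to a class of G_{m,n}, which makes the map multiplicative.
   Its kernel consists of the g_{p,q} vanishing at both ends, and linear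
   interpolation between prescribed end values gives surjectivity. *)

(* One device, [kernel_embedding], serves all three algebras: each is mapped injectively into
   kernels [ker_of F], where the star-algebra laws, the C*-norm axioms and completeness are proved
   once. Even C*(G) enters this way, so its norm is a reduced norm too. The main obstacle is
   measure-theoretic: convolution and the reduced norm integrate over classes in [Y_] that are not
   known to be measurable. Integrands containing a kernel vanish off countably many disjoint
   measurable cylinders, finitely many for a fixed tail, and their integrals are moved there; norms
   of vectors are only compared by inclusion of domains. Moreover the reduced norm is [fine] of a
   supremum, which is informative only when the supremum is finite. Boundedness of coefficients is
   therefore carried along, and the norm is used only through [least_bound], as the smallest uniform
   bound of the matrices. Strong simplicity acts by doubling: two paths between two vertices give
   two disjoint cylinders of equal mass, so masses at least halve between suitable levels. *)
Require Import Defs.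
From mathcomp Require Import all_boot all_order all_algebra.
From mathcomp Require Import all_classical all_reals all_analysis.
From mathcomp Require Import complex measurable_realfun.
From mathcomp Require Import zify ring lra.

Set Implicit Arguments.
Unset Strict Implicit.
Unset Printing Implicit Defensive.

Import Order.TTheory GRing.Theory Num.Theory.
Import numFieldNormedType.Exports.

Local Open Scope classical_set_scope.
Local Open Scope ring_scope.
Local Open Scope complex_scope.

(** * Paths of a Bratteli diagram *)

(** Totality and transitivity are asked on [A] only, because edges are comparable only at a common
    source and rays only inside one [Xplus v]. Reversed orders give least elements. *)
Lemma finite_set_greatest (T : Type) (le : T -> T -> Prop) (A : set T) :
  finite_set A -> A !=set0 -> (forall x y, A x -> A y -> le x y \/ le y x) ->
  (forall x y z, A x -> A y -> A z -> le x y -> le y z -> le x z) ->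
  exists2 m, A m & forall y, A y -> le y m.
Proof.
(* Classical choice equips [T] with the decidable equality needed to list [A] as a sequence. *)
elim/Pchoice: T => T in le A *.
move=> /finite_seqP[s ->]; elim: s => [[x]//|a s IH] _ tot tr.
have [s0|] := eqVneq s [::].
  rewrite s0 in tot *; exists a => /=; first by rewrite inE.
  move=> y /=; rewrite inE => /eqP ->.
  by have [] := tot a a; rewrite /= ?inE.
move=> sn0.
have [|x y xs ys|x y z xs ys zs|m ms mmax] := IH.
- by case: s sn0 {IH tot tr} => // b s _; exists b; rewrite /= inE eqxx.
- by apply: tot; rewrite /= inE ?xs ?ys orbT.
- by apply: (tr x y z); rewrite /= inE ?xs ?ys ?zs orbT.
have am : a \in a :: s by rewrite inE eqxx.
have sm y : y \in s -> y \in a :: s by move=> ys; rewrite inE ys orbT.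
have [lam|lma] := tot a m am (sm _ ms).
  exists m; first exact: sm.
  move=> y /=; rewrite inE => /orP[/eqP ->//|]; exact: mmax.
exists a => // y /=; rewrite inE => /orP[/eqP ->|ys].
  by have [] := tot a a am am.
by apply: (tr _ m) => //; [exact: sm|exact: sm|exact: mmax].
Qed.

Lemma finite_seqs (T : choiceType) (A : set T) (k : nat) : finite_set A ->
  finite_set [set s : seq T | size s = k /\ forall x, x \in s -> A x].
Proof.
move=> fA; elim: k => [|k IH].
  apply: (@sub_finite_set _ _ [set [::]]) => //.
  by move=> [|x s] [].
apply: sub_finite_set (finite_image2 (fun x s => x :: s) fA IH).
move=> [[]//|x s [[sk] sA]]; exists x; first by apply: sA; rewrite inE eqxx.
exists s => //; split=> // y ys; apply: sA; by rewrite inE ys orbT.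
Qed.

Section Diagram.
Variable B : bratteli.
Local Notation V := (vertex B).
Local Notation E := (edge B).
Local Notation r := (@rng B).
Local Notation s := (@src B).

(** * Edges at a vertex, extremal rays, left-infinite paths *)

Lemma finite_out_edges (v : V) : finite_set [set e | s e = v].
Proof.
apply: (@sub_finite_set _ _ [set e | elevel e = vlevel v + 1]); last first.
  exact: edges_finite.
by move=> e /= <-; rewrite src_level subrK.
Qed.

Lemma le_s_trans (e f g : E) : le_s e f -> le_s f g -> le_s e g.
Proof. by case: (le_s_order B) => _ _ tr; apply: tr. Qed.

Lemma le_s_anti (e f : E) : le_s e f -> le_s f e -> e = f.
Proof. by case: (le_s_order B) => _ an _ h1 h2; apply: an; rewrite h1 h2. Qed.

Lemma lt_s_irrefl (e : E) : ~ lt_s e e.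
Proof. by case. Qed.

Lemma lt_s_trans (e f g : E) : lt_s e f -> lt_s f g -> lt_s e g.
Proof.
move=> [h1 n1] [h2 n2]; split; first exact: le_s_trans h2.
by move=> eg; apply: n1; apply: le_s_anti => //; rewrite eg.
Qed.

Lemma lt_s_src (e f : E) : lt_s e f -> s e = s f.
Proof. by case=> h _; apply/le_s_comparable; left. Qed.

Lemma lt_s_total (e f : E) : s e = s f -> [\/ e = f, lt_s e f | lt_s f e].
Proof.
move=> /le_s_comparable h; have [->|/eqP ne] := eqVneq e f; first by constructor 1.
by case: h => h; [constructor 2|constructor 3]; split => // /esym.
Qed.

Lemma exists_edge_smax (v : V) : exists2 e, s e = v & edge_smax e.
Proof.
have [||x y sx sy|x y z _ _ _|e ev emax] :=
  @finite_set_greatest E (@le_s B) [set e | s e = v].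
- exact: finite_out_edges.
- by have [e <-] := src_surj v; exists e.
- by apply/le_s_comparable; rewrite /= sx.
- exact: le_s_trans.
exists e => //; split => // f _ lef.
have [fe ne] := lef; apply: ne; apply: le_s_anti => //; apply: emax.
by rewrite /= -(lt_s_src lef).
Qed.

Lemma exists_edge_smin (v : V) : exists2 e, s e = v & edge_smin e.
Proof.
have [||x y sx sy|x y z _ _ _ h1 h2|e ev emax] :=
  @finite_set_greatest E (fun x y => le_s y x) [set e | s e = v].
- exact: finite_out_edges.
- by have [e <-] := src_surj v; exists e.
- by apply/le_s_comparable; rewrite /= sx.
- exact: le_s_trans h1.
exists e => //; split => // f _ lef.
have [fe ne] := lef; apply: ne; apply: le_s_anti => //; apply: emax.
by rewrite /= (lt_s_src lef).
Qed.

Lemma exists_ray (P : E -> Prop) : (forall v, exists2 e, s e = v & P e) ->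
  forall v, exists w : ray B, Xplus v w /\ forall k, P (w k).
Proof.
move=> hP v.
have [nx hnx] : {nx : V -> E & forall v, s (nx v) = v /\ P (nx v)}.
  by apply: (@choice _ _ (fun v e => s e = v /\ P e)) => u; have [e] := hP u; exists e.
exists (fun k => nx (iter k (fun u => r (nx u)) v)); split; last first.
  by move=> k; case: (hnx (iter k (fun u => r (nx u)) v)).
split; first by case: (hnx v).
by move=> k; case: (hnx (iter k.+1 (fun u => r (nx u)) v)).
Qed.

(** Since a witness exists, [get] in [ray_smax] does not fall back on its default. *)
Lemma ray_smaxP (v : V) : Xplus v (ray_smax v) /\ forall k, edge_smax (ray_smax v k).
Proof. exact: (@getPex _ _ (exists_ray exists_edge_smax v)). Qed.

Lemma ray_sminP (v : V) : Xplus v (ray_smin v) /\ forall k, edge_smin (ray_smin v k).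
Proof. exact: (@getPex _ _ (exists_ray exists_edge_smin v)). Qed.

Lemma Xplus_level (v : V) (w : ray B) k : Xplus v w ->
  elevel (w k) = vlevel v + k.+1%:Z.
Proof.
move=> [w0 wS]; elim: k => [|k IH].
  by have := src_level (w 0%N); rewrite w0; lia.
have := src_level (w k.+1); rewrite -wS rng_level IH; lia.
Qed.

(** Supplies the past of a bi-infinite path; the index counts levels downwards from that of [v]. *)
Lemma exists_left_ray (v : V) : exists l : nat -> E, r (l 0%N) = v /\
  (forall k, r (l k.+1) = s (l k)) /\ forall k, elevel (l k) = vlevel v - k%:Z.
Proof.
have [pr hpr] : {pr : V -> E & forall v, r (pr v) = v}.
  by apply: (@choice _ _ (fun v e => r e = v)) => u; exact: rng_surj.
exists (fun k => pr (iter k (fun u => s (pr u)) v)); split; first exact: hpr.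
split=> [k|]; first exact: hpr.
elim=> [|k IH] /=; first by rewrite -rng_level hpr subr0.
rewrite -rng_level hpr src_level IH; lia.
Qed.

(** * Finite paths and segments of bi-infinite paths *)

Lemma pathsP (m n : int) (p : seq E) : paths m n p <->
  [/\ size p = `|n - m|%N,
      forall i, (i < size p)%N -> elevel (nth point p i) = m + i.+1%:Z
    & forall i, (i.+1 < size p)%N -> r (nth point p i) = s (nth point p i.+1)].
Proof.
rewrite /paths /=; split.
  move=> [hl /(sortedP point) hs].
  have sz : size p = `|n - m|%N.
    by have := congr1 size hl; rewrite !size_map size_iota.
  split => //.
  - move=> i ip; have := congr1 (fun t => nth 0 t i) hl.
    rewrite (nth_map point)// (nth_map 0%N) ?size_iota -?sz//.
    by rewrite nth_iota -?sz// => ->.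
  - by move=> i ip; apply/eqP; exact: hs.
move=> [sz lv rs]; split.
  apply: (@eq_from_nth _ 0); first by rewrite !size_map size_iota.
  move=> i; rewrite size_map => ip.
  rewrite (nth_map point)// (nth_map 0%N) ?size_iota -?sz//.
  by rewrite nth_iota -?sz// lv.
by apply/(sortedP point) => i ip; apply/eqP/rs.
Qed.

Lemma paths_vlevel m n (p : seq E) : m < n -> paths m n p ->
  vlevel (psrc p) = m /\ vlevel (prng p) = n.
Proof.
move=> mn /pathsP[sz lv _].
have p0 : (0 < size p)%N by rewrite sz; lia.
split; first by rewrite /psrc src_level -nth0 lv// addrK.
rewrite /prng rng_level -nth_last lv; lia.
Qed.

Lemma paths_finite m n : finite_set (paths (B := B) m n).
Proof.
apply: (@sub_finite_set _ _ [set p : seq E | size p = `|n - m|%N /\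
    forall x, x \in p -> (\bigcup_(i in `I_(`|n - m|%N)) [set e | elevel e = m + i.+1%:Z]) x]).
  move=> p /pathsP[sz lv _]; split => // x /(nthP point)[i ip <-].
  by exists i; [rewrite /= -sz|exact: lv].
apply: finite_seqs; apply: bigcup_finite => // i _; exact: edges_finite.
Qed.

Lemma size_segment m n (x : bipath B) : size (segment m n x) = `|n - m|%N.
Proof. by rewrite size_map size_iota. Qed.

Lemma nth_segment m n (x : bipath B) i : (i < `|n - m|)%N ->
  nth point (segment m n x) i = x (m + i.+1%:Z).
Proof.
by move=> ip; rewrite (nth_map 0%N) ?size_iota// nth_iota.
Qed.

Lemma segment_paths m n (x : bipath B) : X_ x -> paths m n (segment m n x).
Proof.
move=> Xx; apply/pathsP; rewrite size_segment; split => // i ip.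
  by rewrite nth_segment//; case: (Xx (m + i.+1%:Z)).
rewrite !nth_segment//; last exact: ltnW.
case: (Xx (m + i.+1%:Z)) => _ ->; congr (s (x _)); lia.
Qed.

Lemma psrc_segment m n (x : bipath B) : m < n -> psrc (segment m n x) = s (x (m + 1)).
Proof. by move=> mn; rewrite /psrc -nth0 nth_segment //; lia. Qed.

Lemma prng_segment m n (x : bipath B) : m < n -> prng (segment m n x) = r (x n).
Proof.
move=> mn; rewrite /prng -nth_last size_segment nth_segment; last by lia.
congr (r (x _)); lia.
Qed.

Lemma tail_Xplus n (x : bipath B) : X_ x -> Xplus (r (x n)) (tail n x).
Proof.
move=> Xx; split=> [|k]; rewrite /tail; first by case: (Xx n) => _ ->.
case: (Xx (n + k.+1%:Z)) => _ ->; congr (s (x _)); lia.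
Qed.

(** A left ray into the source of [p], the path [p] and the ray [w] are glued. This turns statements
    about pairs (p, w) into evaluations of kernels at points. *)
Lemma exists_bipath m n (p : seq E) (w : ray B) : m < n -> paths m n p ->
  Xplus (prng p) w -> exists x, [/\ X_ x, segment m n x = p & tail n x = w].
Proof.
move=> mn pp Xw; have [vs vr] := paths_vlevel mn pp.
have [sz lv rs] := (pathsP _ _ _).1 pp.
have [l [l0 [lS ll]]] := exists_left_ray (psrc p).
(* The entry [l 0] sits at level m, the first edge of [p] at level m + 1 and [w 0] at level n +
   1. *)
pose x : bipath B := fun j => if j <= m then l `|m - j|%N else
  if j <= n then nth point p `|j - m|.-1 else w `|j - n|.-1.
have xl (k : nat) : x (m - k%:Z) = l k.
  by rewrite /x ifT; [congr l; lia|lia].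
have xm (k : nat) : (k < size p)%N -> x (m + k.+1%:Z) = nth point p k.
  move=> kp; rewrite /x ifF; last by lia.
  by rewrite ifT; [congr nth; lia|lia].
have xr (k : nat) : x (n + k.+1%:Z) = w k.
  rewrite /x ifF; last by lia.
  by rewrite ifF; [congr w; lia|lia].
have p0 : (0 < size p)%N by rewrite sz; lia.
exists x; split.
- move=> j; have [jm|mj] := leP j m.
    pose k := `|m - j|%N; have -> : j = m - k%:Z by lia.
    rewrite xl; split; first by rewrite ll vs.
    case: k => [|k].
      have -> : m - 0%:Z + 1 = m + 0.+1%:Z by lia.
      by rewrite xm// l0 /psrc nth0.
    have -> : m - k.+1%:Z + 1 = m - k%:Z by lia.
    by rewrite xl lS.
  have [jn|nj] := leP j n.
    pose k := `|j - m|.-1; have -> : j = m + k.+1%:Z by lia.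
    have kp : (k < size p)%N by lia.
    rewrite xm//; split; first exact: lv.
    have [kp'|kp'] := ltnP k.+1 (size p).
      have -> : m + k.+1%:Z + 1 = m + k.+2%:Z by lia.
      by rewrite xm// rs.
    have -> : m + k.+1%:Z + 1 = n + 0.+1%:Z by lia.
    rewrite xr; case: Xw => -> _; rewrite /prng -nth_last; congr (r (nth _ _ _)); lia.
  pose k := `|j - n|.-1; have -> : j = n + k.+1%:Z by lia.
  rewrite xr; split; first by rewrite (Xplus_level _ Xw) vr.
  have -> : n + k.+1%:Z + 1 = n + k.+2%:Z by lia.
  by rewrite xr; case: Xw.
- apply: (@eq_from_nth _ point); first by rewrite size_segment.
  by move=> i; rewrite size_segment => ip; rewrite nth_segment// xm// sz.
- by apply/funext => k; rewrite /tail xr.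
Qed.

(** * The lexicographic order on finite paths, and the relation G *)

Lemma plt_s_src m n (p q : seq E) : paths m n p -> paths m n q ->
  plt_s p q -> psrc p = psrc q.
Proof.
move=> /pathsP[sp _ _] /pathsP[sq _ _] [i [ip tk lt]].
rewrite /psrc -!nth0; case: i => [|i] in ip tk lt *; first exact: lt_s_src.
by have := congr1 (fun t => nth point t 0) tk; rewrite !nth_take// => ->.
Qed.

(** At the first index where the paths differ, the preceding edges agree, so the two edges leave the
    same vertex and are comparable. *)
Lemma plt_s_total m n (p q : seq E) : m < n -> paths m n p -> paths m n q ->
  psrc p = psrc q -> [\/ p = q, plt_s p q | plt_s q p].
Proof.
move=> mn /pathsP[sp _ rp] /pathsP[sq _ rq] e.
have [->|pq] := eqVneq p q; first by constructor 1.
have : exists i, (i < size p)%N && (nth point p i != nth point q i).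
  apply: contrapT => hn; case/eqP: pq; apply: (@eq_from_nth _ point); first by rewrite sp.
  move=> i ip; apply: contrapT => /eqP ne; apply: hn; exists i; by rewrite ip.
move=> /ex_minnP[i /andP[ip ne] imin].
have tk : take i p = take i q.
  apply: (@eq_from_nth _ point); first by rewrite !size_take sp sq.
  move=> j; rewrite size_take ip => ji; rewrite !nth_take//.
  apply: contrapT => /eqP nj.
  have := imin j; rewrite nj (ltn_trans ji ip) => /(_ isT); lia.
have se : s (nth point p i) = s (nth point q i).
  case: i => [|i] in ip ne imin tk *; first by rewrite !nth0.
  rewrite -rp// -rq ?sq -?sp//; congr r.
  by have := congr1 (fun t => nth point t i) tk; rewrite !nth_take.
have [/eqP|l|l] := lt_s_total se; first by rewrite (negbTE ne).
  by constructor 2; exists i.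
by constructor 3; exists i; split => //; rewrite sq -sp.
Qed.

(** Two immediate successors have the same source, hence are comparable, and the smaller would lie
    strictly between [p] and the larger. *)
Lemma imm_succ_inj_r m n (p q q' : seq E) : m < n ->
  imm_succ (@plt_s B) (paths m n) p q -> imm_succ (@plt_s B) (paths m n) p q' -> q = q'.
Proof.
move=> mn [pp pq lt im] [_ pq' lt' im'].
have e : psrc q = psrc q' by rewrite -(plt_s_src pp pq lt) -(plt_s_src pp pq' lt').
have [//|h|h] := plt_s_total mn pq pq' e.
  by case: (im' q pq).
by case: (im q' pq').
Qed.

Lemma imm_succ_inj_l m n (p q q' : seq E) : m < n ->
  imm_succ (@plt_s B) (paths m n) q p -> imm_succ (@plt_s B) (paths m n) q' p -> q = q'.
Proof.
move=> mn [pq pp lt im] [pq' _ lt' im'].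
have e : psrc q = psrc q' by rewrite (plt_s_src pq pp lt) (plt_s_src pq' pp lt').
have [//|h|h] := plt_s_total mn pq pq' e.
  by case: (im q' pq').
by case: (im' q pq).
Qed.

(** Together with [Es_inj2] this makes alpha_1 and alpha_2 injective on G, which every computation
    at an end of the interval uses. *)
Lemma Es_inj1 m n (P Q : ppair B) : m < n -> Es m n P -> Es m n Q -> P.1 = Q.1 -> P = Q.
Proof.
case: P Q => [p1 p2] [q1 q2] /= mn [_ _ h] [_ _ h'] /= e; rewrite -e in h' *.
by rewrite (@imm_succ_inj_r _ _ _ p2 q2 mn h h').
Qed.

Lemma Es_inj2 m n (P Q : ppair B) : m < n -> Es m n P -> Es m n Q -> P.2 = Q.2 -> P = Q.
Proof.
case: P Q => [p1 p2] [q1 q2] /= mn [_ _ h] [_ _ h'] /= e; rewrite -e in h' *.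
by rewrite (@imm_succ_inj_l _ _ _ p1 q1 mn h h').
Qed.

Lemma G_sym m n (P Q : ppair B) : G_ m n P Q -> G_ m n Q P.
Proof. by move=> [p q [e1 e2]]; split. Qed.

Lemma G_trans m n (P Q Z : ppair B) : G_ m n P Q -> G_ m n Q Z -> G_ m n P Z.
Proof.
by move=> [p q [e1 e2]] [_ z [f1 f2]]; split; rewrite // e1 e2 f1 f2.
Qed.

End Diagram.

(** * Complex matrices and their norm bounds *)

Section ComplexNumbers.
Variable R : realType.
Local Notation C := R[i].

(** The squared modulus as a real polynomial, so that estimates reduce to [ring], [field] and
    [nra]. *)
Definition sqn (z : C) : R := complex.Re z ^+ 2 + complex.Im z ^+ 2.

Lemma sqn_ge0 z : 0 <= sqn z.
Proof. by rewrite addr_ge0 ?sqr_ge0. Qed.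

Lemma normc_sqn z : Normc.normc z ^+ 2 = sqn z.
Proof. by case: z => a b; rewrite /= sqr_sqrtr // addr_ge0 ?sqr_ge0. Qed.

Lemma normc_ge0 (z : C) : 0 <= Normc.normc z.
Proof. by case: z => a b; exact: sqrtr_ge0. Qed.

Lemma normcE_sqrt (z : C) : Normc.normc z = Num.sqrt (sqn z).
Proof. by case: z. Qed.

Lemma sqn0 : sqn 0 = 0.
Proof. by rewrite /sqn /= expr0n addr0. Qed.

Lemma sqn1 : sqn 1 = 1.
Proof. by rewrite /sqn /= expr0n addr0 expr1n. Qed.

Lemma sqnM y z : sqn (y * z) = sqn y * sqn z.
Proof. by case: y z => a b [c d]; rewrite /sqn /=; ring. Qed.

Lemma sqn_real (a : R) : sqn a%:C = a ^+ 2.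
Proof. by rewrite /sqn /= expr0n addr0. Qed.

Lemma sqn_eq0 z : sqn z = 0 -> z = 0.
Proof.
move=> z0; apply: Normc.eq0_normc; apply/eqP.
by rewrite -sqrf_eq0 normc_sqn z0.
Qed.

Lemma sqn_conj (z : C) : sqn (conjc z) = sqn z.
Proof. by case: z => a b; rewrite /sqn /= sqrrN. Qed.

Lemma normc_conj (z : C) : Normc.normc (conjc z) = Normc.normc z.
Proof. by rewrite !normcE_sqrt sqn_conj. Qed.

Lemma conjCM (y z : C) : conjc (y * z) = conjc y * conjc z.
Proof. exact: (rmorphM (@conjc _)). Qed.

Lemma conjC_sum I (J : seq I) (P : pred I) (F : I -> C) :
  conjc (\sum_(i <- J | P i) F i) = \sum_(i <- J | P i) conjc (F i).
Proof. exact: (rmorph_sum (@conjc _)). Qed.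

Lemma conjCR (a : R) : conjc (a%:C) = a%:C :> C.
Proof. by rewrite /= oppr0. Qed.

Lemma ReD (y z : C) : complex.Re (y + z) = complex.Re y + complex.Re z.
Proof. by case: y z => a b [c d]. Qed.

Lemma ImD (y z : C) : complex.Im (y + z) = complex.Im y + complex.Im z.
Proof. by case: y z => a b [c d]. Qed.

Lemma Re_sum I (J : seq I) (P : pred I) (F : I -> C) :
  complex.Re (\sum_(i <- J | P i) F i) = \sum_(i <- J | P i) complex.Re (F i).
Proof. exact: (big_morph _ ReD). Qed.

Lemma Im_sum I (J : seq I) (P : pred I) (F : I -> C) :
  complex.Im (\sum_(i <- J | P i) F i) = \sum_(i <- J | P i) complex.Im (F i).
Proof. exact: (big_morph _ ImD). Qed.

(** The right side minus the left is |b y - a z|^2 / (a b). It replaces the triangle inequality, the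
    weights being the bounds of the two operators. *)
Lemma sqnD_weighted (a b : R) (y z : C) : 0 < a -> 0 < b ->
  sqn (y + z) <= (a + b) / a * sqn y + (a + b) / b * sqn z.
Proof.
case: y z => y1 y2 [z1 z2] a0 b0; rewrite /sqn /= -subr_ge0.
have -> : (a + b) / a * (y1 ^+ 2 + y2 ^+ 2) + (a + b) / b * (z1 ^+ 2 + z2 ^+ 2) -
  ((y1 + z1) ^+ 2 + (y2 + z2) ^+ 2) =
  ((b * y1 - a * z1) ^+ 2 + (b * y2 - a * z2) ^+ 2) / (a * b).
  by field; rewrite !gt_eqF.
by rewrite divr_ge0 ?addr_ge0 ?sqr_ge0// mulr_ge0// ltW.
Qed.

(** The right side minus the left is |a y - z|^2 / (2 a). *)
Lemma Re_conjM_le (a : R) (y z : C) : 0 < a ->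
  complex.Re (conjc y * z) <= (a * sqn y + sqn z / a) / 2.
Proof.
case: y z => y1 y2 [z1 z2] a0; rewrite /sqn /= -subr_ge0.
have -> : (a * (y1 ^+ 2 + y2 ^+ 2) + (z1 ^+ 2 + z2 ^+ 2) / a) / 2 -
  (y1 * z1 - - y2 * z2) = ((a * y1 - z1) ^+ 2 + (a * y2 - z2) ^+ 2) / (2 * a).
  by field; rewrite gt_eqF.
by rewrite divr_ge0 ?addr_ge0 ?sqr_ge0// mulr_ge0// ltW.
Qed.

Lemma le_eps_mul (t a s : R) : 0 <= s ->
  (forall e, 0 < e -> e <= 1 -> t <= a + e * s) -> t <= a.
Proof.
move=> s0 h; rewrite leNgt; apply/negP => at_.
(* Chosen so that d <= 1 and d * s < t - a. *)
pose d := (t - a) / (s + 1 + (t - a)).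
have D0 : 0 < s + 1 + (t - a) by lra.
have d0 : 0 < d by rewrite divr_gt0 // subr_gt0.
have d1 : d <= 1 by rewrite ler_pdivrMr //; lra.
have := h d d0 d1; rewrite leNgt => /negP; apply.
rewrite -ltrBrDl /d mulrAC ltr_pdivrMr //; nra.
Qed.

End ComplexNumbers.

(** * Matrices indexed by a sequence, with operator norm bounds *)

Section Matrices.
Variables (R : realType) (T : eqType).
Local Notation C := R[i].
Implicit Types (J : seq T) (M N : T -> T -> C) (x y : T -> C).

Definition nrm2 J x : R := \sum_(i <- J) sqn (x i).
Definition mapp J M x : T -> C := fun i => \sum_(j <- J) M i j * x j.
Definition mmul J M N : T -> T -> C := fun i j => \sum_(k <- J) M i k * N k j.
Definition mstar M : T -> T -> C := fun i j => conjc (M j i).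
(** An operator norm bound on l^2(J), expressed without a supremum; only entries indexed by [J]
    matter. *)
Definition mbound J M (c : R) := forall x, nrm2 J (mapp J M x) <= c ^+ 2 * nrm2 J x.

Lemma nrm2_ge0 J x : 0 <= nrm2 J x.
Proof. by apply: sumr_ge0 => i _; exact: sqn_ge0. Qed.

Lemma eq_nrm2 J x y : {in J, x =1 y} -> nrm2 J x = nrm2 J y.
Proof. by move=> xy; apply: eq_big_seq => i iJ; rewrite xy. Qed.

Lemma eq_mbound J M N c : (forall i j, i \in J -> j \in J -> M i j = N i j) ->
  mbound J M c -> mbound J N c.
Proof.
move=> MN h x; rewrite -(@eq_nrm2 _ (mapp J M x)); first exact: h.
by move=> i iJ; apply: eq_big_seq => j jJ; rewrite MN.
Qed.

Lemma nrm2Z J (a : C) x : nrm2 J (fun i => a * x i) = sqn a * nrm2 J x.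
Proof. by rewrite /nrm2 mulr_sumr; apply: eq_bigr => i _; rewrite sqnM. Qed.

Lemma mappZ J (a : C) M x : mapp J M (fun i => a * x i) = fun i => a * mapp J M x i.
Proof.
by apply/funext => i; rewrite /mapp mulr_sumr; apply: eq_bigr => j _; rewrite mulrCA.
Qed.

Lemma nrm2_eq0 J x : nrm2 J x = 0 -> {in J, forall i, x i = 0}.
Proof.
move=> h i iJ; apply: sqn_eq0; apply/eqP; apply: contraT => n0.
have := h; rewrite /nrm2 (big_rem i)//= => h'.
have : 0 < sqn (x i) by rewrite lt_neqAle eq_sym n0 sqn_ge0.
have : 0 <= \sum_(y <- rem i J) sqn (x y) by apply: sumr_ge0 => k _; exact: sqn_ge0.
lra.
Qed.

(** Homogeneity. The reduced norm tests vectors of the unit ball only, and this recovers all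
    vectors. *)
Lemma mbound_unit J M c :
  (forall x, nrm2 J x <= 1 -> nrm2 J (mapp J M x) <= c ^+ 2) -> mbound J M c.
Proof.
move=> h x; have [x0|xn0] := eqVneq (nrm2 J x) 0.
  rewrite x0 mulr0 /nrm2 big1_seq// => i /= iJ.
  rewrite /mapp big1_seq ?sqn0// => j /= jJ.
  by rewrite (nrm2_eq0 x0 jJ) mulr0.
have xp : 0 < nrm2 J x by rewrite lt_neqAle eq_sym xn0 nrm2_ge0.
pose a : C := ((Num.sqrt (nrm2 J x))^-1)%:C.
have sa : sqn a = (nrm2 J x)^-1.
  by rewrite sqn_real exprVn sqr_sqrtr // ltW.
have := h (fun i => a * x i); rewrite nrm2Z sa mulVf// => /(_ (lexx _)).
by rewrite mappZ nrm2Z sa mulrC ler_pdivrMr.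
Qed.

(** Allows bounds to be taken strictly positive, so that one may divide by them as in
    [sqnD_weighted]. *)
Lemma mbound_approx J M c : 0 <= c -> (forall e, 0 < e -> mbound J M (c + e)) ->
  mbound J M c.
Proof.
move=> c0 h x.
(* For e <= 1 one has (c + e)^2 <= c^2 + e (2 c + 1). *)
apply: (@le_eps_mul _ _ _ ((2 * c + 1) * nrm2 J x)).
  by rewrite mulr_ge0 ?nrm2_ge0// addr_ge0 ?mulr_ge0.
move=> e e0 e1; apply: (le_trans (h e e0 x)); rewrite -subr_ge0.
have -> : c ^+ 2 * nrm2 J x + e * ((2 * c + 1) * nrm2 J x) - (c + e) ^+ 2 * nrm2 J x =
  e * (1 - e) * nrm2 J x by ring.
by rewrite mulr_ge0 ?nrm2_ge0// mulr_ge0 ?subr_ge0// ltW.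
Qed.

Lemma mbound_le J M a b : 0 <= a -> a <= b -> mbound J M a -> mbound J M b.
Proof.
move=> a0 ab h x; apply: (le_trans (h x)); apply: ler_wpM2r; first exact: nrm2_ge0.
by rewrite lerXn2r ?nnegrE// (le_trans a0).
Qed.

(** With the bounds themselves as weights nothing is lost: (a + b) / a * a^2 + (a + b) / b * b^2 =
    (a + b)^2. *)
Lemma mboundD J M N a b : 0 <= a -> 0 <= b -> mbound J M a -> mbound J N b ->
  mbound J (fun i j => M i j + N i j) (a + b).
Proof.
move=> a0 b0 hM hN; apply: mbound_approx; first exact: addr_ge0.
move=> e e0; pose a' := a + e / 2; pose b' := b + e / 2.
have a'0 : 0 < a' by rewrite /a'; lra.
have b'0 : 0 < b' by rewrite /b'; lra.
have hM' : mbound J M a' by apply: mbound_le hM => //; rewrite /a'; lra.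
have hN' : mbound J N b' by apply: mbound_le hN => //; rewrite /b'; lra.
have -> : a + b + e = a' + b' by rewrite /a' /b'; field.
move=> x.
apply: (@le_trans _ _ ((a' + b') / a' * nrm2 J (mapp J M x) +
                       (a' + b') / b' * nrm2 J (mapp J N x))).
  rewrite /nrm2 !mulr_sumr -big_split /=; apply: ler_sum => i _.
  rewrite /mapp (eq_bigr (fun j => M i j * x j + N i j * x j)); last first.
    by move=> j _; rewrite mulrDl.
  by rewrite big_split; exact: sqnD_weighted.
have -> : (a' + b') ^+ 2 * nrm2 J x = (a' + b') / a' * (a' ^+ 2 * nrm2 J x) +
    (a' + b') / b' * (b' ^+ 2 * nrm2 J x) by field; rewrite !gt_eqF.
apply: lerD; apply: ler_wpM2l; [|exact: hM'| |exact: hN'];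
  by (apply: divr_ge0; [apply: addr_ge0|]); exact: ltW.
Qed.

Lemma mapp_mmul J M N x i : mapp J (mmul J M N) x i = mapp J M (mapp J N x) i.
Proof.
rewrite /mapp /mmul.
under eq_bigr do rewrite mulr_suml.
rewrite exchange_big /=; apply: eq_bigr => k _; rewrite mulr_sumr.
by apply: eq_bigr => j _; rewrite mulrA.
Qed.

Lemma mboundM J M N a b : mbound J M a -> mbound J N b ->
  mbound J (mmul J M N) (a * b).
Proof.
move=> hM hN x; rewrite (@eq_nrm2 _ _ (mapp J M (mapp J N x))); last first.
  by move=> i _; exact: mapp_mmul.
apply: (le_trans (hM _)); rewrite [(a * b) ^+ 2]exprMn -[leRHS]mulrA.
by apply: ler_wpM2l; [exact: sqr_ge0|exact: hN].
Qed.

Lemma mboundZ J M (z : C) c : mbound J M c ->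
  mbound J (fun i j => z * M i j) (Normc.normc z * c).
Proof.
move=> h x; rewrite (@eq_nrm2 _ _ (fun i => z * mapp J M x i)); last first.
  by move=> i _; rewrite /mapp mulr_sumr; apply: eq_bigr => j _; rewrite mulrA.
by rewrite nrm2Z exprMn normc_sqn -mulrA ler_wpM2l// sqn_ge0.
Qed.

(* ||M x||^2 = <x, M^* M x>, and the arithmetic-geometric mean inequality
   replaces Cauchy-Schwarz. *)
Lemma mbound_mstar_mmul J M c : 0 <= c -> mbound J (mmul J (mstar M) M) c ->
  mbound J M (Num.sqrt c).
Proof.
move=> c0 h x; rewrite sqr_sqrtr//.
have -> : nrm2 J (mapp J M x) =
    complex.Re (\sum_(k <- J) conjc (x k) * mapp J (mmul J (mstar M) M) x k).
  transitivity (complex.Re (\sum_(i <- J) conjc (mapp J M x i) * mapp J M x i)).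
    rewrite Re_sum; apply: eq_bigr => i _.
    by case: (mapp J M x i) => a b; rewrite /sqn /=; ring.
  congr complex.Re.
  rewrite (eq_bigr (fun i => \sum_(k <- J) conjc (x k) * (mstar M k i * mapp J M x i))).
    rewrite exchange_big /=; apply: eq_bigr => k _.
    by rewrite -mulr_sumr mapp_mmul.
  move=> i _; rewrite {1}/mapp conjC_sum mulr_suml; apply: eq_bigr => k _.
  by rewrite conjCM mulrA [conjc (x k) * _]mulrC.
apply: (@le_eps_mul _ _ _ (nrm2 J x)); first exact: nrm2_ge0.
move=> e e0 _; have ce : 0 < c + e by lra.
have hx := h x; have nx := nrm2_ge0 J x.
apply: (@le_trans _ _ (((c + e) * nrm2 J x +
    nrm2 J (mapp J (mmul J (mstar M) M) x) / (c + e)) / 2)).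
  rewrite Re_sum /nrm2 mulr_sumr mulr_suml -big_split /= mulr_suml.
  by apply: ler_sum => k _; exact: Re_conjM_le.
have : nrm2 J (mapp J (mmul J (mstar M) M) x) / (c + e) <= c * nrm2 J x.
  rewrite ler_pdivrMr//; apply: (le_trans hx).
  rewrite -subr_ge0 (_ : _ - _ = (c * e) * nrm2 J x); last by ring.
  by rewrite mulr_ge0// mulr_ge0// ltW.
nra.
Qed.

(** Apply the bound to the j-th basis vector and keep only the i-th coordinate of the image. *)
Lemma mbound_entry J M c i j : uniq J -> i \in J -> j \in J -> 0 <= c ->
  mbound J M c -> Normc.normc (M i j) <= c.
Proof.
move=> uJ iJ jJ c0 h; have := h (fun k => (k == j)%:R).
have -> : nrm2 J (fun k => (k == j)%:R) = 1.
  rewrite /nrm2 (bigD1_seq j)//= eqxx sqn1 big1 ?addr0// => k /negbTE ->.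
  by rewrite sqn0.
rewrite mulr1 => h1.
have : sqn (M i j) <= c ^+ 2.
  apply: le_trans h1; rewrite /nrm2 (bigD1_seq i)//=.
  have -> : mapp J M (fun k => (k == j)%:R) i = M i j.
    rewrite /mapp (bigD1_seq j)//= eqxx mulr1 big1 ?addr0// => k /negbTE ->.
    by rewrite mulr0.
  by rewrite lerDl; apply: sumr_ge0 => k _; exact: sqn_ge0.
rewrite -normc_sqn ler_sqr ?nnegrE//; exact: normc_ge0.
Qed.

(** Cauchy-Schwarz against the constant vector 1, by induction. *)
Lemma sqr_sum_le J (a : T -> R) :
  (\sum_(i <- J) a i) ^+ 2 <= (size J)%:R * \sum_(i <- J) a i ^+ 2.
Proof.
elim: J => [|i J IH]; first by rewrite !big_nil expr0n mulr0.
rewrite !big_cons /=.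
have h : 2 * (a i * \sum_(j <- J) a j) <=
    (size J)%:R * a i ^+ 2 + \sum_(j <- J) a j ^+ 2.
  elim: J {IH} => [|j J IH]; first by rewrite !big_nil !mulr0 mul0r addr0.
  rewrite !big_cons /= -natr1; have := sqr_ge0 (a i - a j); nra.
rewrite -natr1; move: IH h.
set S := \sum_(j <- J) a j; set Q := \sum_(j <- J) a j ^+ 2; set n := (size J)%:R.
nra.
Qed.

Lemma normc_sum_le J x : Normc.normc (\sum_(i <- J) x i) <= \sum_(i <- J) Normc.normc (x i).
Proof.
elim: J => [|i J IH]; first by rewrite !big_nil Normc.normc0.
by rewrite !big_cons; apply: (le_trans (le_normcD _ _)); rewrite lerD2l.
Qed.

(** Cauchy-Schwarz in every row. The crude constant is enough to compare the norm with the supremum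
    of the entries. *)
Lemma mbound_of_entries J M c : 0 <= c ->
  (forall i j, i \in J -> j \in J -> Normc.normc (M i j) <= c) ->
  mbound J M (c * (size J)%:R).
Proof.
move=> c0 h x.
have hi i : i \in J -> sqn (mapp J M x i) <= c ^+ 2 * ((size J)%:R * nrm2 J x).
  move=> iJ; rewrite -normc_sqn.
  apply: (@le_trans _ _ ((c * \sum_(j <- J) Normc.normc (x j)) ^+ 2)).
    rewrite lerXn2r ?nnegrE ?normc_ge0//.
      by rewrite mulr_ge0 // sumr_ge0 // => j _; exact: normc_ge0.
    apply: (le_trans (normc_sum_le _ _)); rewrite mulr_sumr.
    rewrite !big_seq; apply: ler_sum => j jJ.
    by rewrite Normc.normcM ler_wpM2r ?normc_ge0// h.
  rewrite exprMn; apply: ler_wpM2l; first exact: sqr_ge0.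
  apply: (le_trans (sqr_sum_le _ _)).
  by under eq_bigr do rewrite normc_sqn.
rewrite {1}/nrm2 big_seq.
apply: (@le_trans _ _ (\sum_(i <- J | i \in J) c ^+ 2 * ((size J)%:R * nrm2 J x))).
  exact: ler_sum.
rewrite -big_seq big_const_seq count_predT iter_addr_0 -mulr_natl.
by rewrite exprMn le_eqVlt; apply/orP; left; apply/eqP; ring.
Qed.

End Matrices.

(** * The state, the measures on rays and the map phi_s *)

Section EdgeSets.
Variable B : bratteli.
Local Notation V := (vertex B).
Local Notation E := (edge B).
Local Notation r := (@rng B).
Local Notation s := (@src B).

Lemma edges_countable : countable [set: E].
Proof.
have -> : [set: E] = \bigcup_(n in [set: int]) [set e : E | elevel e = n].
  by apply/seteqP; split => e // _; exists (elevel e).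
by apply: bigcup_countable => // n _; exact/finite_set_countable/edges_finite.
Qed.

Lemma finite_in_edges (v : V) : finite_set [set e | r e = v].
Proof.
apply: (@sub_finite_set _ _ [set e | elevel e = vlevel v]); last exact: edges_finite.
by move=> e /= <-; rewrite rng_level.
Qed.

(** The generators fix a single edge. There are countably many edges, so any condition on the k-th
    edge is a countable union of generators, indexed through an injection [f] into the naturals. *)
Lemma measurable_ray_coord (k : nat) (Q : set E) :
  measurable ([set w : ray B | Q (w k)] : set (ray_mspace B)).
Proof.
have /countable_injP[f fi] := edges_countable.
have -> : [set w : ray B | Q (w k)] =
    \bigcup_(j in [set j | exists2 e, Q e & f e = j]) [set w : ray B | f (w k) = j].
  apply/seteqP; split=> [w Qw|w [j [e Qe fe] /= we]].
    by exists (f (w k)) => //; exists (w k).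
  by rewrite (fi (w k) e) ?inE// we fe.
apply: bigcup_measurable => j [e Qe <-].
have -> : [set w : ray B | f (w k) = f e] = [set w | w k = e].
  by apply/seteqP; split => w /= => [h|->//]; apply: fi; rewrite ?inE.
by apply: sub_sigma_algebra; exists k, e.
Qed.

Lemma measurable_bipath_coord (k : int) (Q : set E) :
  measurable ([set w : bipath B | Q (w k)] : set (bipath_mspace B)).
Proof.
have /countable_injP[f fi] := edges_countable.
have -> : [set w : bipath B | Q (w k)] =
    \bigcup_(j in [set j | exists2 e, Q e & f e = j]) [set w : bipath B | f (w k) = j].
  apply/seteqP; split=> [w Qw|w [j [e Qe fe] /= we]].
    by exists (f (w k)) => //; exists (w k).
  by rewrite (fi (w k) e) ?inE// we fe.
apply: bigcup_measurable => j [e Qe <-].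
have -> : [set w : bipath B | f (w k) = f e] = [set w | w k = e].
  by apply/seteqP; split => w /= => [h|->//]; apply: fi; rewrite ?inE.
by apply: sub_sigma_algebra; exists k, e.
Qed.

Lemma measurable_ray_step (k : nat) :
  measurable ([set w : ray B | r (w k) = s (w k.+1)] : set (ray_mspace B)).
Proof.
have /countable_injP[f fi] := edges_countable.
have -> : [set w : ray B | r (w k) = s (w k.+1)] = \bigcup_(j in [set: nat])
    ([set w : ray B | f (w k) = j] `&`
     [set w : ray B | exists2 e, f e = j & r e = s (w k.+1)]).
  apply/seteqP; split=> [w /= h|w [j _ [/= wj [e ej <-]]]].
    by exists (f (w k)) => //; split => //; exists (w k).
  by rewrite (fi (w k) e) ?inE// wj ej.
apply: bigcup_measurable => j _; apply: measurableI.
  exact: (measurable_ray_coord k [set e | f e = j]).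
exact: (measurable_ray_coord k.+1 [set g | exists2 e, f e = j & r e = s g]).
Qed.

Lemma measurable_bipath_step (k l : int) :
  measurable ([set w : bipath B | r (w k) = s (w l)] : set (bipath_mspace B)).
Proof.
have /countable_injP[f fi] := edges_countable.
have -> : [set w : bipath B | r (w k) = s (w l)] = \bigcup_(j in [set: nat])
    ([set w : bipath B | f (w k) = j] `&`
     [set w : bipath B | exists2 e, f e = j & r e = s (w l)]).
  apply/seteqP; split=> [w /= h|w [j _ [/= wj [e ej <-]]]].
    by exists (f (w k)) => //; split => //; exists (w k).
  by rewrite (fi (w k) e) ?inE// wj ej.
apply: bigcup_measurable => j _; apply: measurableI.
  exact: (measurable_bipath_coord k [set e | f e = j]).
exact: (measurable_bipath_coord l [set g | exists2 e, f e = j & r e = s g]).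
Qed.

Lemma measurable_Xplus (v : V) : measurable (Xplus v : set (ray_mspace B)).
Proof.
have -> : Xplus v = [set w : ray B | s (w 0%N) = v] `&`
    \bigcap_(k in [set: nat]) [set w : ray B | r (w k) = s (w k.+1)].
  by apply/seteqP; split=> w [w0 wS]; split => // k; [move=> _|]; apply: wS.
apply: measurableI; first exact: (measurable_ray_coord 0 [set e | s e = v]).
by apply: bigcap_measurableType => k _; exact: measurable_ray_step.
Qed.

Lemma measurable_X : measurable (@X_ B : set (bipath_mspace B)).
Proof.
(* The integers are enumerated as j and -j, to have an intersection over the naturals. *)
have -> : @X_ B = \bigcap_(j in [set: nat]) \bigcap_(b in [set: bool])
    let k := if b then j%:Z else - j%:Z in
    ([set x : bipath B | elevel (x k) = k] `&`
    [set x : bipath B | r (x k) = s (x (k + 1))]).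
  apply/seteqP; split=> [x Xx j _ b _ /=|x h k]; first exact: Xx.
  have [k0|k0] := leP 0 k.
    have := h `|k|%N I true I; rewrite /= (_ : `|k|%:Z = k) ?gez0_abs//.
  have := h `|k|%N I false I; rewrite /= (_ : - `|k|%:Z = k)//; lia.
apply: bigcap_measurableType => j _.
apply: fin_bigcap_measurable => // b _.
set k := if b then _ else _; apply: measurableI.
  exact: (measurable_bipath_coord k [set e | elevel e = k]).
exact: measurable_bipath_step.
Qed.

(** The edges 0, ..., k are fixed, so the prefix has k + 1 edges; when [w] lies in [Xplus v] the
    mass is nu_s at the end of the edge [w k]. *)
Definition ray_cyl (v : V) (w : ray B) (k : nat) : set (ray B) :=
  [set y | Xplus v y /\ forall i, (i <= k)%N -> y i = w i].

Lemma measurable_ray_cyl v w k : measurable (ray_cyl v w k : set (ray_mspace B)).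
Proof.
have -> : ray_cyl v w k =
    Xplus v `&` \bigcap_(i in `I_k.+1) [set y : ray B | y i = w i].
  by apply/seteqP; split=> y [Xy h]; split => // i ik; apply: h.
apply: measurableI; first exact: measurable_Xplus.
apply: fin_bigcap_measurable => // i _.
exact: (measurable_ray_coord i [set e | e = w i]).
Qed.

Definition ray_below (v : V) (w : ray B) : set (ray B) :=
  [set y | Xplus v y /\ wle_s y w].

(** [wle_s] means equality or a first strictly smaller edge, that is, countably many conditions on
    coordinates. *)
Lemma measurable_ray_below v w : measurable (ray_below v w : set (ray_mspace B)).
Proof.
have -> : ray_below v w = Xplus v `&`
    ((\bigcap_(i in [set: nat]) [set y : ray B | y i = w i]) `|`
    (\bigcup_(i in [set: nat]) ((\bigcap_(j in `I_i) [set y : ray B | y j = w j]) `&`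
       [set y : ray B | lt_s (y i) (w i)]))).
  apply/seteqP; split=> [y [Xy [yw|[i [h lt]]]]|y [Xy [h|[i _ [h lt]]]]].
  - by split => //; left => i _; rewrite /= yw.
  - by split => //; right; exists i.
  - split => //; left; apply/funext => i; exact: h.
  - by split => //; right; exists i.
apply: measurableI; first exact: measurable_Xplus.
apply: measurableU.
  apply: bigcap_measurableType => i _.
  exact: (measurable_ray_coord i [set e | e = w i]).
apply: bigcup_measurable => i _; apply: measurableI; last first.
  exact: (measurable_ray_coord i [set e | lt_s e (w i)]).
apply: bigcap_measurableType => j _.
exact: (measurable_ray_coord j [set e | e = w j]).
Qed.

Lemma wle_s_total v (x y : ray B) : Xplus v x -> Xplus v y ->
  x = y \/ exists i, (forall j, (j < i)%N -> x j = y j) /\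
    (lt_s (x i) (y i) \/ lt_s (y i) (x i)).
Proof.
move=> [x0 xS] [y0 yS].
have [h|/existsNP h] := pselect (forall i, x i = y i); first by left; apply/funext.
have {}h : exists i, x i != y i by case: h => i /eqP; exists i.
right; case: (ex_minnP h) => i ne imin; exists i.
have eqj j : (j < i)%N -> x j = y j.
  by move=> ji; apply: contrapT => /eqP /imin; rewrite leqNgt ji.
split => //.
have se : s (x i) = s (y i).
  case: i => [|i] in ne imin eqj *; first by rewrite x0.
  by rewrite -xS -yS eqj.
have [/eqP|l|l] := lt_s_total se; [by rewrite (negbTE ne)|by left|by right].
Qed.

Lemma wle_s_trans (x y z : ray B) : wle_s x y -> wle_s y z -> wle_s x z.
Proof.
move=> [->//|[i [h l]]] [<-|[j [h' l']]]; first by right; exists i.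
right; have [ij|ji|ij] := ltngtP i j.
- exists i; split; last by rewrite -h'.
  by move=> k ki; rewrite h// h'// (ltn_trans ki).
- exists j; split; last by rewrite h.
  by move=> k kj; rewrite h ?h'// (ltn_trans kj).
- subst j; exists i; split; last exact: lt_s_trans l'.
  by move=> k ki; rewrite h ?h'.
Qed.

Lemma wle_s_anti (x y : ray B) i : (forall j, (j < i)%N -> x j = y j) ->
  lt_s (x i) (y i) -> ~ wle_s y x.
Proof.
move=> h l [yx|[j [h' l']]]; first by rewrite yx in l; exact: lt_s_irrefl l.
have [ij|ji|ij] := ltngtP i j.
- by rewrite (h' _ ij) in l; exact: lt_s_irrefl l.
- by rewrite (h _ ji) in l'; exact: lt_s_irrefl l'.
- by subst j; exact: lt_s_irrefl (lt_s_trans l l').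
Qed.

Lemma wle_s_smax v (y : ray B) : Xplus v y -> wle_s y (ray_smax v).
Proof.
move=> Xy; have [Xm mx] := ray_smaxP v.
have [->|[i [h [l|l]]]] := wle_s_total Xy Xm; [by left|by right; exists i|].
by case: (mx i) => _ /(_ (y i) I).
Qed.

Lemma wle_s_smin v (y : ray B) : Xplus v y -> wle_s y (ray_smin v) -> y = ray_smin v.
Proof.
move=> Xy [//|[i [h l]]]; have [Xm mx] := ray_sminP v.
by case: (mx i) => _ /(_ (y i) I).
Qed.

End EdgeSets.

Lemma ler_fsum_single (R : realDomainType) (I : choiceType) (A : set I) (F : I -> R) i :
  finite_set A -> A i -> (forall j, 0 <= F j) -> F i <= \sum_(j \in A) F j.
Proof.
move=> fA Ai F0; rewrite (fsbigD1 i)//= lerDl; exact: fsumr_ge0.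
Qed.

(** * Positivity of states, decay of masses and the function phi *)

Section State.
Variables (R : realType) (B : bratteli).
Local Notation V := (vertex B).
Local Notation E := (edge B).
Local Notation r := (@rng B).
Local Notation s := (@src B).
Variables (nu_r nu_s : V -> R).
Hypotheses (hB : standing_assumptions B) (hnu : is_state nu_r nu_s).

Lemma nu_r_edge (e : E) : nu_r (s e) <= nu_r (r e).
Proof.
rewrite (state_rE hnu (r e)).
apply: (@ler_fsum_single _ _ _ (fun e => nu_r (s e))) => //.
  exact: finite_in_edges.
by move=> f; exact: state_r_ge0 hnu _.
Qed.

Lemma nu_s_edge (e : E) : nu_s (r e) <= nu_s (s e).
Proof.
rewrite (state_sE hnu (s e)).
apply: (@ler_fsum_single _ _ _ (fun e => nu_s (r e))) => //.
  exact: finite_out_edges.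
by move=> f; exact: state_s_ge0 hnu _.
Qed.

Lemma path_homo (f : V -> R) m n p : m < n -> (forall e, f (s e) <= f (r e)) ->
  paths m n p -> f (psrc p) <= f (prng p).
Proof.
move=> mn hf /pathsP[sz lv rs].
have p0 : (0 < size p)%N by rewrite sz; lia.
suff h i : (i < size p)%N -> f (psrc p) <= f (r (nth point p i)).
  by rewrite /prng -nth_last; apply: h; rewrite prednK.
elim: i => [|i IH] ip; first by rewrite /psrc -nth0.
apply: (le_trans (IH (ltnW ip))); rewrite rs//.
Qed.

(** Some vertex has positive mass. The state equation passes positivity to a source one level down,
    and monotonicity along edges passes it up, so every level has a positive vertex. Strong
    simplicity joins such a vertex, at a level below [v], to [v] by a path, along which [nu_r] does
    not decrease. *)
Lemma nu_r_gt0 (v : V) : 0 < nu_r v.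
Proof.
have [u /eqP u0] := state_r_neq0 hnu.
have up : 0 < nu_r u by rewrite lt_neqAle eq_sym u0 (state_r_ge0 hnu).
have down (k : nat) : exists2 w, vlevel w = vlevel u - k%:Z & 0 < nu_r w.
  elim: k => [|k [w wk w0]]; first by exists u => //; lia.
  have : exists2 e, r e = w & 0 < nu_r (s e).
    apply: contrapT => /forall2NP h; move: w0; rewrite (state_rE hnu) fsbig1 ?ltxx//.
    move=> e /= ew; case: (h e) => // /negP; rewrite -leNgt => h'.
    by apply/eqP; rewrite eq_le h' (state_r_ge0 hnu).
  move=> [e ew e0]; exists (s e) => //; rewrite src_level -rng_level ew; lia.
have upw (k : nat) : exists2 w, vlevel w = vlevel u + k%:Z & 0 < nu_r w.
  elim: k => [|k [w wk w0]]; first by exists u => //; lia.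
  have [e ew] := src_surj w; exists (r e).
    have := src_level e; rewrite rng_level ew; lia.
  by apply: lt_le_trans (nu_r_edge e); rewrite ew.
have any (j : int) : exists2 w, vlevel w = j & 0 < nu_r w.
  have [uj|ju] := leP (vlevel u) j.
    by have [w wk w0] := upw `|j - vlevel u|%N; exists w => //; lia.
  by have [w wk w0] := down `|j - vlevel u|%N; exists w => //; lia.
case: hB => _ ss _ _; have [l [n [lm mn hl _]]] := ss (vlevel v).
have [w wl w0] := any l.
have [p [_ [pp _ _ [ps pr] _]]] := hl w v wl erefl.
rewrite -pr; apply: lt_le_trans (path_homo lm nu_r_edge pp); by rewrite ps.
Qed.

(** The two directions exchange roles: [nu_s] does not increase along edges, so a positive vertex
    reached from [v] bounds the value at [v] from below. *)
Lemma nu_s_gt0 (v : V) : 0 < nu_s v.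
Proof.
have [u /eqP u0] := state_s_neq0 hnu.
have up : 0 < nu_s u by rewrite lt_neqAle eq_sym u0 (state_s_ge0 hnu).
have upw (k : nat) : exists2 w, vlevel w = vlevel u + k%:Z & 0 < nu_s w.
  elim: k => [|k [w wk w0]]; first by exists u => //; lia.
  have : exists2 e, s e = w & 0 < nu_s (r e).
    apply: contrapT => /forall2NP h; move: w0; rewrite (state_sE hnu) fsbig1 ?ltxx//.
    move=> e /= ew; case: (h e) => // /negP; rewrite -leNgt => h'.
    by apply/eqP; rewrite eq_le h' (state_s_ge0 hnu).
  move=> [e ew e0]; exists (r e) => //; have := src_level e; rewrite rng_level ew; lia.
have down (k : nat) : exists2 w, vlevel w = vlevel u - k%:Z & 0 < nu_s w.
  elim: k => [|k [w wk w0]]; first by exists u => //; lia.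
  have [e ew] := rng_surj w; exists (s e).
    rewrite src_level -rng_level ew; lia.
  by apply: lt_le_trans (nu_s_edge e); rewrite ew.
have any (j : int) : exists2 w, vlevel w = j & 0 < nu_s w.
  have [uj|ju] := leP (vlevel u) j.
    by have [w wk w0] := upw `|j - vlevel u|%N; exists w => //; lia.
  by have [w wk w0] := down `|j - vlevel u|%N; exists w => //; lia.
case: hB => _ ss _ _; have [l [n [lm mn _ hn]]] := ss (vlevel v).
have [w wl w0] := any n.
have [p [_ [pp _ _ [ps pr] _]]] := hn v w erefl wl.
(* The sign turns the decreasing function [nu_s] into one that increases along edges. *)
have := @path_homo (fun v => - nu_s v) _ _ _ mn _ pp.
rewrite ps pr => h; apply: (lt_le_trans w0); rewrite -lerN2; apply: h.
by move=> e; rewrite lerN2; exact: nu_s_edge.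
Qed.

Variable mu : V -> {measure set (ray_mspace B) -> \bar R}.
Hypothesis hmu : is_ray_measure nu_s mu.

Lemma mu_path m n p : m < n -> paths m n p ->
  mu (psrc p) [set w | Xplus (psrc p) w /\ [seq w i | i <- iota 0 (size p)] = p] =
  (nu_s (prng p))%:E.
Proof. by move=> mn pp; have [_ h] := hmu (psrc p); exact: h pp erefl. Qed.

Lemma measurable_mu_path (v : V) (p : seq E) : measurable
  ([set w : ray B | Xplus v w /\ [seq w i | i <- iota 0 (size p)] = p] : set (ray_mspace B)).
Proof.
have [->|/set0P[w [Xw wp]]] := eqVneq [set w : ray B | Xplus v w /\
  [seq w i | i <- iota 0 (size p)] = p] set0; first exact: measurable0.
have -> : [set w : ray B | Xplus v w /\ [seq w i | i <- iota 0 (size p)] = p] =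
  Xplus v `&` \bigcap_(i in `I_(size p)) [set y : ray B | y i = w i].
  apply/seteqP; split=> y [Xy h]; split => //.
    move=> i /= ip; have := congr1 (fun t => nth point t i) (etrans h (esym wp)).
    by rewrite !(nth_map 0%N) ?size_iota// nth_iota.
  apply: etrans wp; apply/eq_in_map => i; rewrite mem_iota add0n => ip.
  exact: h.
apply: measurableI; first exact: measurable_Xplus.
apply: fin_bigcap_measurable => // i _.
exact: (measurable_ray_coord i [set e | e = w i]).
Qed.

Lemma mu_ray_cyl v w k : Xplus v w -> mu v (ray_cyl v w k) = (nu_s (r (w k)))%:E.
Proof.
move=> Xw; pose p := [seq w i | i <- iota 0 k.+1].
have sp : size p = k.+1 by rewrite size_map size_iota.
have np i : (i < k.+1)%N -> nth point p i = w i.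
  by move=> ik; rewrite (nth_map 0%N) ?size_iota// nth_iota.
have pp : paths (vlevel v) (vlevel v + k.+1%:Z) p.
  apply/pathsP; rewrite sp; split; first by lia.
    by move=> i ik; rewrite np// (Xplus_level _ Xw).
  by move=> i ik; rewrite !np//; [case: Xw|exact: ltnW].
have ps : psrc p = v by rewrite /psrc -nth0 np//; case: Xw.
have pr : prng p = r (w k) by rewrite /prng -nth_last sp /= np.
have := @mu_path _ _ _ _ pp; rewrite ps pr => <-; last by lia.
congr (mu v _); apply/seteqP; split=> y [Xy h]; split => //.
  rewrite sp; apply/eq_in_map => i; rewrite mem_iota add0n => /andP[_ ik].
  exact: h.
move=> i ik; have := congr1 (fun t => nth point t i) h; rewrite np//.
by rewrite sp (nth_map 0%N) ?size_iota// nth_iota.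
Qed.

(** [is_ray_measure] prescribes masses of nonempty paths only, so the total mass is obtained by
    splitting along the first edge and summing with the state equation. *)
Lemma mu_Xplus v : mu v (Xplus v) = (nu_s v)%:E.
Proof.
have cylE e : s e = v -> exists w, [/\ Xplus v w, w 0%N = e &
    [set y : ray B | Xplus v y /\ y 0%N = e] = ray_cyl v w 0].
  move=> ev; have [Xm _] := ray_smaxP (r e).
  exists (fun k => if k is k'.+1 then ray_smax (r e) k' else e); split => //.
    by split=> // [[|k]]; case: Xm.
  apply/seteqP; split=> y [Xy h]; split => //; last exact: h.
  by move=> i; rewrite leqn0 => /eqP ->.
have -> : Xplus v = \bigcup_(e in [set e | s e = v]) [set y : ray B | Xplus v y /\ y 0%N = e].
  apply/seteqP; split=> [y Xy|y [e _ []//]].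
  by exists (y 0%N) => //; case: Xy.
rewrite measure_fin_bigcup.
- rewrite (state_sE hnu v) -fsumEFin; last exact: finite_out_edges.
  apply: eq_fsbigr => e /[!inE] /= ev; have [w [Xw <- ->]] := cylE e ev.
  exact: mu_ray_cyl.
- exact: finite_out_edges.
- by move=> e f /= _ _ [y [[_ <-] [_ <-]]].
- move=> e ev; have [w [_ _ ->]] := cylE e ev; exact: measurable_ray_cyl.
Qed.

(** The two paths define disjoint cylinders in [Xplus v], each of mass [nu_s w]. *)
Lemma nu_s_two_paths m n v w : m < n -> two_paths B m n -> level_vertices m v ->
  level_vertices n w -> 2 * nu_s w <= nu_s v.
Proof.
move=> mn tp vm wn; have [p [q [pp qq pq [ps pr] [qs qr]]]] := tp v w vm wn.
have sz : size p = size q by have [-> _ _] := (pathsP _ _ _).1 pp; have [-> _ _] := (pathsP _ _ _).1 qq.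
have hP := mu_path mn pp; have hQ := mu_path mn qq.
rewrite ps pr in hP; rewrite qs qr in hQ.
rewrite -lee_fin -(mu_Xplus v) mulr2n mulrDl mul1r EFinD -{1}hP -hQ -measureU.
- apply: le_measure; rewrite ?inE.
  + by apply: measurableU; exact: measurable_mu_path.
  + exact: measurable_Xplus.
  + by move=> y [[]|[]].
- exact: measurable_mu_path.
- exact: measurable_mu_path.
- apply/seteqP; split=> // y [[_ h1] [_ h2]]; apply: pq.
  rewrite -sz in h2.
  exact: etrans (esym h1) h2.
Qed.

(** By [nu_s_two_paths], masses are at least halved from one suitable level to the next, uniformly
    over the vertices of that level. *)
Lemma nu_s_small v (e : R) : 0 < e ->
  exists k, forall w, Xplus v w -> nu_s (r (w k)) < e.
Proof.
move=> e0; case: hB => _ ss _ _.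
have step (j : nat) : exists2 n, vlevel v < n &
    forall u, vlevel u = n -> nu_s u * 2 ^+ j <= nu_s v.
  elim: j => [|j [n vn IH]].
    have [_ [n [_ mn _ tp]]] := ss (vlevel v); exists n => // u un.
    have := nu_s_two_paths mn tp erefl un; have := nu_s_gt0 u; rewrite expr0; lra.
  have [_ [n' [_ mn _ tp]]] := ss n; exists n'; first exact: lt_trans mn.
  (* Any vertex of the intermediate level may serve, since there are two paths from each such vertex
     to [u]. *)
  move=> u un'; have [w wn] := @vertices_nonempty B n.
  apply: le_trans (IH w wn); rewrite exprS mulrA; apply: ler_wpM2r.
    by rewrite exprn_ge0.
  by rewrite mulrC; exact: nu_s_two_paths tp wn un'.
(* The Archimedean property together with j < 2^j. *)
have [j hj] : exists j : nat, nu_s v / e < 2 ^+ j.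
  exists (Num.bound (nu_s v / e)).
  apply: lt_trans (archi_boundP _) _; first by rewrite divr_ge0 ?(state_s_ge0 hnu)// ltW.
  by rewrite -natrX ltr_nat ltn_expl.
(* The edge of index k of a ray from [v] ends at level [vlevel v + k + 1], hence the predecessor. *)
have [n vn hn] := step j; exists (`|n - vlevel v|.-1)%N => w Xw.
have lw : vlevel (r (w (`|n - vlevel v|.-1)%N)) = n.
  by rewrite rng_level (Xplus_level _ Xw); lia.
have := hn _ lw; rewrite ltr_pdivrMr// in hj => h.
have p2 : 0 < 2 ^+ j :> R by rewrite exprn_gt0.
by rewrite -(ltr_pM2r p2) [ltRHS]mulrC; exact: le_lt_trans hj.
Qed.

Local Notation phi := (phi_s mu).

Lemma mu_fin v (A : set (ray B)) : measurable (A : set (ray_mspace B)) ->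
  A `<=` Xplus v -> mu v A \is a fin_num.
Proof.
move=> mA AX; rewrite ge0_fin_numE//.
apply: (@le_lt_trans _ _ (mu v (Xplus v))); last by rewrite mu_Xplus ltry.
by apply: le_measure; rewrite ?inE //; exact: measurable_Xplus.
Qed.

Lemma phi_mu v w : ((phi v w)%:E = mu v (ray_below v w))%E.
Proof.
rewrite /phi_s fineK//; apply: mu_fin; first exact: measurable_ray_below.
by move=> y [].
Qed.

Lemma phi_ge0 v w : 0 <= phi v w.
Proof. by rewrite -lee_fin phi_mu. Qed.

Lemma phi_le v w : phi v w <= nu_s v.
Proof.
rewrite -lee_fin phi_mu -mu_Xplus; apply: le_measure; rewrite ?inE.
- exact: measurable_ray_below.
- exact: measurable_Xplus.
- by move=> y [].
Qed.

Lemma phi_smax v : phi v (ray_smax v) = nu_s v.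
Proof.
apply: EFin_inj; rewrite phi_mu -mu_Xplus; congr (mu v _).
by apply/seteqP; split=> y => [[]//|Xy]; split => //; exact: wle_s_smax.
Qed.

Lemma phi_mono v w w' : wle_s w w' -> phi v w <= phi v w'.
Proof.
move=> ww; rewrite -lee_fin !phi_mu; apply: le_measure; rewrite ?inE.
- exact: measurable_ray_below.
- exact: measurable_ray_below.
- by move=> y [Xy h]; split => //; exact: wle_s_trans ww.
Qed.

(** A ray below [w'] either is below [w] or shares the edges 0, ..., k with [w], according to where
    it first departs from [w']. With [nu_s_small] this gives continuity of phi. *)
Lemma phi_le_cyl v w w' k : Xplus v w -> (forall i, (i <= k)%N -> w' i = w i) ->
  phi v w' <= phi v w + nu_s (r (w k)).
Proof.
move=> Xw h; rewrite -lee_fin EFinD !phi_mu -(mu_ray_cyl k Xw).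
apply: le_trans (measureU2 _ _ _); last 2 first.
- exact: measurable_ray_below.
- exact: measurable_ray_cyl.
apply: le_measure; rewrite ?inE.
- exact: measurable_ray_below.
- by apply: measurableU; [exact: measurable_ray_below|exact: measurable_ray_cyl].
move=> y [Xy [yw|[i [yi l]]]]; first by right; split => // i ik; rewrite yw h.
have [ik|ki] := leqP i k; last first.
  by right; split => // j jk; rewrite yi ?h// (leq_ltn_trans jk).
left; split => //; right; exists i; rewrite -h//; split => // j ji.
by rewrite yi ?h// ltnW// (leq_trans ji).
Qed.

Lemma phi_dist_cyl v w w' k : Xplus v w -> Xplus v w' ->
  (forall i, (i <= k)%N -> w' i = w i) -> `|phi v w' - phi v w| <= nu_s (r (w k)).
Proof.
move=> Xw Xw' h; have h1 := phi_le_cyl Xw h.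
have h2 : phi v w <= phi v w' + nu_s (r (w' k)).
  by apply: phi_le_cyl => // i ik; rewrite h.
rewrite h// in h2; rewrite ler_norml; apply/andP; split; lra.
Qed.

(** Only [ray_smin v] itself lies below, and it is contained in cylinders of arbitrarily small
    mass. *)
Lemma phi_smin v : phi v (ray_smin v) = 0.
Proof.
apply/eqP; rewrite eq_le phi_ge0 andbT; apply/ler_addgt0Pr => e e0; rewrite add0r.
have [k hk] := nu_s_small v e0; have [Xm _] := ray_sminP v.
apply: le_trans (ltW (hk _ Xm)); rewrite -lee_fin phi_mu -(mu_ray_cyl _ Xm).
apply: le_measure; rewrite ?inE.
- exact: measurable_ray_below.
- exact: measurable_ray_cyl.
- by move=> y [Xy /(wle_s_smin Xy) ->].
Qed.

End State.

(** * Density of the values of phi *)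

Section Density.
Variables (R : realType) (B : bratteli).
Local Notation V := (vertex B).
Local Notation E := (edge B).
Local Notation r := (@rng B).
Local Notation s := (@src B).
Variables (nu_r nu_s : V -> R).
Hypotheses (hB : standing_assumptions B) (hnu : is_state nu_r nu_s).
Variable mu : V -> {measure set (ray_mspace B) -> \bar R}.
Hypothesis hmu : is_ray_measure nu_s mu.
Local Notation phi := (phi_s mu).

(** The hypothesis says that, up to depth k, no prefix lies strictly between those of [w] and [w'];
    subadditivity does the rest. *)
Lemma phi_below_gap v w w' k : Xplus v w -> Xplus v w' ->
  (forall y, Xplus v y -> wle_s y w' ->
     wle_s y w \/ ray_cyl v w k y \/ ray_cyl v w' k y) ->
  phi v w' <= phi v w + nu_s (r (w k)) + nu_s (r (w' k)).
Proof.
move=> Xw Xw' h; rewrite -lee_fin !EFinD !(phi_mu hnu hmu).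
rewrite -(mu_ray_cyl hmu k Xw) -(mu_ray_cyl hmu k Xw').
apply: (@le_trans _ _ (mu v (ray_below v w `|` ray_cyl v w k `|` ray_cyl v w' k))).
  apply: le_measure; rewrite ?inE.
  - exact: measurable_ray_below.
  - apply: measurableU; last exact: measurable_ray_cyl.
    by apply: measurableU; [exact: measurable_ray_below|exact: measurable_ray_cyl].
  - by move=> y [Xy /(h y Xy)[?|[?|?]]]; [left; left|left; right|right].
apply: le_trans (measureU2 _ _ _) _; last 1 first.
- apply: leeD => //; apply: measureU2.
    exact: measurable_ray_below.
  exact: measurable_ray_cyl.
- by apply: measurableU; [exact: measurable_ray_below|exact: measurable_ray_cyl].
- exact: measurable_ray_cyl.
Qed.

Lemma finite_ray_reps v k : exists A : set (ray B), [/\ finite_set A, A `<=` Xplus v &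
  forall y, Xplus v y -> exists2 w, A w & forall i, (i <= k)%N -> w i = y i].
Proof.
(* A prefix of k + 1 edges is completed by the s-maximal ray from its end. *)
pose rep (l : seq E) : ray B := fun i => if (i <= k)%N then nth point l i
  else ray_smax (r (nth point l k)) (i - k.+1)%N.
pose L := \bigcup_(i in `I_k.+1) [set e : E | elevel e = vlevel v + i.+1%:Z].
pose A := rep @` [set l | size l = k.+1 /\ forall e, e \in l -> L e].
pose pre (y : ray B) : seq E := @map nat E y (iota 0 k.+1).
have npre y i : (i <= k)%N -> nth point (pre y) i = y i.
  by move=> ik; rewrite (nth_map 0%N) ?size_iota// nth_iota.
have Apre y : Xplus v y -> A (rep (pre y)).
  move=> Xy; exists (pre y) => //; split; first by rewrite size_map size_iota.
  move=> e ep; have [i ik <-] := nthP point ep; rewrite size_map size_iota in ik.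
  by exists i => //=; rewrite npre// (Xplus_level _ Xy).
have repE y i : (i <= k)%N -> rep (pre y) i = y i.
  by move=> ik; rewrite /rep ik npre.
have Xrep y : Xplus v y -> Xplus v (rep (pre y)).
  move=> [y0 yS]; split; first by rewrite repE.
  move=> i; rewrite /rep; have [ik|ki] := ltnP i k.
    by rewrite ltnW// !npre// ltnW.
  have [Xm _] := ray_smaxP (r (nth point (pre y) k)).
  have [ik|ik] := leqP i k.
    have -> : i = k by apply/eqP; rewrite eqn_leq ik ki.
    by rewrite subnn; case: Xm => ->.
  by rewrite subSn//; case: Xm => _ ->.
(* The intersection discards sequences of edges that are not paths from [v]. *)
exists (A `&` Xplus v); split=> [|y []//|y Xy].
  apply: finite_setIl; apply: finite_image; apply: finite_seqs.
  by apply: bigcup_finite => // i _; exact: edges_finite.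
exists (rep (pre y)); last exact: repE.
by split; [exact: Apre|exact: Xrep].
Qed.

Lemma wle_s_totalW v (x y : ray B) : Xplus v x -> Xplus v y -> wle_s x y \/ wle_s y x.
Proof.
move=> Xx Xy; have [->|[i [h [l|l]]]] := wle_s_total Xx Xy; first by left; left.
  by left; right; exists i.
by right; right; exists i; split => // j ji; rewrite h.
Qed.

(* Among finitely many rays representing all prefixes of a given length, the
   last one whose phi-value does not exceed t + e / 3 and the next one have
   values that differ by at most two cylinder masses. *)
Lemma phi_dense v t e : 0 <= t -> t <= nu_s v -> 0 < e ->
  exists2 w, Xplus v w & `|phi v w - t| < e.
Proof.
move=> t0 tv e0; have e30 : 0 < e / 3 by lra.
have [k hk] := nu_s_small hB hnu hmu v e30.
have [A [fA AX Arep]] := finite_ray_reps v k.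
have dist w w' : Xplus v w -> Xplus v w' -> (forall i, (i <= k)%N -> w' i = w i) ->
    `|phi v w' - phi v w| < e / 3.
  by move=> Xw Xw' h; apply: le_lt_trans (phi_dist_cyl hnu hmu Xw Xw' h) (hk _ Xw).
(* The slack e / 3 makes [D] nonempty even at t = 0: the representative of the s-minimal ray has
   phi-value below e / 3. *)
pose D := A `&` [set w | phi v w <= t + e / 3].
have [||x y [Ax _] [Ay _]|x y z _ _ _|p [Ap pt] pmax] :=
  @finite_set_greatest _ (@wle_s B) D.
- exact: finite_setIl.
- have [Xm _] := ray_sminP v; have [w Aw h] := Arep _ Xm.
  exists w; split => //=; have := dist _ _ Xm (AX _ Aw) h.
  rewrite (phi_smin hB hnu hmu) ltr_norml => /andP[_]; lra.
- exact: wle_s_totalW (AX _ Ax) (AX _ Ay).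
- exact: wle_s_trans.
exists p; first exact: AX.
(* The upper estimate is already contained in the membership of [p] in [D]. *)
suff : t - e / 3 <= phi v p by rewrite /= in pt; rewrite ltr_norml; lra.
(* If no representative lies outside [D], the one of the s-maximal ray lies below [p], and its
   phi-value is within e / 3 of [nu_s v], hence at least t - e / 3. *)
have [D0|/set0P D0] := eqVneq (A `\` D) set0.
  have [Xm _] := ray_smaxP v; have [w Aw h] := Arep _ Xm.
  have := dist _ _ Xm (AX _ Aw) h; rewrite (phi_smax hnu hmu) ltr_norml => /andP[h1 _].
  have Dw : D w by apply: contrapT => nD; have : (A `\` D) w by []; rewrite D0.
  have := phi_mono hnu hmu v (pmax _ Dw); lra.
have [||x y [Ax _] [Ay _]|x y z _ _ _ xy yz|q [Aq nDq] qmin] :=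
  @finite_set_greatest _ (fun x y => wle_s y x) (A `\` D).
- exact: finite_setD.
- by [].
- by apply: wle_s_totalW; apply: AX.
- exact: wle_s_trans yz xy.
have qt : t + e / 3 < phi v q.
  by rewrite ltNge; apply/negP => h; apply: nDq; split.
have hpk := hk _ (AX _ Ap); have hqk := hk _ (AX _ Aq).
(* The value at [q] exceeds t + e / 3 and both cylinder masses are below e / 3, so the value at [p]
   exceeds t - e / 3. *)
suff : phi v q <= phi v p + nu_s (r (p k)) + nu_s (r (q k)) by lra.
apply: phi_below_gap; [exact: AX|exact: AX|move=> y Xy yq].
(* The representative of a ray below [q] is either in [D], hence at most [p], or outside [D], hence
   at least [q]; comparing first differences with depth k gives the alternatives. *)
have [y' Ay' hy] := Arep y Xy.
have [Dy|nDy] := pselect (D y').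
  have [py|[i [h l]]] := pmax _ Dy.
    by right; left; split => // i ik; rewrite -py hy.
  have [ik|ki] := leqP i k.
    left; right; exists i; rewrite -(hy i ik); split => // j ji.
    by rewrite -hy ?h// ltnW// (leq_trans ji).
  by right; left; split => // j jk; rewrite -hy ?h// (leq_ltn_trans jk).
have qy : wle_s q y' by apply: qmin.
case: yq => [->|[i [h l]]]; first by right; right; split => //; exact: AX.
have [ik|ki] := leqP i k; last first.
  by right; right; split => // j jk; rewrite h// (leq_ltn_trans jk).
case: (@wle_s_anti _ y' q i) => //; last by rewrite hy.
by move=> j ji; rewrite hy ?h// ltnW// (leq_trans ji).
Qed.

End Density.

(** * Integrals over possibly non-measurable domains *)

Section Integration.
Context d (T : measurableType d) (R : realType) (mu : {measure set T -> \bar R}).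
Implicit Types (D : set T).

Lemma measurable_fun_fin_cover (I : choiceType) (J : seq I) (C : I -> set T) (f : T -> R) :
  (forall i, measurable (C i)) -> (forall i, i \in J -> measurable_fun (C i) f) ->
  measurable_fun (\bigcup_(i in [set` J]) C i) f.
Proof.
move=> mC mf _ A mA; rewrite setI_bigcupl.
by apply: fin_bigcup_measurable => // i iJ; exact: (mf i iJ (mC i) A mA).
Qed.

Lemma measurable_step (I : choiceType) (J : seq I) (C : I -> set T) (a : I -> R) (f : T -> R) :
  (forall i, measurable (C i)) -> (forall i z, i \in J -> C i z -> f z = a i) ->
  (forall z, (forall i, i \in J -> ~ C i z) -> f z = 0) -> measurable_fun setT f.
Proof.
move=> mC fa f0; pose S := \bigcup_(i in [set` J]) C i.
have mS : measurable S by apply: fin_bigcup_measurable.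
rewrite -(setUv S); apply/measurable_funU => //; first exact: measurableC.
split.
  apply: measurable_fun_fin_cover => // i iJ.
  apply: (@eq_measurable_fun _ _ _ _ _ (cst (a i))); last exact: measurable_cst.
  by move=> z /[!inE] Cz; rewrite /= (fa i).
apply: (@eq_measurable_fun _ _ _ _ _ (cst (0 : R))); last exact: measurable_cst.
by move=> z /[!inE] Sz; rewrite /= f0// => i iJ Cz; apply: Sz; exists i.
Qed.

(* The domain D is not assumed measurable: it will be a right tail class
   restricted to Y_. *)
Lemma integral_supported (I : choiceType) (J : seq I) (C : I -> set T) D (f : T -> R) :
  uniq J -> (forall i, measurable (C i)) -> trivIset [set` J] C ->
  (forall i, i \in J -> C i `<=` D) ->
  (forall z, D z -> (forall i, i \in J -> ~ C i z) -> f z = 0) ->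
  (forall i, i \in J -> measurable_fun (C i) f) ->
  (\int[mu]_(z in D) (f z)%:E = \sum_(i <- J) \int[mu]_(z in C i) (f z)%:E)%E.
Proof.
move=> uJ mC tC CD f0 mf.
pose S := \big[setU/set0]_(i <- J) C i.
have SE : S = \bigcup_(i in [set` J]) C i by rewrite bigcup_seq.
have mS : measurable S by apply: bigsetU_measurable => i _; exact: mC.
rewrite -(integral_bigsetU_EFin mu mC uJ tC); last first.
  by apply/measurable_EFinP; rewrite -/S SE; exact: measurable_fun_fin_cover.
rewrite integral_mkcond [RHS]integral_mkcond; apply: eq_integral => z _.
rewrite !patchE; case: ifPn => [|/negP]; rewrite inE => zD; case: ifPn => //.
- move=> /negP; rewrite inE -/S SE => zS; rewrite f0// => i iJ Ciz.
  by apply: zS; exists i.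
- by rewrite inE -/S SE => -[i iJ /(CD i iJ)].
Qed.

Lemma Rintegral_supported (I : choiceType) (J : seq I) (C : I -> set T) D (f : T -> R) :
  uniq J -> (forall i, measurable (C i)) -> trivIset [set` J] C ->
  (forall i, i \in J -> C i `<=` D) ->
  (forall z, D z -> (forall i, i \in J -> ~ C i z) -> f z = 0) ->
  (forall i, i \in J -> mu.-integrable (C i) (EFin \o f)) ->
  \int[mu]_(z in D) f z = \sum_(i <- J) \int[mu]_(z in C i) f z.
Proof.
move=> uJ mC tC CD f0 fi; rewrite /Rintegral (integral_supported uJ mC tC CD f0).
  rewrite big_seq -sum_fine; first by rewrite -big_seq.
  by move=> i iJ; apply: integrable_fin_num => //; exact: fi.
by move=> i /fi /integrableP[/measurable_EFinP].
Qed.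

(** The integral of a nonnegative function is a supremum over simple functions below it, which is
    monotone in the domain, measurable or not. *)
Lemma ge0_subset_integral_gen D1 D2 (f : T -> \bar R) : D1 `<=` D2 ->
  (forall x, D2 x -> 0 <= f x)%E ->
  (\int[mu]_(x in D1) f x <= \int[mu]_(x in D2) f x)%E.
Proof.
move=> D12 f0; rewrite integral_mkcond [leRHS]integral_mkcond.
rewrite !ge0_integralTE; first last.
- by apply: erestrict_ge0 => x /D12; exact: f0.
- exact: erestrict_ge0.
apply: le_ereal_sup => _ [h hf <-]; exists h => // x; apply: (le_trans (hf x)).
rewrite !patchE; case: ifPn => [|_]; rewrite ?inE.
  by move=> /D12 xD2; rewrite ifT ?inE.
by case: ifPn => //; rewrite inE; exact: f0.
Qed.

(** |f| <= 1 + f^2, and constants are integrable on a set of finite mass. *)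
Lemma integrable_of_sqr D (f : T -> R) : measurable D -> (mu D < +oo)%E ->
  measurable_fun D f -> (\int[mu]_(z in D) (f z ^+ 2)%:E < +oo)%E ->
  mu.-integrable D (EFin \o f) /\ mu.-integrable D (EFin \o (fun z => f z ^+ 2)).
Proof.
move=> mD muD mf f2.
have mf2 : measurable_fun D (fun z => f z ^+ 2) by exact: measurable_funX.
have i2 : mu.-integrable D (EFin \o (fun z => f z ^+ 2)).
  apply/integrableP; split; first exact/measurable_EFinP.
  by under eq_integral do rewrite /= ger0_norm ?sqr_ge0//.
split => //; have ic : mu.-integrable D (EFin \o cst 1).
  apply: measurable_bounded_integrable => //.
  by exists 1; split => // x x1 y _; rewrite /= normr1 ltW.
apply: (le_integrable mD _ _ (integrableD mD ic i2)); first exact/measurable_EFinP.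
move=> x _ /=; rewrite lee_fin [leRHS]ger0_norm ?addr_ge0 ?sqr_ge0//.
rewrite ler_norml; have := sqr_ge0 (f x - 1); have := sqr_ge0 (f x + 1).
by rewrite !expr2 => h1 h2; apply/andP; split; nra.
Qed.

(** Cauchy-Schwarz against the constant 1: the integral of (f - c)^2 is a nonnegative quadratic
    polynomial in c. *)
Lemma sqr_Rintegral_le D (f : T -> R) : measurable D -> (mu D < +oo)%E ->
  mu.-integrable D (EFin \o f) -> mu.-integrable D (EFin \o (fun z => f z ^+ 2)) ->
  (\int[mu]_(z in D) f z) ^+ 2 <= fine (mu D) * \int[mu]_(z in D) (f z ^+ 2).
Proof.
move=> mD muD fi f2.
set a := \int[mu]_(z in D) f z; set b := \int[mu]_(z in D) (f z ^+ 2).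
set M := fine (mu D).
have M0 : 0 <= M by exact: fine_ge0.
have b0 : 0 <= b by apply: Rintegral_ge0 => x _; exact: sqr_ge0.
have ic (c : R) : mu.-integrable D (EFin \o cst c).
  apply: measurable_bounded_integrable => //.
  by exists `|c|; split => // x x1 y _; rewrite /= ltW.
have key (c : R) : 0 <= b - 2 * c * a + c ^+ 2 * M.
  have : 0 <= \int[mu]_(z in D) (f z ^+ 2 - 2 * c * f z + cst (c ^+ 2) z).
    apply: Rintegral_ge0 => z _ /=.
    by rewrite (_ : _ + _ = (f z - c) ^+ 2) ?sqr_ge0//; ring.
  have i1 : mu.-integrable D (EFin \o (fun z => 2 * c * f z)).
    rewrite (_ : _ \o _ = (fun z => ((2 * c)%:E * (f z)%:E)%E)); last first.
      by apply/funext => z; rewrite /= EFinM.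
    exact: integrableZl.
  have i3 : mu.-integrable D (EFin \o (fun z => f z ^+ 2 - 2 * c * f z)).
    have -> : EFin \o (fun z => f z ^+ 2 - 2 * c * f z) =
        ((EFin \o (fun z => f z ^+ 2)%R) \- (EFin \o (fun z => 2 * c * f z)%R))%E.
      by apply/funext.
    exact: integrableB.
  by rewrite RintegralD// RintegralB// RintegralZl// Rintegral_cst.
(* For M = 0 the polynomial is affine; were its slope nonzero, c = (b + 1) / (2 a) would give the
   value -1. *)
have [M00|Mn0] := eqVneq M 0.
  have [->|a0] := eqVneq a 0; first by rewrite expr0n M00 mul0r.
  have := key ((b + 1) / (2 * a)); rewrite M00 mulr0 addr0.
  rewrite (_ : _ - _ = -1); last by field; rewrite a0.
  by rewrite lerNr oppr0 ler10.
have Mp : 0 < M by rewrite lt_neqAle eq_sym Mn0.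
(* The minimum of the quadratic polynomial. *)
have := key (a / M).
rewrite (_ : _ + _ = (M * b - a ^+ 2) / M); last by field; rewrite Mn0.
by rewrite pmulr_lge0 ?invr_gt0// subr_ge0.
Qed.

End Integration.

(** * Kernels and convolution *)

Section Cylinders.
Variables (R : realType) (B : bratteli) (m : int).
Local Notation V := (vertex B).
Local Notation E := (edge B).
Local Notation r := (@rng B).
Local Notation s := (@src B).

(** The past up to level m is free and everything beyond is fixed: the set X^-_{s(p)} p x_{(n,oo)}
    of the Haar system, written without p and n. *)
Definition cyl (z : bipath B) : set (bipath B) :=
  [set y | X_ y /\ forall k, m < k -> y k = z k].

Lemma measurable_cyl z : measurable (cyl z : set (bipath_mspace B)).
Proof.
have -> : cyl z = @X_ B `&`
    \bigcap_(j in [set: nat]) [set y : bipath B | y (m + j.+1%:Z) = z (m + j.+1%:Z)].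
  apply/seteqP; split=> y [Xy h]; split => //.
    by move=> j _ /=; apply: h; lia.
  move=> k mk; have := h (`|k - m|.-1)%N I; rewrite /= (_ : m + _ = k)//; lia.
apply: measurableI; first exact: measurable_X.
apply: bigcap_measurableType => j _.
exact: (measurable_bipath_coord _ [set e | e = z (m + j.+1%:Z)]).
Qed.

Lemma segment_tail_eq n (y z : bipath B) : m <= n ->
  (segment m n y = segment m n z /\ tail n y = tail n z) <->
  forall k, m < k -> y k = z k.
Proof.
move=> mn; split=> [[hs ht] k mk|h].
  have [kn|nk] := leP k n.
    have ik : (`|k - m|.-1 < `|n - m|)%N by lia.
    have := congr1 (fun t => nth point t `|k - m|.-1) hs.
    by rewrite !nth_segment// (_ : m + _ = k); last by lia.
  have := congr1 (fun t : ray B => t `|k - n|.-1) ht.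
  by rewrite /tail (_ : n + _ = k); last by lia.
split; first by apply/eq_in_map => i; rewrite mem_iota => ?; apply: h; lia.
by apply/funext => k; apply: h; lia.
Qed.

Variables (nu_r : V -> R) (haar : bipath B -> {measure set (bipath_mspace B) -> \bar R}).
Hypothesis hh : is_haar_system nu_r haar.

(** The Haar system prescribes cylinders whose tail is literally that of [x]; [z] is only tail
    equivalent to [x], so the fixed part is cut at a level beyond which they agree. *)
Lemma haar_cyl x z : tail_equiv x z -> haar x (cyl z) = (nu_r (s (z (m + 1))))%:E.
Proof.
move=> [Xx Xz [N xz]].
(* Exceeds both m and N. *)
pose n := `|N - m|%:Z + 1 + m.
have mn : m < n by rewrite /n; lia.
have xzn k : n <= k -> x k = z k by move=> nk; apply: xz; rewrite /n in nk; lia.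
have [_ h] := hh Xx.
have := h m n (segment m n z) mn (segment_paths m n Xz).
rewrite prng_segment// psrc_segment// xzn// => /(_ erefl) <-.
congr (haar x _); apply/seteqP; split=> y.
  move=> [Xy /(segment_tail_eq _ _ (ltW mn)) [hs ht]]; split => //.
  by rewrite ht; apply/funext => k; rewrite /tail xzn//; lia.
move=> [Xy hs ht]; split => //; apply/(segment_tail_eq _ _ (ltW mn)); split => //.
by rewrite ht; apply/funext => k; rewrite /tail xzn//; lia.
Qed.

End Cylinders.

(** * Kernels given by families of coefficients, and their convolution *)

Section Kernels.
Variables (R : realType) (B : bratteli).
Local Notation V := (vertex B).
Local Notation E := (edge B).
Local Notation r := (@rng B).
Local Notation s := (@src B).
Local Notation C := R[i].
Variables (nu_r nu_s : V -> R).
Hypotheses (hB : standing_assumptions B) (hnu : is_state nu_r nu_s).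
Variable haar : bipath B -> {measure set (bipath_mspace B) -> \bar R}.
Hypothesis hh : is_haar_system nu_r haar.
Variables (m n : int).
Hypothesis mn : m < n.

Definition coeffs := seq E -> seq E -> ray B -> C.
Implicit Types (F G : coeffs).

Definition EY_seq : seq (seq E) := finmap.enum_fset (fset_set (@EY B m n)).
Definition EY_at (v : V) : seq (seq E) := [seq p <- EY_seq | prng p == v].

Lemma EY_finite : finite_set (EY (B := B) m n).
Proof. by apply: sub_finite_set (paths_finite B m n) => p []. Qed.

Lemma mem_EY_seq (p : seq E) : (p \in EY_seq) = (p \in EY m n).
Proof. by rewrite in_fset_set//; exact: EY_finite. Qed.

Lemma EY_atP v (p : seq E) : reflect (EY m n p /\ prng p = v) (p \in EY_at v).
Proof.
rewrite mem_filter mem_EY_seq; apply: (iffP andP).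
  by move=> [/eqP ? /set_mem].
by move=> [? /eqP ?]; split => //; exact: mem_set.
Qed.

Lemma EY_at_uniq v : uniq (EY_at v).
Proof. by rewrite filter_uniq// finmap.fset_uniq. Qed.

Lemma EY_paths (p : seq E) : EY m n p -> paths m n p.
Proof. by case. Qed.

Lemma EY_Y (x : bipath B) : X_ x -> EY m n (segment m n x) -> Y_ x.
Proof. by move=> Xx [_ _ _ _ h]; exact: h. Qed.

Definition wt (p : seq E) : R := (Num.sqrt (nu_r (psrc p)))^-1.

Lemma wt_gt0 p : 0 < wt p.
Proof. by rewrite invr_gt0 sqrtr_gt0 (nu_r_gt0 hB hnu). Qed.

Lemma wt_sqrE p : wt p ^+ 2 = (nu_r (psrc p))^-1.
Proof. by rewrite exprVn sqr_sqrtr// ltW// (nu_r_gt0 hB hnu). Qed.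

Lemma wt_sqr p : wt p ^+ 2 * nu_r (psrc p) = 1.
Proof. by rewrite wt_sqrE mulVf// gt_eqF// (nu_r_gt0 hB hnu). Qed.

(** Membership in [Y_] and tail equivalence follow, as every point passing through a path of [EY]
    lies in [Y_]. *)
Definition kcond (x y : bipath B) : Prop :=
  [/\ X_ x, X_ y, EY m n (segment m n x), EY m n (segment m n y)
    & tail n x = tail n y].

(* The kernel of the element [sum a_{p,q} (x) F p q] over pairsY. *)
Definition ker_of F : Defs.kernel B R := fun x y =>
  if `[< kcond x y >] then
    (wt (segment m n x) * wt (segment m n y))%:C *
    F (segment m n x) (segment m n y) (tail n x)
  else 0.

Lemma kcond_sym x y : kcond x y -> kcond y x.
Proof. by case. Qed.

Lemma kcond_trans x y z : kcond x y -> kcond y z -> kcond x z.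
Proof. by move=> [? ? ? ? e] [? ? ? ? f]; split => //; rewrite e. Qed.

Lemma kcond_tail_equivY x y : kcond x y -> tail_equivY x y.
Proof.
move=> [Xx Xy px py e]; split; [exact: EY_Y|exact: EY_Y|split => //].
exists n => k nk; have := congr1 (fun t : ray B => t (`|k - n|.-1)%N) e.
by rewrite /tail (_ : n + _ = k); last by lia.
Qed.

Lemma kcond_prng x y : kcond x y -> prng (segment m n x) = prng (segment m n y).
Proof.
move=> [Xx Xy _ _ e]; rewrite !prng_segment//.
have [<- _] := tail_Xplus n Xx; have [<- _] := tail_Xplus n Xy; by rewrite e.
Qed.

Lemma pairsY_finite : finite_set (pairsY (B := B) m n).
Proof.
apply: (@sub_finite_set _ _ (EY m n `*` EY m n)); first by move=> [p q] [].
by apply: finite_setX; exact: EY_finite.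
Qed.

(** At (x, y) the only pair that can contribute is that of the segments of x and y. *)
Lemma sum_a_tensor F :
  \sum_(pq \in pairsY m n) a_tensor nu_r m n pq.1 pq.2 (F pq.1 pq.2) = ker_of F.
Proof.
rewrite fsbig_finite; last exact: pairsY_finite.
apply/funext => x; apply/funext => y.
set S := finmap.enum_fset _.
have SP pq : (pq \in S) = (pq \in pairsY m n) by rewrite in_fset_set//; exact: pairsY_finite.
have -> : (\sum_(pq <- S) a_tensor nu_r m n pq.1 pq.2 (F pq.1 pq.2)) x y =
    \sum_(pq <- S) a_tensor nu_r m n pq.1 pq.2 (F pq.1 pq.2) x y.
  exact: (big_morph (fun k : Defs.kernel B R => k x y)).
rewrite /ker_of; case: asboolP => [c|nc].
  have [Xx Xy px py e] := c.
  rewrite (bigD1_seq (segment m n x, segment m n y))/=.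
  - rewrite big1 ?addr0.
      rewrite /a_tensor /a_ asboolT; first by rewrite /wt mulrC.
      by split => //; exact: kcond_tail_equivY.
    move=> [p q] /= npq; rewrite /a_tensor /a_ asboolF ?mulr0// => -[_ hp hq _].
    by case/eqP: npq; rewrite hp hq.
  - by rewrite SP; apply: mem_set; split => //=; exact: kcond_prng.
  - exact: finmap.fset_uniq.
rewrite big_seq big1// => -[p q] /=; rewrite SP.
move=> /set_mem [pp qq _]; rewrite /a_tensor /a_ asboolF ?mulr0//.
move=> [[_ _ [Xx Xy _]] hp hq e]; apply: nc; split => //; first by rewrite hp.
by rewrite hq.
Qed.

Lemma eq_ker_of F G :
  (forall p q w, pairsY m n (p, q) -> Xplus (prng p) w -> F p q w = G p q w) ->
  ker_of F = ker_of G.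
Proof.
move=> FG; apply/funext => x; apply/funext => y; rewrite /ker_of.
case: asboolP => // c; have [Xx Xy px py e] := c.
by rewrite FG//; [split => //; exact: kcond_prng|rewrite prng_segment//; exact: tail_Xplus].
Qed.

(** A point through [p] with tail [w]. Its past below level m is arbitrary and affects neither
    [ker_of] nor [cyl m]. *)
Definition bip (p : seq E) (w : ray B) : bipath B :=
  get [set x | [/\ X_ x, segment m n x = p & tail n x = w]].

Lemma bipP p w : paths m n p -> Xplus (prng p) w ->
  [/\ X_ (bip p w), segment m n (bip p w) = p & tail n (bip p w) = w].
Proof. by move=> pp Xw; apply: (@getPex _ _ (exists_bipath mn pp Xw)). Qed.

Lemma kcond_bip p q w : pairsY m n (p, q) -> Xplus (prng p) w ->
  kcond (bip p w) (bip q w).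
Proof.
move=> [/= pp qq pq] Xw; have [Xp sp tp] := bipP (EY_paths pp) Xw.
rewrite pq in Xw; have [Xq sq tq] := bipP (EY_paths qq) Xw.
by split; rewrite ?sp ?sq ?tp ?tq.
Qed.

(** Inverts [ker_of] by evaluation at one point. Being defined and linear on all kernels, it lets
    the quotient map be written without choosing coefficients. *)
Definition coef (a : Defs.kernel B R) (p q : seq E) (w : ray B) : C :=
  ((wt p * wt q)^-1)%:C * a (bip p w) (bip q w).

Lemma coefK F p q w : pairsY m n (p, q) -> Xplus (prng p) w ->
  coef (ker_of F) p q w = F p q w.
Proof.
move=> pq Xw; rewrite /coef /ker_of asboolT; last exact: kcond_bip.
have [/= pp qq e] := pq; have [Xp -> ->] := bipP (EY_paths pp) Xw.
rewrite e in Xw; have [Xq -> _] := bipP (EY_paths qq) Xw.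
by rewrite mulrA -rmorphM mulVf ?mul1r// mulf_neq0// gt_eqF// wt_gt0.
Qed.

Lemma ker_of_inj F G p q w : ker_of F = ker_of G -> pairsY m n (p, q) ->
  Xplus (prng p) w -> F p q w = G p q w.
Proof. by move=> FG pq Xw; rewrite -(coefK F pq Xw) FG coefK. Qed.

Lemma ker_of_lin (c : C) F G :
  c *: ker_of F + ker_of G = ker_of (fun p q w => c * F p q w + G p q w).
Proof.
apply/funext => x; apply/funext => y.
transitivity (c * ker_of F x y + ker_of G x y); first by [].
rewrite /ker_of; case: asboolP => _; last by rewrite mulr0 addr0.
by rewrite mulrDr mulrCA.
Qed.

Lemma kstar_ker_of F : kstar (ker_of F) = ker_of (fun p q w => conjc (F q p w)).
Proof.
apply/funext => x; apply/funext => y; rewrite /kstar /ker_of.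
case: asboolP => [c|nc]; last first.
  by rewrite asboolF ?conjc0// => /kcond_sym.
rewrite asboolT; last exact: kcond_sym.
by case: c => _ _ _ _ ->; rewrite conjCM conjCR [wt _ * _]mulrC.
Qed.

Local Notation cylw p w := (cyl m (bip p w)).

Lemma cylwP p w z : paths m n p -> Xplus (prng p) w ->
  cylw p w z <-> [/\ X_ z, segment m n z = p & tail n z = w].
Proof.
move=> pp Xw; have [Xb sb tb] := bipP pp Xw; split.
  by move=> [Xz /(segment_tail_eq _ _ (ltW mn)) [-> ->]].
by move=> [Xz hs ht]; split => //; apply/(segment_tail_eq _ _ (ltW mn)); rewrite sb tb.
Qed.

Lemma trivIset_cylw v w : Xplus v w ->
  trivIset [set` EY_at v] (fun p => cylw p w).
Proof.
move=> Xw p q /= /EY_atP[pp pv] /EY_atP[qq qv] [z [hp hq]].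
have [|_ <- _] := (cylwP z (EY_paths pp) _).1 hp; first by rewrite pv.
by have [|_ <- _] := (cylwP z (EY_paths qq) _).1 hq; first by rewrite qv.
Qed.

Section Class.
Variables (x y : bipath B).
Hypotheses (Yx : Y_ x) (xy : tail_equiv x y).
Local Notation w := (tail n y).
Local Notation v := (r (y n)).

Let Xy : X_ y. Proof. by case: xy. Qed.
Let Xw : Xplus v w. Proof. exact: tail_Xplus. Qed.

Lemma cylw_classP p z : p \in EY_at v ->
  cylw p w z <-> [/\ X_ z, segment m n z = p & tail n z = w].
Proof. by move=> /EY_atP[pp pv]; apply: cylwP; [exact: EY_paths|rewrite pv]. Qed.

Lemma tail_eq_equiv z : X_ z -> tail n z = w -> tail_equiv x z.
Proof.
move=> Xz e; have [Xx _ [N xN]] := xy; split => //.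
exists (Num.max N n) => k; rewrite gt_max => /andP[Nk nk].
rewrite xN//; have := congr1 (fun t : ray B => t (`|k - n|.-1)%N) e.
by rewrite /tail (_ : n + _ = k); last by lia.
Qed.

Lemma cylw_sub_class p : p \in EY_at v -> cylw p w `<=` tail_equivY x.
Proof.
move=> pv z /(cylw_classP z pv)[Xz sz tz]; split => //.
  by apply: EY_Y => //; rewrite sz; case/EY_atP: pv.
exact: tail_eq_equiv.
Qed.

Lemma haar_cylw p : p \in EY_at v -> haar x (cylw p w) = (nu_r (psrc p))%:E.
Proof.
move=> pv; have /EY_atP[pp pr] := pv.
have [|Xb sb tb] := bipP (EY_paths pp) (_ : Xplus (prng p) w); first by rewrite pr.
rewrite (haar_cyl m hh); last exact: tail_eq_equiv.
by rewrite -(psrc_segment _ mn) sb.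
Qed.

Lemma haar_cylw_fin p : p \in EY_at v -> (haar x (cylw p w) < +oo)%E.
Proof. by move=> pv; rewrite haar_cylw// ltry. Qed.

Definition Cint p (f : bipath B -> C) : C :=
  (\int[haar x]_(z in cylw p w) complex.Re (f z)) +i*
  (\int[haar x]_(z in cylw p w) complex.Im (f z)).

Definition Cintegrable p (f : bipath B -> C) : Prop :=
  (haar x).-integrable (cylw p w) (EFin \o (fun z => complex.Re (f z))) /\
  (haar x).-integrable (cylw p w) (EFin \o (fun z => complex.Im (f z))).

Lemma integrable_lin2 (D : set (bipath_mspace B)) (a b : R) (f g : bipath B -> R) :
  measurable D -> (haar x).-integrable D (EFin \o f) ->
  (haar x).-integrable D (EFin \o g) ->
  (haar x).-integrable D (EFin \o (fun z => a * f z + b * g z)) /\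
  \int[haar x]_(z in D) (a * f z + b * g z) =
  a * \int[haar x]_(z in D) f z + b * \int[haar x]_(z in D) g z.
Proof.
move=> mD fi gi.
have sc (c : R) h : (haar x).-integrable D (EFin \o h) ->
    (haar x).-integrable D (EFin \o (fun z => c * h z)).
  move=> hi; rewrite (_ : _ \o _ = (fun z => (c%:E * (h z)%:E)%E)).
    exact: integrableZl.
  by apply/funext => z; rewrite /= EFinM.
have fi' := sc a _ fi; have gi' := sc b _ gi; split.
  rewrite (_ : _ \o _ = (EFin \o (fun z => a * f z)%R) \+ (EFin \o (fun z => b * g z)%R))%E.
    exact: integrableD.
  by apply/funext.
by rewrite RintegralD// !RintegralZl.
Qed.

Lemma Cintegral_eq0 (h : bipath B -> C) : (forall z, h z = 0) -> Cintegral haar x h = 0.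
Proof.
move=> h0; rewrite /Cintegral /Rintegral !integral0_eq//= => z _; by rewrite h0.
Qed.

(** For fixed y the kernel is constant on each of the finitely many cylinders [q w] and vanishes on
    the rest of the class, so only the integrals of [f] over these cylinders remain. *)
Lemma Cintegral_ker_of F (f : bipath B -> C) :
  (forall q, q \in EY_at v -> Cintegrable q f) ->
  Cintegral haar x (fun z => ker_of F y z * f z) =
  if segment m n y \in EY_at v then
    \sum_(q <- EY_at v) (wt (segment m n y) * wt q)%:C * F (segment m n y) q w * Cint q f
  else 0.
Proof.
move=> fi; case: ifPn => [py|npy]; last first.
  apply: Cintegral_eq0 => z; rewrite /ker_of asboolF ?mul0r// => -[_ _ py _ _].
  by move/negP: npy; apply; apply/EY_atP; split => //; rewrite prng_segment.
pose b q : C := (wt (segment m n y) * wt q)%:C * F (segment m n y) q w.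
have onC q z : q \in EY_at v -> cylw q w z -> ker_of F y z * f z = b q * f z.
  move=> qv /(cylw_classP z qv)[Xz sz tz]; rewrite /ker_of asboolT ?sz//.
  split => //; last by rewrite sz; case/EY_atP: qv.
  by case/EY_atP: py.
have offC z : tail_equivY x z -> (forall q, q \in EY_at v -> ~ cylw q w z) ->
    ker_of F y z * f z = 0.
  move=> _ h; rewrite /ker_of; case: asboolP; last by rewrite mul0r.
  move=> c; have [_ Xz _ pz e] := c.
  have zv : segment m n z \in EY_at v.
    by apply/EY_atP; split => //; rewrite -(kcond_prng c) prng_segment.
  by case: (h _ zv); apply/(cylw_classP z zv).
have mC q : measurable (cylw q w : set (bipath_mspace B)) by exact: measurable_cyl.
have ReM (a c : C) : complex.Re (a * c) =
    complex.Re a * complex.Re c + - complex.Im a * complex.Im c.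
  by case: a c => ? ? [? ?] /=; rewrite mulNr.
have ImM (a c : C) : complex.Im (a * c) =
    complex.Im a * complex.Re c + complex.Re a * complex.Im c.
  by case: a c => ? ? [? ?] /=; rewrite addrC.
have ReC q : q \in EY_at v ->
    (haar x).-integrable (cylw q w) (EFin \o (fun z => complex.Re (ker_of F y z * f z))) /\
    \int[haar x]_(z in cylw q w) complex.Re (ker_of F y z * f z) =
    complex.Re (b q * Cint q f).
  move=> qv; have [fr fim] := fi q qv.
  have [h1 h2] := integrable_lin2 (complex.Re (b q)) (- complex.Im (b q)) (mC q) fr fim.
  split; last first.
    rewrite ReM -h2; apply: eq_Rintegral => z /[!inE] hz; by rewrite (onC q)// ReM.
  apply: (eq_integrable (mC q) _ _ _ h1) => z /[!inE] hz.
  by congr EFin; rewrite (onC q z)// ReM.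
have ImC q : q \in EY_at v ->
    (haar x).-integrable (cylw q w) (EFin \o (fun z => complex.Im (ker_of F y z * f z))) /\
    \int[haar x]_(z in cylw q w) complex.Im (ker_of F y z * f z) =
    complex.Im (b q * Cint q f).
  move=> qv; have [fr fim] := fi q qv.
  have [h1 h2] := integrable_lin2 (complex.Im (b q)) (complex.Re (b q)) (mC q) fr fim.
  split; last first.
    rewrite ImM -h2; apply: eq_Rintegral => z /[!inE] hz; by rewrite (onC q)// ImM.
  apply: (eq_integrable (mC q) _ _ _ h1) => z /[!inE] hz.
  by congr EFin; rewrite (onC q z)// ImM.
rewrite /Cintegral.
have tC := trivIset_cylw Xw; have uJ := EY_at_uniq v.
rewrite (Rintegral_supported uJ mC tC cylw_sub_class); first last.
- by move=> q /ReC[].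
- by move=> z Dz h; rewrite offC.
rewrite (Rintegral_supported uJ mC tC cylw_sub_class); first last.
- by move=> q /ImC[].
- by move=> z Dz h; rewrite offC.
apply/eqP; rewrite eq_complex /= Re_sum Im_sum; apply/andP; split; apply/eqP.
  by apply: eq_big_seq => q /ReC[].
by apply: eq_big_seq => q /ImC[].
Qed.

End Class.

Definition cmul F G : coeffs := fun p q w =>
  \sum_(z <- EY_at (prng p)) F p z w * G z q w.
Definition cstar F : coeffs := fun p q w => conjc (F q p w).

(** On the cylinder [q w] both kernels are constant. Its mass nu_r(s(q)) cancels the two factors
    [wt q], one from each kernel, leaving the matrix product. *)
Lemma conv_ker_of F G : Defs.conv haar (ker_of F) (ker_of G) = ker_of (cmul F G).
Proof.
apply/funext => x; apply/funext => y; rewrite /Defs.conv.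
have [px|npx] := pselect (X_ x /\ EY m n (segment m n x)); last first.
  rewrite [RHS]/ker_of asboolF; last by case=> *; apply: npx.
  apply: Cintegral_eq0 => z.
  by rewrite /ker_of asboolF ?mul0r// => -[*]; apply: npx.
case: px => Xx px.
have xx : tail_equiv x x by split => //; exists 0.
have Yx : Y_ x by exact: EY_Y.
have Xw : Xplus (r (x n)) (tail n x) by exact: tail_Xplus.
have xv : segment m n x \in EY_at (r (x n)).
  by apply/EY_atP; split => //; rewrite prng_segment.
pose g q : C := if `[< kcond x y >] then
  (wt q * wt (segment m n y))%:C * G q (segment m n y) (tail n x) else 0.
have gE q z : q \in EY_at (r (x n)) -> cylw q (tail n x) z -> ker_of G z y = g q.
  move=> qv /(cylw_classP xx z qv)[Xz sz tz].
  have xz : kcond x z by split => //; rewrite sz; case/EY_atP: qv.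
  rewrite /g /ker_of; case: asboolP => [zy|nzy].
    by rewrite asboolT ?sz ?tz//; exact: kcond_trans zy.
  by rewrite asboolF// => xy; apply: nzy; apply: kcond_trans xy; exact: kcond_sym.
have mC q : measurable (cylw q (tail n x) : set (bipath_mspace B)).
  exact: measurable_cyl.
have ic (c : R) q : q \in EY_at (r (x n)) ->
    (haar x).-integrable (cylw q (tail n x)) (EFin \o cst c).
  move=> qv; apply: measurable_bounded_integrable => //; first exact: haar_cylw_fin.
  by exists `|c|; split => // u u1 t _; rewrite /= ltW.
rewrite (Cintegral_ker_of Yx xx); last first.
  move=> q qv; split.
    apply: eq_integrable (ic (complex.Re (g q)) q qv) => // z /[!inE] hz.
    by rewrite /= (gE q).
  apply: eq_integrable (ic (complex.Im (g q)) q qv) => // z /[!inE] hz.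
  by rewrite /= (gE q).
rewrite xv.
have Ig q : q \in EY_at (r (x n)) ->
    Cint x x q (ker_of G ^~ y) = g q * (nu_r (psrc q))%:C.
  move=> qv; rewrite /Cint.
  rewrite (@eq_Rintegral _ _ _ _ _ (cst (complex.Re (g q)))); last first.
    by move=> z /[!inE] hz; rewrite /= (gE q).
  rewrite [X in _ +i* X](@eq_Rintegral _ _ _ _ _ (cst (complex.Im (g q)))); last first.
    by move=> z /[!inE] hz; rewrite /= (gE q).
  rewrite !Rintegral_cst// haar_cylw//=.
  case: (g q) => a b; apply/eqP; rewrite eq_complex /=.
  by apply/andP; split; apply/eqP; ring.
rewrite (eq_big_seq (fun q => (wt (segment m n x) * wt q)%:C *
    F (segment m n x) q (tail n x) * (g q * (nu_r (psrc q))%:C))); last first.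
  by move=> q qv; rewrite Ig.
rewrite [RHS]/ker_of /g; case: asboolP => [c|nc]; last first.
  by rewrite big1// => q _; rewrite mul0r mulr0.
rewrite /cmul mulr_sumr prng_segment//; apply: eq_bigr => q _.
have := wt_sqr q; set W := wt q; set U := nu_r _ => WU.
have : (W%:C) ^+ 2 * U%:C = 1 :> C by rewrite -rmorphXn -rmorphM /= WU.
rewrite !rmorphM /= => h.
set a := (wt _)%:C; set b := (wt _)%:C; set P := F _ _ _; set Q := G _ _ _.
rewrite -[RHS]mulr1 -h; ring.
Qed.

End Kernels.

(** * The reduced norm of a kernel *)

Section ReducedNorm.
Variables (R : realType) (B : bratteli).
Local Notation V := (vertex B).
Local Notation E := (edge B).
Local Notation r := (@rng B).
Local Notation s := (@src B).
Local Notation C := R[i].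
Variables (nu_r nu_s : V -> R).
Hypotheses (hB : standing_assumptions B) (hnu : is_state nu_r nu_s).
Variable haar : bipath B -> {measure set (bipath_mspace B) -> \bar R}.
Hypothesis hh : is_haar_system nu_r haar.
Variables (m n : int).
Hypothesis mn : m < n.
Local Notation coeffs := (coeffs R B).
Local Notation EY_at := (@EY_at B m n).
Local Notation kerF := (ker_of nu_r m n).
Local Notation bip := (bip m n).
Local Notation wt := (wt nu_r).
Local Notation cylw p w := (cyl m (bip p w)).
Implicit Types (F G : coeffs).

Definition cbound F (c : R) : Prop := forall v w, Xplus v w ->
  mbound (EY_at v) (fun p q => F p q w) c.

(** What the reduced norm of [ker_of F] will be; the norm axioms are then read off from uniform
    bounds of matrices. *)
Definition least_bound F (N : R) : Prop :=
  [/\ 0 <= N, cbound F N & forall c, 0 <= c -> cbound F c -> N <= c].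

Definition entries_le F (c : R) : Prop := forall p q w, pairsY m n (p, q) ->
  Xplus (prng p) w -> Normc.normc (F p q w) <= c.

Lemma entries_le_cbound F c : 0 <= c -> entries_le F c ->
  cbound F (c * (size (@EY_seq B m n))%:R).
Proof.
move=> c0 h v w Xw; apply: (@mbound_le _ _ _ _ (c * (size (EY_at v))%:R)).
- exact: mulr_ge0.
- by apply: ler_wpM2l => //; rewrite ler_nat size_filter count_size.
- apply: mbound_of_entries => // p q /EY_atP[pp pv] /EY_atP[qq qv].
  by apply: h; [split => //=; rewrite pv qv|rewrite pv].
Qed.

Lemma cbound_entries_le F c : 0 <= c -> cbound F c -> entries_le F c.
Proof.
move=> c0 h p q w [/= pp qq pq] Xw.
apply: (@mbound_entry _ _ (EY_at (prng p)) (fun p q => F p q w)) => //.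
- exact: EY_at_uniq.
- by apply/EY_atP.
- by apply/EY_atP.
- exact: h.
Qed.

(** A tail met by the class agrees with that of [x] from some index on, and for each such index
    there are finitely many possible prefixes. *)
Lemma countable_tails x : X_ x ->
  countable [set w : ray B | exists2 y, tail_equiv x y & tail n y = w].
Proof.
move=> Xx.
pose rep (j : nat) (l : seq E) : ray B :=
  fun i => if (i < j)%N then nth point l i else tail n x i.
pose L (j : nat) := \bigcup_(i in `I_j) [set e : E | elevel e = n + i.+1%:Z].
pose U := \bigcup_(j in [set: nat])
  (rep j @` [set l | size l = j /\ forall e, e \in l -> L j e]).
apply: (@sub_countable _ _ _ U); last first.
  apply: bigcup_countable => // j _; apply: finite_set_countable.
  apply: finite_image; apply: finite_seqs; apply: bigcup_finite => // i _.
  exact: edges_finite.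
apply: subset_card_le => w [y [_ Xy [N xy]] yw].
pose j := `|N - n|%N.
exists j => //; exists [seq y (n + i.+1%:Z) | i <- iota 0 j].
  split; first by rewrite size_map size_iota.
  move=> e ep; have [i ij <-] := nthP point ep; rewrite size_map size_iota in ij.
  exists i => //=; rewrite (nth_map 0%N) ?size_iota// nth_iota//.
  by case: (Xy (n + i.+1%:Z)).
rewrite -yw; apply/funext => i; rewrite /rep; case: ltnP => ij.
  by rewrite (nth_map 0%N) ?size_iota// nth_iota.
by rewrite /tail xy//; lia.
Qed.

Section Class.
Variables (x y : bipath B).
Hypotheses (Yx : Y_ x) (xy : tail_equiv x y).
Local Notation w := (tail n y).
Local Notation v := (r (y n)).
Local Notation Cxy := (Cint haar m n x y).

(** One block of the left regular representation: the points reaching the tail of [y] through a path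
    of [EY]. *)
Definition class_slice : set (bipath B) :=
  \bigcup_(p in [set` EY_at v]) cylw p w.

Let mC p : measurable (cylw p w : set (bipath_mspace B)).
Proof. exact: measurable_cyl. Qed.

Let Xy : X_ y. Proof. by case: xy. Qed.
Let Xw : Xplus v w. Proof. exact: tail_Xplus. Qed.

Lemma class_sliceP z : class_slice z <->
  [/\ X_ z, EY m n (segment m n z) & tail n z = w].
Proof.
split=> [[p pv /(cylw_classP mn xy z pv)[Xz sz tz]]|[Xz pz tz]].
  by split => //; rewrite sz; case/EY_atP: pv.
have zv : segment m n z \in EY_at v.
  apply/EY_atP; split => //; rewrite prng_segment//.
  have [<- _] := tail_Xplus n Xz; rewrite tz; by case: Xw.
by exists (segment m n z) => //; apply/(cylw_classP mn xy z zv).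
Qed.

Lemma measurable_class_slice : measurable (class_slice : set (bipath_mspace B)).
Proof. by apply: fin_bigcup_measurable. Qed.

Lemma class_slice_sub : class_slice `<=` tail_equivY x.
Proof. by move=> z [p pv]; exact: cylw_sub_class. Qed.

Lemma class_integral (f : bipath B -> R) :
  (forall p, p \in EY_at v -> measurable_fun (cylw p w : set (bipath_mspace B)) f) ->
  (\int[haar x]_(z in class_slice) (f z)%:E =
   \sum_(p <- EY_at v) \int[haar x]_(z in cylw p w) (f z)%:E)%E.
Proof.
move=> mf; have tC := trivIset_cylw mn Xw; have uJ := EY_at_uniq m n v.
rewrite (integral_supported (haar x) uJ mC tC)//.
- by move=> p pv z Cz; exists p.
- by move=> z [p pv Cz] /(_ p pv).
Qed.

Lemma class_integral_step (f : bipath B -> R) (a : seq E -> R) :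
  (forall p z, p \in EY_at v -> cylw p w z -> f z = a p) ->
  (\int[haar x]_(z in class_slice) (f z)%:E =
   (\sum_(p <- EY_at v) a p * nu_r (psrc p))%:E)%E.
Proof.
move=> fa; rewrite class_integral; last first.
  move=> p pv; apply: (@eq_measurable_fun _ _ _ _ _ (cst (a p))).
    by move=> z /[!inE] Cz; rewrite (fa p).
  exact: measurable_cst.
rewrite -sumEFin; apply: eq_big_seq => p pv.
rewrite (eq_integral (cst (a p)%:E)); last by move=> z /[!inE] Cz; rewrite (fa p).
by rewrite integral_cst// (haar_cylw hh mn xy pv) EFinM.
Qed.

Variables (F : coeffs) (xi : bipath B -> C).
Hypothesis ixi : forall q, q \in EY_at v -> Cintegrable haar m n x y q xi.

(** The number [wt q * Cxy q xi] is the coordinate of [xi] along the normalised indicator of [q w].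
    The kernel acts on these coordinates by the matrix at [w], and the result is constant on each
    cylinder. *)
Lemma left_reg_cyl p z : p \in EY_at v -> cylw p w z ->
  left_reg haar x (kerF F) xi z =
  (wt p)%:C * mapp (EY_at v) (fun p q => F p q w) (fun q => (wt q)%:C * Cxy q xi) p.
Proof.
move=> pv /(cylw_classP mn xy z pv)[Xz sz tz].
have xz : tail_equiv x z by exact: (tail_eq_equiv mn xy Xz tz).
have rz : r (z n) = v.
  by have [<- _] := tail_Xplus n Xz; rewrite tz; case: Xw.
have CE q : Cint haar m n x z q xi = Cxy q xi by rewrite /Cint tz.
rewrite /left_reg (Cintegral_ker_of nu_r mn Yx xz); last first.
  by move=> q; rewrite rz => /ixi; rewrite /Cintegrable tz.
rewrite rz sz pv /mapp mulr_sumr; apply: eq_bigr => q _.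
rewrite CE tz rmorphM /=; ring.
Qed.

Lemma class_norm_left_reg :
  (\int[haar x]_(z in class_slice)
     ((Normc.normc (left_reg haar x (kerF F) xi z)) ^+ 2)%:E =
   (nrm2 (EY_at v) (mapp (EY_at v) (fun p q => F p q w)
      (fun q => (wt q)%:C * Cxy q xi)))%:E)%E.
Proof.
set u := mapp _ _ _.
rewrite (class_integral_step (a := fun p => wt p ^+ 2 * sqn (u p))).
  congr EFin; apply: eq_bigr => p _.
  by rewrite mulrAC (wt_sqr hB hnu) mul1r.
by move=> p z pv Cz; rewrite normc_sqn (left_reg_cyl pv Cz) sqnM sqn_real.
Qed.

End Class.

(** The last clause is Bessel's inequality for one normalised indicator: Cauchy-Schwarz for the real
    and imaginary parts on a cylinder of finite mass. *)
Lemma Cintegrable_of_L2 x y (xi : bipath B -> C) : Y_ x -> tail_equiv x y ->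
  L2_unit_ball haar x xi -> forall q, q \in EY_at (r (y n)) ->
  [/\ Cintegrable haar m n x y q xi,
      (\int[haar x]_(z in cylw q (tail n y)) (sqn (xi z))%:E < +oo)%E,
      measurable_fun (cylw q (tail n y) : set (bipath_mspace B)) (fun z => sqn (xi z)) &
      (wt q ^+ 2 * sqn (Cint haar m n x y q xi))%:E <=
        \int[haar x]_(z in cylw q (tail n y)) (sqn (xi z))%:E]%E.
Proof.
move=> Yx xy [mRe mIm L2] q qv.
set D := cylw q (tail n y).
have mD : measurable (D : set (bipath_mspace B)) by exact: measurable_cyl.
have mr : measurable_fun (D : set (bipath_mspace B)) (fun z => complex.Re (xi z)).
  exact: measurable_funS mRe.
have mi : measurable_fun (D : set (bipath_mspace B)) (fun z => complex.Im (xi z)).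
  exact: measurable_funS mIm.
have msq : measurable_fun (D : set (bipath_mspace B)) (fun z => sqn (xi z)).
  by apply: measurable_funD; exact: measurable_funX.
have fin : (\int[haar x]_(z in D) (sqn (xi z))%:E < +oo)%E.
  apply: (@le_lt_trans _ _ 1%E); last exact: ltry.
  apply: le_trans L2; rewrite /L2norm_sq.
  under [leRHS]eq_integral do rewrite normc_sqn.
  apply: ge0_subset_integral_gen; last by move=> z _; rewrite lee_fin sqn_ge0.
  exact: cylw_sub_class.
have muD : (haar x D < +oo)%E by exact: (haar_cylw_fin hh mn xy qv).
have lefin (f : bipath B -> R) : measurable_fun (D : set (bipath_mspace B)) f ->
    (forall z, f z ^+ 2 <= sqn (xi z)) -> (\int[haar x]_(z in D) (f z ^+ 2)%:E < +oo)%E.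
  move=> mf fs; apply: le_lt_trans fin; apply: ge0_le_integral => //.
  - by move=> z _; rewrite lee_fin sqr_ge0.
  - by apply/measurable_EFinP; exact: measurable_funX.
  - exact/measurable_EFinP.
  - by move=> z _; rewrite lee_fin.
have [ir ir2] := integrable_of_sqr mD muD mr
  (lefin _ mr (fun z => ltac:(by rewrite /sqn lerDl sqr_ge0))).
have [ii ii2] := integrable_of_sqr mD muD mi
  (lefin _ mi (fun z => ltac:(by rewrite /sqn lerDr sqr_ge0))).
split => //.
have h1 := sqr_Rintegral_le mD muD ir ir2.
have h2 := sqr_Rintegral_le mD muD ii ii2.
have -> : (\int[haar x]_(z in D) (sqn (xi z))%:E =
    (\int[haar x]_(z in D) (complex.Re (xi z) ^+ 2) +
     \int[haar x]_(z in D) (complex.Im (xi z) ^+ 2))%:E)%E.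
  rewrite -RintegralD// /Rintegral fineK//.
  by rewrite ge0_fin_numE// integral_ge0// => z _; rewrite lee_fin sqn_ge0.
rewrite lee_fin /Cint /sqn /= -/D.
have nq := nu_r_gt0 hB hnu (psrc q).
have hD : haar x D = (nu_r (psrc q))%:E by exact: (haar_cylw hh mn xy qv).
rewrite hD /= in h1 h2.
rewrite (wt_sqrE hB hnu) ler_pdivrMl//.
by rewrite mulrDr; apply: lerD.
Qed.

Lemma measurable_left_reg_slice x y F (xi : bipath B -> C) : Y_ x -> tail_equiv x y ->
  L2_unit_ball haar x xi ->
  measurable_fun (class_slice y : set (bipath_mspace B))
    (fun z => (Normc.normc (left_reg haar x (kerF F) xi z)) ^+ 2).
Proof.
move=> Yx xy L2; apply: measurable_fun_fin_cover.
  by move=> p; exact: measurable_cyl.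
move=> p pv.
apply: eq_measurable_fun (measurable_cst ((Normc.normc ((wt p)%:C *
   mapp (EY_at (r (y n))) (fun p q => F p q (tail n y))
   (fun q => (wt q)%:C * Cint haar m n x y q xi) p)) ^+ 2)) => z /[!inE] Cz.
by rewrite (left_reg_cyl Yx xy F _ pv Cz)// => q /(Cintegrable_of_L2 Yx xy L2)[].
Qed.

Lemma slice_norm_le x y F (xi : bipath B -> C) c : Y_ x -> tail_equiv x y ->
  L2_unit_ball haar x xi -> cbound F c ->
  (\int[haar x]_(z in class_slice y)
     ((Normc.normc (left_reg haar x (kerF F) xi z)) ^+ 2)%:E <=
   (c ^+ 2)%:E * \int[haar x]_(z in class_slice y) (sqn (xi z))%:E)%E.
Proof.
move=> Yx xy L2 hc.
have iq := Cintegrable_of_L2 Yx xy L2.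
rewrite (class_norm_left_reg Yx xy); last by move=> q /iq[].
have Xy : X_ y by case: xy.
apply: (@le_trans _ _ (c ^+ 2 * nrm2 (EY_at (r (y n)))
   (fun q => (wt q)%:C * Cint haar m n x y q xi))%:E).
  by rewrite lee_fin; apply: hc; exact: tail_Xplus.
rewrite EFinM; apply: lee_wpmul2l; first by rewrite lee_fin sqr_ge0.
rewrite (class_integral xy); last by move=> q /iq[].
rewrite /nrm2 -sumEFin big_seq [leRHS]big_seq; apply: lee_sum => q qv.
by rewrite sqnM sqn_real; have [] := iq q qv.
Qed.

(** Countable additivity over slices numbered by an injection of the tails into the naturals; on
    each of them [slice_norm_le] applies. *)
Lemma L2norm_left_reg_le x F (xi : bipath B -> C) c : Y_ x ->
  L2_unit_ball haar x xi -> cbound F c ->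
  (L2norm_sq haar x (left_reg haar x (kerF F) xi) <= (c ^+ 2)%:E)%E.
Proof.
move=> Yx L2 hc; have Xx : X_ x by case: Yx.
have /countable_injP[f fi] := countable_tails Xx.
(* The integrands vanish on the class outside the disjoint measurable sets S j,
   so measurability of the class itself is not needed. *)
pose S (j : nat) : set (bipath B) := [set z | [/\ tail_equiv x z,
  EY m n (segment m n z) & f (tail n z) = j]].
have SE j : S j = set0 \/ exists2 y, tail_equiv x y & S j = class_slice y.
  have [->|/set0P[y [xy py fy]]] := eqVneq (S j) set0; [by left|right].
  exists y => //; apply/seteqP; split=> z.
    move=> [xz pz fz]; apply/(class_sliceP xy); split => //; first by case: xz.
    by apply: fi; rewrite ?inE; [exists z|exists y|rewrite fz fy].
  move=> /(class_sliceP xy)[Xz pz tz]; split => //; last by rewrite tz.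
  exact: (tail_eq_equiv mn xy Xz tz).
have mS j : measurable (S j : set (bipath_mspace B)).
  by have [->|[y xy ->]] := SE j => //; exact: measurable_class_slice.
have tS : trivIset setT S by move=> i j _ _ [z [[_ _ <-] [_ _ <-]]].
have SD : \bigcup_j S j `<=` tail_equivY x.
  move=> z [j _]; have [->//|[y xy ->]] := SE j; exact: class_slice_sub.
pose g z := (Normc.normc (left_reg haar x (kerF F) xi z)) ^+ 2.
have g0 z : tail_equivY x z -> ~ (\bigcup_j S j) z -> g z = 0.
  move=> [_ _ xz] nS; rewrite /g normc_sqn /left_reg Cintegral_eq0 ?sqn0// => u.
  rewrite /ker_of asboolF ?mul0r// => -[_ _ pz _ _].
  by apply: nS; exists (f (tail n z)).
have -> : (L2norm_sq haar x (left_reg haar x (kerF F) xi) =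
    \int[haar x]_(z in \bigcup_j S j) (g z)%:E)%E.
  rewrite /L2norm_sq integral_mkcond [RHS]integral_mkcond.
  apply: eq_integral => z _; rewrite !patchE -/(g z).
  case: ifPn => [|/negP]; rewrite inE => zD; case: ifPn => //.
    by move=> /negP; rewrite inE => nS; rewrite g0.
  by rewrite inE => /SD.
have mg : measurable_fun (\bigcup_j S j : set (bipath_mspace B)) (EFin \o g).
  apply/measurable_fun_bigcup => // j; apply/measurable_EFinP.
  have [->|[y xy ->]] := SE j; first exact: measurable_fun_set0.
  exact: measurable_left_reg_slice.
have mxi : measurable_fun (\bigcup_j S j : set (bipath_mspace B))
    (fun z => (sqn (xi z))%:E).
  apply/measurable_EFinP; case: L2 => mr mi _.
  apply: (@measurable_funS _ _ _ _ setT) => //.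
  by apply: measurable_funD; exact: measurable_funX.
rewrite ge0_integral_bigcup//; last by move=> z _; rewrite lee_fin sqr_ge0.
apply: (@le_trans _ _ ((c ^+ 2)%:E * \sum_(0 <= j <oo) \int[haar x]_(z in S j) (sqn (xi z))%:E)%E).
  rewrite -nneseriesZl; last first.
    by move=> j _; apply: integral_ge0 => z _; rewrite lee_fin sqn_ge0.
  apply: lee_nneseries.
    by move=> j _ _; apply: integral_ge0 => z _; rewrite lee_fin sqr_ge0.
  move=> j _; have [->|[y xy ->]] := SE j; last exact: slice_norm_le.
  by rewrite !integral_set0 mule0.
rewrite -ge0_integral_bigcup//; last by move=> z _; rewrite lee_fin sqn_ge0.
rewrite -[leRHS]mule1; apply: lee_wpmul2l; first by rewrite lee_fin sqr_ge0.
case: L2 => _ _ L2; apply: le_trans L2; rewrite /L2norm_sq.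
under [leRHS]eq_integral do rewrite normc_sqn.
by apply: ge0_subset_integral_gen => // z _; rewrite lee_fin sqn_ge0.
Qed.

(** The vector with coordinates [a] in the normalised indicators of the slice at [w]. The matrix
    value is already attained by integrating over this slice, which bounds the full norm from
    below. *)
Lemma exists_test_vector F v w (a : seq E -> C) : Xplus v w ->
  nrm2 (EY_at v) a <= 1 -> EY_at v != [::] ->
  exists x xi, [/\ Y_ x, L2_unit_ball haar x xi &
    ((nrm2 (EY_at v) (mapp (EY_at v) (fun p q => F p q w) a))%:E <=
     L2norm_sq haar x (left_reg haar x (kerF F) xi))%E].
Proof.
move=> Xw a1 vn0.
have [p0 p0v] : exists p0, p0 \in EY_at v.
  by case: (EY_at v) vn0 => // p0 l _; exists p0; rewrite inE eqxx.
have /EY_atP[pp pv] := p0v.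
pose x := bip p0 w.
have [Xx sx tx] : [/\ X_ x, segment m n x = p0 & tail n x = w].
  by apply: (bipP mn (EY_paths pp)); rewrite pv.
have xx : tail_equiv x x by split => //; exists 0.
have Yx : Y_ x by apply: (@EY_Y _ m n x Xx); rewrite sx.
have rx : r (x n) = v by rewrite -(prng_segment x mn) sx.
pose xi z : C := if `[< class_slice x z >] then
  (wt (segment m n z))%:C * a (segment m n z) else 0.
have xiE q z : q \in EY_at v -> cylw q w z -> xi z = (wt q)%:C * a q.
  move=> qv Cz; rewrite /xi asboolT; last first.
    by exists q; rewrite /= ?rx// tx.
  have [] := (cylw_classP mn xx z (_ : q \in EY_at (r (x n)))).1; rewrite ?rx ?tx//.
  by move=> _ ->.
have xi0 z : (forall q, q \in EY_at v -> ~ cylw q w z) -> xi z = 0.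
  move=> h; rewrite /xi asboolF// => -[q /=]; rewrite rx tx => qv; exact: h.
have mC p : measurable (cylw p w : set (bipath_mspace B)) by exact: measurable_cyl.
have mstep (f : C -> R) : f 0 = 0 ->
    measurable_fun setT ((fun z => f (xi z)) : bipath_mspace B -> R).
  move=> f0; apply: (@measurable_step _ (bipath_mspace B) R _ (EY_at v) (fun q => cylw q w)
     (fun q => f ((wt q)%:C * a q)) _ mC).
    by move=> q z qv Cz; rewrite (xiE q).
  by move=> z h; rewrite xi0.
have L2E : L2norm_sq haar x xi = (nrm2 (EY_at v) a)%:E.
  rewrite /L2norm_sq.
  under eq_integral do rewrite normc_sqn.
  transitivity (\int[haar x]_(z in class_slice x) (sqn (xi z))%:E)%E.
    rewrite integral_mkcond [RHS]integral_mkcond; apply: eq_integral => z _.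
    rewrite !patchE; case: ifPn => [|/negP]; rewrite inE => zD; case: ifPn => //.
      by move=> /negP; rewrite inE => zS; rewrite /xi asboolF// sqn0.
    by rewrite inE => /(class_slice_sub Yx xx).
  rewrite (class_integral_step xx (a := fun q => wt q ^+ 2 * sqn (a q))).
    rewrite rx; congr EFin; apply: eq_bigr => p _.
    by rewrite mulrAC (wt_sqr hB hnu) mul1r.
  by move=> q z; rewrite rx tx => qv Cz; rewrite (xiE q)// sqnM sqn_real.
have L2 : L2_unit_ball haar x xi.
  split; [exact: (mstep (@complex.Re R))|exact: (mstep (@complex.Im R))|].
  by rewrite L2E lee_fin.
exists x, xi; split => //.
have iq q : q \in EY_at (r (x n)) -> Cintegrable haar m n x x q xi.
  by move=> qv; have [] := Cintegrable_of_L2 Yx xx L2 qv.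
have CE q : q \in EY_at v -> (wt q)%:C * Cint haar m n x x q xi = a q.
  move=> qv; rewrite /Cint tx.
  rewrite (@eq_Rintegral _ _ _ _ _ (cst (complex.Re ((wt q)%:C * a q)))); last first.
    by move=> z /[!inE] hz; rewrite /= (xiE q).
  rewrite [X in _ +i* X](@eq_Rintegral _ _ _ _ _ (cst (complex.Im ((wt q)%:C * a q)))); last first.
    by move=> z /[!inE] hz; rewrite /= (xiE q).
  have hq := haar_cylw hh mn xx (_ : q \in EY_at (r (x n))).
  rewrite rx tx in hq.
  rewrite !Rintegral_cst// hq//=.
  have := wt_sqr hB hnu q; case: (a q) => b d h; apply/eqP; rewrite eq_complex /=.
  apply/andP; split; apply/eqP.
    by rewrite -[RHS]mul1r -h; ring.
  by rewrite -[RHS]mul1r -h; ring.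
have := class_norm_left_reg Yx xx F iq; rewrite rx tx.
rewrite (@eq_nrm2 _ _ _ _ (mapp (EY_at v) (fun p q => F p q w) a)); last first.
  by move=> p pv'; apply: eq_big_seq => q qv; rewrite CE.
move=> <-; apply: ge0_subset_integral_gen; first exact: class_slice_sub.
by move=> z _; rewrite lee_fin sqr_ge0.
Qed.

(** The bound [c] keeps the supremum finite, so that [fine] loses nothing where test vectors
    exist. *)
Lemma reduced_norm_least F c : 0 <= c -> cbound F c ->
  least_bound F (reduced_norm haar (kerF F)).
Proof.
move=> c0 hc; rewrite /reduced_norm.
set A := (X in ereal_sup X).
have Ale b : 0 <= b -> cbound F b -> (ereal_sup A <= (b ^+ 2)%:E)%E.
  move=> b0 hb; apply: ge_ereal_sup => _ [x [xi [Yx L2 ->]]].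
  exact: L2norm_left_reg_le.
have fle b : 0 <= b -> cbound F b -> fine (ereal_sup A) <= b ^+ 2.
  move=> b0 hb; have := Ale b b0 hb.
  (* The value -oo, for empty [A], is sent to 0 by [fine]. *)
  by case: (ereal_sup A) => [t| |]//= _; rewrite sqr_ge0.
split; first exact: sqrtr_ge0.
  (* No path of [EY] need end at [v]; then the matrix is empty and there is no test vector. *)
  move=> v w Xw; have [v0|vn0] := eqVneq (EY_at v) [::].
    by move=> a; rewrite /nrm2 v0 !big_nil mulr0.
  apply: mbound_unit => a a1.
  have [x [xi [Yx L2 h]]] := exists_test_vector F Xw a1 vn0.
  have h2 : (L2norm_sq haar x (left_reg haar x (kerF F) xi) <= ereal_sup A)%E.
    by apply: ereal_sup_ubound; exists x, xi.
  have h3 := le_trans h h2; have h4 := Ale c c0 hc.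
  have fA : ereal_sup A \is a fin_num.
    by move: h3 h4; case: (ereal_sup A).
  have : nrm2 (EY_at v) (mapp (EY_at v) (fun p q => F p q w) a) <= fine (ereal_sup A).
    by rewrite -lee_fin fineK.
  move=> h5; rewrite sqr_sqrtr//; apply: le_trans h5; exact: nrm2_ge0.
move=> b b0 hb; rewrite -[leRHS]ger0_norm// -sqrtr_sqr.
by rewrite ler_wsqrtr//; exact: fle.
Qed.

End ReducedNorm.

(** * The C*-norm axioms and completeness *)

Lemma real_cauchy (R : realType) (u : nat -> R) :
  (forall e, 0 < e -> exists k0 : nat, forall j k, (k0 <= j)%N -> (k0 <= k)%N ->
     `|u j - u k| < e) ->
  exists l, forall e, 0 < e -> exists k0 : nat, forall k, (k0 <= k)%N -> `|u k - l| <= e.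
Proof.
move=> h; have : cvgn u.
  apply/cauchy_cvgP/cauchy_exP => e e0; have [k0 hk] := h e e0.
  exists (u k0); exists k0 => // k /= kk; rewrite /ball /=; exact: hk.
move=> cu; exists (limn u) => e e0.
have /cvgrPdist_le /(_ e e0) [k0 _ hk] := cu.
by exists k0 => k kk; rewrite distrC; exact: hk.
Qed.

Section ComplexLimits.
Variable R : realType.
Local Notation C := R[i].
Implicit Types (u : nat -> C).

(** Stated with the real-valued modulus, because the norm of [R[i]] takes its values in [R[i]]. *)
Definition ccvg u (l : C) : Prop := forall e : R, 0 < e ->
  exists k0 : nat, forall k, (k0 <= k)%N -> Normc.normc (u k - l) <= e.

Lemma normcB (y z : C) : Normc.normc (y - z) = Normc.normc (z - y).
Proof. by rewrite -normcN opprB. Qed.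

Lemma normc_dist (x y z : C) :
  Normc.normc (x - z) <= Normc.normc (x - y) + Normc.normc (y - z).
Proof. by rewrite -[x - z](subrKA y); exact: le_normcD. Qed.

Lemma normc_Re (z : C) : `|complex.Re z| <= Normc.normc z.
Proof.
rewrite -sqrtr_sqr normcE_sqrt; apply: ler_wsqrtr; by rewrite /sqn lerDl sqr_ge0.
Qed.

Lemma normc_Im (z : C) : `|complex.Im z| <= Normc.normc z.
Proof.
rewrite -sqrtr_sqr normcE_sqrt; apply: ler_wsqrtr; by rewrite /sqn lerDr sqr_ge0.
Qed.

Lemma normc_le_ReIm (z : C) : Normc.normc z <= `|complex.Re z| + `|complex.Im z|.
Proof.
rewrite -[leRHS]ger0_norm ?addr_ge0// -sqrtr_sqr normcE_sqrt; apply: ler_wsqrtr.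
rewrite /sqn -(real_normK (num_real (complex.Re z))) -(real_normK (num_real (complex.Im z))).
have := normr_ge0 (complex.Re z); have := normr_ge0 (complex.Im z); nra.
Qed.

Lemma ccauchy u :
  (forall e : R, 0 < e -> exists k0 : nat, forall j k, (k0 <= j)%N -> (k0 <= k)%N ->
     Normc.normc (u j - u k) < e) -> exists l, ccvg u l.
Proof.
move=> h.
have [a ha] : exists l, forall e : R, 0 < e -> exists k0 : nat,
    forall k, (k0 <= k)%N -> `|complex.Re (u k) - l| <= e.
  apply: real_cauchy => e /h[k0 hk]; exists k0 => j k kj kk.
  apply: le_lt_trans (hk _ _ kj kk); apply: le_trans (normc_Re _).
  by case: (u j) (u k) => ? ? [].
have [b hb] : exists l, forall e : R, 0 < e -> exists k0 : nat,
    forall k, (k0 <= k)%N -> `|complex.Im (u k) - l| <= e.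
  apply: real_cauchy => e /h[k0 hk]; exists k0 => j k kj kk.
  apply: le_lt_trans (hk _ _ kj kk); apply: le_trans (normc_Im _).
  by case: (u j) (u k) => ? ? [].
exists (a +i* b) => e e0; have e20 : 0 < e / 2 by rewrite divr_gt0.
have [k1 h1] := ha _ e20; have [k2 h2] := hb _ e20.
exists (maxn k1 k2) => k; rewrite geq_max => /andP[/h1 {}h1 /h2 {}h2].
apply: le_trans (normc_le_ReIm _) _; rewrite [leRHS]splitr.
by move: h1 h2; case: (u k) => c d /= h1 h2; exact: lerD.
Qed.

Lemma ccvg_unique u l l' : ccvg u l -> ccvg u l' -> l = l'.
Proof.
move=> h h'; apply/eqP; rewrite -subr_eq0; apply/eqP; apply: Normc.eq0_normc.
apply/eqP; rewrite eq_le normc_ge0 andbT; apply/ler_addgt0Pr => e e0; rewrite add0r.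
have e20 : 0 < e / 2 by rewrite divr_gt0.
have [k1 h1] := h _ e20; have [k2 h2] := h' _ e20.
apply: le_trans (normc_dist _ (u (maxn k1 k2)) _) _; rewrite [leRHS]splitr.
by apply: lerD; [rewrite normcB; apply: h1; exact: leq_maxl|apply: h2; exact: leq_maxr].
Qed.

Lemma ccvg_eq0 u l : (forall k, u k = 0) -> ccvg u l -> l = 0.
Proof.
move=> u0 ul; apply: ccvg_unique ul _ => e e0; exists 0%N => k _.
by rewrite u0 subrr Normc.normc0 ltW.
Qed.

End ComplexLimits.

(** * The reduced norm as a complete C*-norm on bounded coefficients *)

Section KernelNorm.
Variables (R : realType) (B : bratteli).
Local Notation V := (vertex B).
Local Notation E := (edge B).
Local Notation C := R[i].
Variables (nu_r nu_s : V -> R).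
Hypotheses (hB : standing_assumptions B) (hnu : is_state nu_r nu_s).
Variable haar : bipath B -> {measure set (bipath_mspace B) -> \bar R}.
Hypothesis hh : is_haar_system nu_r haar.
Variables (m n : int).
Hypothesis mn : m < n.
Local Notation coeffs := (coeffs R B).
Local Notation kerF := (ker_of nu_r m n).
Local Notation cbound := (cbound m n).
Local Notation entries_le := (entries_le m n).
Local Notation least_bound := (least_bound m n).
Local Notation fmul := (cmul m n).
Local Notation N := (reduced_norm haar).
Local Opaque reduced_norm.
Implicit Types (F G : coeffs).

Definition bounded_coeffs F : Prop := exists2 c : R, 0 <= c & entries_le F c.

Lemma bounded_lin (c : C) F G : bounded_coeffs F -> bounded_coeffs G ->
  bounded_coeffs (fun p q w => c * F p q w + G p q w).
Proof.
move=> [a a0 ha] [b b0 hb]; exists (Normc.normc c * a + b).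
  by rewrite addr_ge0// mulr_ge0// normc_ge0.
move=> p q w pq Xw; apply: le_trans (le_normcD _ _) _.
rewrite Normc.normcM; apply: lerD; last exact: hb.
by apply: ler_wpM2l; [exact: normc_ge0|exact: ha].
Qed.

Lemma bounded_sub F G : bounded_coeffs F -> bounded_coeffs G ->
  bounded_coeffs (fun p q w => F p q w - G p q w).
Proof.
move=> hF hG; have := bounded_lin (-1) hG hF.
rewrite (_ : (fun p q w => _) = (fun p q w => F p q w - G p q w))//.
by apply/funext => p; apply/funext => q; apply/funext => w; rewrite mulN1r addrC.
Qed.

Lemma norm_least F : bounded_coeffs F -> least_bound F (N (kerF F)).
Proof.
move=> [c c0 hc]; apply: (@reduced_norm_least _ _ _ _ hB hnu _ hh _ _ mn _
  (c * (size (@EY_seq B m n))%:R)); first by rewrite mulr_ge0.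
exact: entries_le_cbound.
Qed.

Lemma norm_ge0 (a : Defs.kernel B R) : 0 <= N a.
Proof. exact: sqrtr_ge0. Qed.

Lemma norm_le_entries F c : 0 <= c -> entries_le F c ->
  N (kerF F) <= c * (size (@EY_seq B m n))%:R.
Proof.
move=> c0 h; have [_ _ least] := norm_least (ex_intro2 _ _ c c0 h).
by apply: least; [rewrite mulr_ge0|exact: entries_le_cbound].
Qed.

Lemma entries_le_norm F : bounded_coeffs F -> entries_le F (N (kerF F)).
Proof.
by move=> /norm_least[N0 Nb _]; exact: cbound_entries_le.
Qed.

Lemma norm_eq0 F : bounded_coeffs F -> N (kerF F) = 0 -> kerF F = 0.
Proof.
move=> bF N0; have h := entries_le_norm bF; rewrite N0 in h.
rewrite (@eq_ker_of _ _ nu_r _ _ mn _ (fun _ _ _ => 0)).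
  apply/funext => x; apply/funext => y; rewrite /ker_of mulr0.
  by case: ifP.
move=> p q w pq Xw; apply: Normc.eq0_normc; apply/eqP.
by rewrite eq_le h//= normc_ge0.
Qed.

Lemma kerFZ (c : C) F : c *: kerF F = kerF (fun p q w => c * F p q w).
Proof.
apply/funext => x; apply/funext => y.
transitivity (c * kerF F x y); first by [].
by rewrite /ker_of; case: asboolP => _; rewrite ?mulr0// mulrCA.
Qed.

Lemma kerFD F G : kerF F + kerF G = kerF (fun p q w => F p q w + G p q w).
Proof.
apply/funext => x; apply/funext => y.
transitivity (kerF F x y + kerF G x y); first by [].
by rewrite /ker_of; case: asboolP => _; rewrite ?addr0// mulrDr.
Qed.

Lemma kerFB F G : kerF F - kerF G = kerF (fun p q w => F p q w - G p q w).
Proof.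
apply/funext => x; apply/funext => y.
transitivity (kerF F x y - kerF G x y); first by [].
by rewrite /ker_of; case: asboolP => _; rewrite ?subr0// mulrBr.
Qed.

Lemma bounded_scale (c : C) F : bounded_coeffs F ->
  bounded_coeffs (fun p q w => c * F p q w).
Proof.
move=> [a a0 ha]; exists (Normc.normc c * a); first by rewrite mulr_ge0 ?normc_ge0.
move=> p q w pq Xw; rewrite Normc.normcM; apply: ler_wpM2l; first exact: normc_ge0.
exact: ha.
Qed.

Lemma normZ_le (c : C) F : bounded_coeffs F ->
  N (c *: kerF F) <= Normc.normc c * N (kerF F).
Proof.
move=> bF; rewrite kerFZ.
have [N0 Nb _] := norm_least bF.
have [_ _ least] := norm_least (bounded_scale c bF).
apply: least; first by rewrite mulr_ge0 ?normc_ge0.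
by move=> v w Xw; apply: mboundZ; exact: Nb.
Qed.

(** The reverse inequality is [normZ_le] for the scalar c^-1. *)
Lemma normZ (c : C) F : bounded_coeffs F ->
  N (c *: kerF F) = Normc.normc c * N (kerF F).
Proof.
move=> bF; apply/eqP; rewrite eq_le normZ_le//=.
have [->|c0] := eqVneq c 0; first by rewrite Normc.normc0 mul0r norm_ge0.
have cp : 0 < Normc.normc c.
  rewrite lt_neqAle normc_ge0 andbT eq_sym; apply/eqP => /Normc.eq0_normc /eqP.
  exact/negP.
have := normZ_le c^-1 (bounded_scale c bF).
by rewrite -kerFZ scalerA mulVf// scale1r Normc.normcV ler_pdivlMl.
Qed.

Lemma normD F G : bounded_coeffs F -> bounded_coeffs G ->
  N (kerF F + kerF G) <= N (kerF F) + N (kerF G).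
Proof.
move=> bF bG; have [F0 Fb _] := norm_least bF; have [G0 Gb _] := norm_least bG.
rewrite kerFD.
have bFG : bounded_coeffs (fun p q w => F p q w + G p q w).
  by have := bounded_lin 1 bF bG; under eq_fun do under eq_fun do under eq_fun do rewrite mul1r.
have [_ _ least] := norm_least bFG.
apply: least (addr_ge0 F0 G0) _ => v w Xw.
exact: (@mboundD _ _ _ (fun p q => F p q w) (fun p q => G p q w) _ _ F0 G0 (Fb v w Xw) (Gb v w Xw)).
Qed.

Lemma cmul_mmul v w F G p q : p \in EY_at m n v ->
  fmul F G p q w = mmul (EY_at m n v) (fun p q => F p q w) (fun p q => G p q w) p q.
Proof. by move=> /EY_atP[_ pv]; rewrite /cmul pv. Qed.

Lemma cbound_cmul F G a b : cbound F a -> cbound G b -> cbound (fmul F G) (a * b).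
Proof.
move=> Fa Gb v w Xw; apply: eq_mbound (mboundM (Fa v w Xw) (Gb v w Xw)).
by move=> p q pv qv; rewrite -cmul_mmul.
Qed.

Lemma bounded_cmul F G : bounded_coeffs F -> bounded_coeffs G ->
  bounded_coeffs (fmul F G).
Proof.
move=> /norm_least[F0 Fb _] /norm_least[G0 Gb _].
have FG0 := mulr_ge0 F0 G0; exists (N (kerF F) * N (kerF G)); first exact: FG0.
by apply: cbound_entries_le; [exact: FG0|exact: cbound_cmul Fb Gb].
Qed.

Lemma bounded_cstar F : bounded_coeffs F -> bounded_coeffs (cstar F).
Proof.
move=> [c c0 h]; exists c => // p q w [/= pp qq pq] Xw.
rewrite /cstar normc_conj; apply: h.
  by split => //=.
by rewrite -pq.
Qed.

Lemma normM F G : bounded_coeffs F -> bounded_coeffs G ->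
  N (Defs.conv haar (kerF F) (kerF G)) <= N (kerF F) * N (kerF G).
Proof.
move=> bF bG; rewrite (conv_ker_of hB hnu hh mn).
have [F0 Fb _] := norm_least bF; have [G0 Gb _] := norm_least bG.
have [_ _ least] := norm_least (bounded_cmul bF bG).
by apply: least (mulr_ge0 F0 G0) _; exact: cbound_cmul Fb Gb.
Qed.

Local Opaque ker_of.

(** If M bounds all matrices of F^* F, then sqrt M bounds those of F, and the norm is the least such
    bound. *)
Lemma norm_sqr_le F : bounded_coeffs F ->
  N (kerF F) ^+ 2 <= N (kerF (fmul (cstar F) F)).
Proof.
move=> bF; have [M0 Mb _] := norm_least (bounded_cmul (bounded_cstar bF) bF).
set M := N (kerF (fmul _ _)) in M0 Mb *.
have [F0 _ least] := norm_least bF.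
rewrite -(sqr_sqrtr M0) ler_sqr ?nnegrE ?sqrtr_ge0//.
apply: least; first exact: sqrtr_ge0.
move=> v w Xw; apply: mbound_mstar_mmul => //.
by apply: eq_mbound (Mb v w Xw) => p q pv qv; rewrite (cmul_mmul _ _ _ _ pv).
Qed.

Lemma norm_le_cstar F : bounded_coeffs F -> N (kerF F) <= N (kerF (cstar F)).
Proof.
move=> bF; have [F0|Fn0] := eqVneq (N (kerF F)) 0; first by rewrite F0 norm_ge0.
have Fp : 0 < N (kerF F) by rewrite lt_neqAle eq_sym Fn0 norm_ge0.
have h1 := norm_sqr_le bF; have h2 := normM (bounded_cstar bF) bF.
rewrite (conv_ker_of hB hnu hh mn) in h2.
have h := le_trans h1 h2.
by rewrite expr2 (ler_pM2r Fp) in h.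
Qed.

Lemma cstarK F : cstar (cstar F) = F.
Proof.
apply/funext => p; apply/funext => q; apply/funext => w; exact: conjcK.
Qed.

Lemma norm_cstar_identity F : bounded_coeffs F ->
  N (Defs.conv haar (kstar (kerF F)) (kerF F)) = N (kerF F) ^+ 2.
Proof.
move=> bF; have bS := bounded_cstar bF.
rewrite kstar_ker_of//; have h1 := normM bS bF; have h2 := norm_le_cstar bS; have h3 := norm_sqr_le bF.
rewrite cstarK in h2; rewrite (conv_ker_of hB hnu hh mn) in h1.
rewrite (conv_ker_of hB hnu hh mn).
have aux (a b c : R) : 0 <= a -> c <= b * a -> b <= a -> a ^+ 2 <= c -> c = a ^+ 2.
  move=> a0 cb ba ac; apply/eqP; rewrite eq_le ac andbT.
  by apply: (le_trans cb); rewrite expr2; exact: ler_wpM2r.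
exact: aux (norm_ge0 _) h1 h2 h3.
Qed.

(** For completeness: entries are bounded by the norm, so a Cauchy sequence has uniformly Cauchy
    coefficients. Their limit is in the image by the last hypothesis, and the norm is at most a
    constant times the largest entry. *)
Lemma kernel_cstar_norm (A : staralg R) (j : A -> Defs.kernel B R) :
  is_star_algebra A ->
  (forall x : A, sa_set x -> exists2 F, bounded_coeffs F & j x = kerF F) ->
  (forall (c : C) (x y : A), sa_set x -> sa_set y -> j (c *: x + y) = c *: j x + j y) ->
  (forall x y : A, sa_set x -> sa_set y -> j (sa_mul x y) = Defs.conv haar (j x) (j y)) ->
  (forall x : A, sa_set x -> j (sa_star x) = kstar (j x)) ->
  (forall x : A, sa_set x -> j x = 0 -> x = 0) ->
  (forall (u : nat -> A) (Fs : nat -> coeffs) F,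
     (forall k, sa_set (u k)) -> (forall k, j (u k) = kerF (Fs k)) ->
     bounded_coeffs F ->
     (forall e : R, 0 < e -> exists k0 : nat, forall k, (k0 <= k)%N ->
        entries_le (fun p q w => Fs k p q w - F p q w) e) ->
     exists2 l, sa_set l & j l = kerF F) ->
  is_cstar_norm (fun x : A => N (j x)).
Proof.
move=> hA jK jL jM jS j0 jcl.
have A0 : sa_set (0 : A) by exact: sa_zero.
have AN (x : A) : sa_set x -> sa_set (- x) by move=> hx; rewrite -scaleN1r; exact: sa_scale.
have AB (x y : A) : sa_set x -> sa_set y -> sa_set (x - y).
  by move=> hx hy; apply: sa_add => //; exact: AN.
have jZ (c : C) (x : A) : sa_set x -> j (c *: x) = c *: j x.
  move=> hx; have z0 : j 0 = 0.
    have := jL 1 0 0 A0 A0; rewrite !scale1r addr0 => /eqP.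
    by rewrite -subr_eq subrr => /eqP <-.
  by have := jL c x 0 hx A0; rewrite addr0 z0 addr0.
have jD (x y : A) : sa_set x -> sa_set y -> j (x + y) = j x + j y.
  by move=> hx hy; rewrite -{1}[x]scale1r jL// scale1r.
have jB (x y : A) : sa_set x -> sa_set y -> j (x - y) = j x - j y.
  move=> hx hy; rewrite jD//; last exact: AN.
  by rewrite -scaleN1r jZ// scaleN1r.
split.
- by move=> x _; exact: norm_ge0.
- by move=> x hx; have [F bF e] := jK x hx; rewrite e => /(norm_eq0 bF); rewrite -e; exact: j0.
- by move=> c x hx; rewrite jZ//; have [F bF ->] := jK x hx; exact: normZ.
- move=> x y hx hy; rewrite jD//.
  by have [F bF ->] := jK x hx; have [G bG ->] := jK y hy; exact: normD.
- move=> x y hx hy; rewrite jM//.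
  by have [F bF ->] := jK x hx; have [G bG ->] := jK y hy; exact: normM.
- move=> x hx; rewrite jM//; last exact: sa_star_in.
  by rewrite jS//; have [F bF ->] := jK x hx; exact: norm_cstar_identity.
move=> u hu cu.
have [Fs hFs] : {Fs : nat -> coeffs & forall k, bounded_coeffs (Fs k) /\ j (u k) = kerF (Fs k)}.
  by apply: (@choice _ _ (fun k F => bounded_coeffs F /\ j (u k) = kerF F)) => k;
    have [F bF e] := jK (u k) (hu k); exists F.
have cF (e : R) : 0 < e -> exists k0 : nat, forall a b, (k0 <= a)%N -> (k0 <= b)%N ->
    forall p q w, pairsY m n (p, q) -> Xplus (prng p) w ->
    Normc.normc (Fs a p q w - Fs b p q w) < e.
  move=> /cu[k0 hk]; exists k0 => a b ka kb p q w pq Xw.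
  apply: le_lt_trans (hk a b ka kb).
  rewrite jB//; have [bFa ->] := hFs a; have [bFb ->] := hFs b; rewrite kerFB.
  exact: (entries_le_norm (bounded_sub bFa bFb)).
pose F : coeffs := fun p q w => xget 0 [set l | ccvg (fun k => Fs k p q w) l].
have FP p q w : pairsY m n (p, q) -> Xplus (prng p) w -> ccvg (fun k => Fs k p q w) (F p q w).
  move=> pq Xw; have [l hl] : exists l, ccvg (fun k => Fs k p q w) l.
    apply: ccauchy => e /cF[k0 hk]; exists k0 => a b ka kb; exact: hk.
  exact: (xgetI 0 hl).
(* The second index of the uniform Cauchy estimate is sent to infinity. *)
have ucv (e : R) : 0 < e -> exists k0 : nat, forall k, (k0 <= k)%N ->
    entries_le (fun p q w => Fs k p q w - F p q w) e.
  move=> /cF[k0 hk]; exists k0 => k kk p q w pq Xw.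
  apply/ler_addgt0Pr => d d0; have [k1 h1] := FP p q w pq Xw d d0.
  apply: le_trans (normc_dist _ (Fs (maxn k0 k1) p q w) _) _; apply: lerD.
    by apply/ltW/hk => //; exact: leq_maxl.
  by apply: h1; exact: leq_maxr.
have bF : bounded_coeffs F.
  have [k0 hk] := ucv 1 ltr01; have [[c c0 hc] _] := hFs k0.
  exists (c + 1); first by rewrite addr_ge0.
  move=> p q w pq Xw; have := hk k0 (leqnn _) p q w pq Xw => h.
  have := le_normcD (Fs k0 p q w) (- (Fs k0 p q w - F p q w)).
  rewrite normcN opprB addrC subrK => h'; apply: (le_trans h'); apply: lerD => //.
  exact: hc.
have [l hl jl] := jcl u Fs F hu (fun k => (hFs k).2) bF ucv.
exists l => //; apply/cvgrPdist_le => e e0.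
pose S := (size (@EY_seq B m n))%:R : R.
have S0 : 0 <= S by rewrite ler0n.
(* [S] is 0 when [EY] is empty, hence the denominator S + 1. *)
have e'0 : 0 < e / (S + 1) by rewrite divr_gt0// ltr_wpDl.
have [k0 hk] := ucv _ e'0; exists k0 => // k /= kk.
rewrite sub0r normrN ger0_norm ?norm_ge0// jB// jl (hFs k).2 kerFB.
apply: le_trans (norm_le_entries (ltW e'0) (hk k kk)) _.
rewrite -/S -mulrA ler_piMr//; first exact: ltW.
by rewrite mulrC ler_pdivrMr ?ltr_wpDl// mul1r lerDl.
Qed.

End KernelNorm.

(** * Continuity *)

Section Continuity.
Variable R : realType.
Local Notation C := R[i].

Lemma filter_normc_dist (T : Type) (F : set_system T) (FF : Filter F) (f : T -> C) (l : C) :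
  ((f : T -> C^o) @ F --> (l : C^o)) <->
  forall e : R, 0 < e -> \forall t \near F, Normc.normc (l - f t) < e.
Proof.
have normE (z : C^o) : `|z| = (Normc.normc (z : C))%:C by rewrite normc_def; case: z.
rewrite cvgrPdist_lt; split=> h e e0.
  have := h (e%:C); rewrite ltcR => /(_ e0); apply: filterS => t.
  by rewrite normE ltcR.
(* A positive element of [R[i]] is a positive real. *)
have /andP[/eqP ime ree] : (complex.Im e == 0) && (0 < complex.Re e).
  by move: e0; rewrite ltcE.
have := h _ ree; apply: filterS => t; rewrite normE.
by case: e ime {e0 ree} => a b /= ->; rewrite ltcE /= eqxx.
Qed.

Definition icont (c : R) (g : R -> C) : Prop := forall t, 0 <= t <= c ->
  forall e, 0 < e -> exists2 d : R, 0 < d &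
    forall u, 0 <= u <= c -> `|t - u| < d -> Normc.normc (g t - g u) < e.

Lemma within_icont c (g : R -> C) :
  {within `[0, c], continuous (g : R -> C^o)} <-> icont c g.
Proof.
rewrite subspace_continuousP; split=> h t tc.
  have tc' : `[0, c]%classic t by rewrite /= in_itv.
  have /filter_normc_dist hc := h t tc'.
  move=> e e0; have [d d0 hd] := (nbhs_ballP _ _).1 (hc e e0).
  by exists d => // u uc td; apply: (hd u td); rewrite /= in_itv.
apply/filter_normc_dist => e e0.
have [|d d0 hd] := h t _ e e0; first by move: tc; rewrite /= in_itv.
apply/nbhs_ballP; exists d => // u ud /=; rewrite in_itv /= => uc; exact: hd.
Qed.

Lemma continuous_normc_dist (g : R -> C) :
  continuous (g : R -> C^o) <-> forall t e, 0 < e -> exists2 d : R, 0 < d &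
    forall u, `|t - u| < d -> Normc.normc (g t - g u) < e.
Proof.
split=> h t.
  move=> e e0; have /filter_normc_dist hc := h t.
  have [d d0 hd] := (nbhs_ballP _ _).1 (hc e e0).
  by exists d => // u ud; exact: hd.
apply/filter_normc_dist => e e0; have [d d0 hd] := h t e e0.
by apply/nbhs_ballP; exists d => // u ud; exact: hd.
Qed.

Lemma icont_cst c (z : C) : icont c (fun=> z).
Proof. by move=> t _ e e0; exists 1 => // u _ _; rewrite subrr Normc.normc0. Qed.

Lemma icont_comp2 c (g h : R -> C) (op : C -> C -> C) : icont c g -> icont c h ->
  (forall y z e, 0 < e -> exists2 d : R, 0 < d & forall y' z',
     Normc.normc (y - y') < d -> Normc.normc (z - z') < d ->
     Normc.normc (op y z - op y' z') < e) ->
  icont c (fun t => op (g t) (h t)).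
Proof.
move=> cg ch cop t tc e e0; have [d d0 hd] := cop (g t) (h t) e e0.
have [d1 d10 h1] := cg t tc d d0; have [d2 d20 h2] := ch t tc d d0.
exists (Num.min d1 d2); first by rewrite lt_min d10.
by move=> u uc; rewrite lt_min => /andP[u1 u2]; apply: hd; [exact: h1|exact: h2].
Qed.

Lemma icontD c (g h : R -> C) : icont c g -> icont c h -> icont c (fun t => g t + h t).
Proof.
move=> cg ch; apply: (icont_comp2 (op := +%R) cg ch) => y z e e0.
exists (e / 2); first by rewrite divr_gt0.
move=> y' z' hy hz; rewrite opprD addrACA [ltRHS]splitr.
by apply: le_lt_trans (le_normcD _ _) _; exact: ltrD.
Qed.

Lemma icontM c (g h : R -> C) : icont c g -> icont c h -> icont c (fun t => g t * h t).
Proof.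
move=> cg ch; apply: (icont_comp2 (op := *%R) cg ch) => y z e e0.
(* Bounds |y| + |z'| once |z - z'| < 1. *)
pose M := Normc.normc y + Normc.normc z + 1.
have ny := normc_ge0 y; have nz := normc_ge0 z.
have M0 : 0 < M by rewrite /M; lra.
exists (Num.min 1 (e / M)); first by rewrite lt_min ltr01 divr_gt0.
move=> y' z'; rewrite !lt_min => /andP[y1 ye] /andP[z1 ze].
have -> : y * z - y' * z' = y * (z - z') + (y - y') * z' by ring.
apply: le_lt_trans (le_normcD _ _) _; rewrite !Normc.normcM.
have z'M : Normc.normc z' <= Normc.normc z + 1.
  have := normc_dist z' z 0; rewrite !subr0 normcB.
  by move: z1; set a := Normc.normc (z - z'); lra.
move: ye ze; rewrite !ltr_pdivlMr// /M.
have := normc_ge0 (y - y'); have := normc_ge0 (z - z'); have := normc_ge0 z'.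
move: z'M ny nz; set a := Normc.normc y; set b := Normc.normc z.
set b' := Normc.normc z'; set p := Normc.normc (y - y'); set q := Normc.normc (z - z').
move=> b'b a0 b0 b'0 q0 p0 pe qe.
have h1 : p * b' <= p * (b + 1) by apply: ler_wpM2l.
have e1 : q * (a + b + 1) < e by [].
have [qp|pq] := leP q p.
  have : a * q <= a * p by apply: ler_wpM2l.
  by move: pe h1; rewrite !mulrDr !mulr1 [p * a]mulrC; lra.
have : p * (b + 1) <= q * (b + 1) by apply: ler_wpM2r; [lra|exact: ltW].
by move: qe h1; rewrite !mulrDr !mulr1 [q * a]mulrC; lra.
Qed.

Lemma icont_conj c (g : R -> C) : icont c g -> icont c (fun t => conjc (g t)).
Proof.
move=> cg t tc e e0; have [d d0 h] := cg t tc e e0; exists d => // u uc tu.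
have := h u uc tu; rewrite (_ : conjc (g t) - conjc (g u) = conjc (g t - g u)).
  by rewrite normc_conj.
by case: (g t) (g u) => a b [a' b']; apply/eqP; rewrite eq_complex /= opprD eqxx /=.
Qed.

Lemma icont_sum (I : Type) (J : seq I) c (g : I -> R -> C) :
  (forall i, icont c (g i)) -> icont c (fun t => \sum_(i <- J) g i t).
Proof.
move=> cg; elim: J => [|i J IH].
  rewrite (_ : (fun t => _) = fun=> 0); first exact: icont_cst.
  by apply/funext => t; rewrite big_nil.
rewrite (_ : (fun t => _) = fun t => g i t + \sum_(i <- J) g i t); first exact: icontD.
by apply/funext => t; rewrite big_cons.
Qed.

(** The extreme value theorem for the modulus of g. *)
Lemma icont_bounded c (g : R -> C) : 0 <= c -> icont c g ->
  exists2 M : R, 0 <= M & forall t, 0 <= t <= c -> Normc.normc (g t) <= M.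
Proof.
move=> c0 cg.
have hc : {within `[0, c], continuous (fun t => Normc.normc (g t))}.
  apply/subspace_continuousP => t tc; apply/cvgrPdist_lt => e e0.
  have [|d d0 hd] := cg t _ e e0; first by move: tc; rewrite /= in_itv.
  apply/nbhs_ballP; exists d => // u ud /=; rewrite in_itv /= => uc.
  apply: le_lt_trans (hd u uc ud); rewrite ler_norml.
  have := normc_dist (g t) (g u) 0; have := normc_dist (g u) (g t) 0.
  rewrite !subr0 [Normc.normc (g u - g t)]normcB => h1 h2.
  by rewrite /from_subspace; apply/andP; split; lra.
have [u uc hu] := EVT_max c0 hc.
exists (Normc.normc (g u)); first exact: normc_ge0.
by move=> t tc; apply: hu; rewrite in_itv.
Qed.

Lemma C0_icont c (g : R -> C) : C0_itv c g -> icont c g.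
Proof.
move=> [/continuous_normc_dist h _] t tc e /(h t)[d d0 hd].
by exists d => // u _; exact: hd.
Qed.

Lemma C0_ends c (g : R -> C) : C0_itv c g -> g 0 = 0 /\ g c = 0.
Proof. by move=> [_ h]; split; apply: h; rewrite ltxx; case. Qed.

(** [C0_itv] consists of functions on the whole line, whereas [icont] controls a function on the
    closed interval only. *)
Definition cut (c : R) (g : R -> C) : R -> C := fun t => if 0 < t < c then g t else 0.

Lemma cutE c (g : R -> C) t : 0 <= t <= c -> g 0 = 0 -> g c = 0 -> cut c g t = g t.
Proof.
move=> /andP[t0 tc] g0 gc; rewrite /cut; have [->|tn0] := eqVneq t 0.
  by rewrite ltxx g0.
have [->|tnc] := eqVneq t c; first by rewrite ltxx andbF gc.
by rewrite !lt_neqAle t0 tc tnc eq_sym tn0.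
Qed.

(* The extension by zero is g composed with the retraction of the line onto
   the interval. *)
Lemma C0_cut c (g : R -> C) : 0 <= c -> icont c g -> g 0 = 0 -> g c = 0 ->
  C0_itv c (cut c g).
Proof.
move=> c0 cg g0 gc; split; last first.
  by move=> t /= nt; rewrite /cut; case: ifP => // /andP[? ?]; case: nt.
pose k t := Num.max 0 (Num.min t c).
have kc t : 0 <= k t <= c by rewrite /k le_max lexx /= ge_max c0 ge_min lexx orbT.
have kE t : cut c g t = g (k t).
  rewrite /cut /k; have [t0|t0] := leP t 0.
    by rewrite /= (min_idPl _) ?(le_trans t0)// (max_idPl _).
  have [ct|tc] /= := leP c t; first by rewrite (max_idPr _).
  by rewrite (max_idPr _)// ltW.
apply/continuous_normc_dist => t e e0; have [d d0 hd] := cg _ (kc t) e e0.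
exists d => // u tu; rewrite !kE; apply: hd => //; apply: le_lt_trans tu.
rewrite /k; case: (leP t c) => h1; case: (leP u c) => h2; case: (leP 0 t) => h3;
  case: (leP 0 u) => h4; case: (leP 0 c) => h5; rewrite ler_norml;
  apply/andP; split; case: (ler0P (t - u)) => h6; lra.
Qed.

Lemma C0_lin c (z : C) (g h : R -> C) : 0 <= c -> C0_itv c g -> C0_itv c h ->
  C0_itv c (fun t => z * g t + h t).
Proof.
move=> c0 Cg Ch; have [g0 gc] := C0_ends Cg; have [h0 hc] := C0_ends Ch.
have ci : icont c (fun t => z * g t + h t).
  apply: icontD; last exact: C0_icont.
  by apply: icontM; [exact: icont_cst|exact: C0_icont].
rewrite (_ : (fun t => _) = cut c (fun t => z * g t + h t)).
  by apply: C0_cut => //; rewrite ?g0 ?gc ?h0 ?hc mulr0 addr0.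
apply/funext => t; rewrite /cut; case: ifP => // /negP nt.
rewrite (Cg.2 t) ?(Ch.2 t) ?mulr0 ?addr0//.
  by move=> [? ?]; apply: nt; apply/andP.
by move=> [? ?]; apply: nt; apply/andP.
Qed.

Lemma C0_0 c : C0_itv c (fun=> 0 : C).
Proof.
split => //; apply/continuous_normc_dist => t e e0; exists 1 => // u _.
by rewrite subrr Normc.normc0.
Qed.

End Continuity.

(** * Continuity on the space of rays by comparison of prefixes *)

Section RayContinuity.
Variables (R : realType) (B : bratteli).
Local Notation V := (vertex B).
Local Notation E := (edge B).
Local Notation C := R[i].

Lemma nbhs_ray_prefix (w : ray B) k :
  nbhs w [set w' : ray B | forall i, (i <= k)%N -> w' i = w i].
Proof.
have coord i : nbhs w [set w' : ray B | w' i = w i].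
  have := @proj_continuous nat (fun _ => discrete_topology E) i w.
  move=> /(_ [set e | e = w i]); apply.
  by rewrite nbhs_principalE; apply/principal_filterP.
elim: k => [|k IH].
  by apply: filterS (coord 0%N) => w' /= h i; rewrite leqn0 => /eqP ->.
apply: filterS (filterI IH (coord k.+1)) => w' [/= h1 h2] i.
by rewrite leq_eqVlt => /orP[/eqP ->//|]; exact: h1.
Qed.

Lemma within_ray_continuous (A : set (ray B)) (f : ray B -> C) :
  (forall w, A w -> forall e : R, 0 < e -> exists k : nat, forall w', A w' ->
     (forall i, (i <= k)%N -> w' i = w i) -> Normc.normc (f w - f w') < e) ->
  {within A, continuous (f : ray B -> C^o)}.
Proof.
move=> h; apply/subspace_continuousP => w Aw; apply/filter_normc_dist => e e0.
have [k hk] := h w Aw e e0; rewrite /within /=.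
by apply: filterS (nbhs_ray_prefix w k) => w' h' Aw'; exact: hk.
Qed.

End RayContinuity.

(** * The algebra B_mn *)

Section StarAlgebras.
Variables (R : realType) (B : bratteli).
Local Notation V := (vertex B).
Local Notation E := (edge B).
Local Notation C := R[i].
Variables (nu_r nu_s : V -> R).
Hypotheses (hB : standing_assumptions B) (hnu : is_state nu_r nu_s).
Variable haar : bipath B -> {measure set (bipath_mspace B) -> \bar R}.
Hypothesis hh : is_haar_system nu_r haar.
Variables (m n : int).
Hypothesis mn : m < n.
Local Notation coeffs := (coeffs R B).
Local Notation kerF := (ker_of nu_r m n).
Local Notation fmul := (cmul m n).
Implicit Types (F G H : coeffs).

Lemma conv_ker_of_assoc F G H :
  Defs.conv haar (kerF F) (Defs.conv haar (kerF G) (kerF H)) =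
  Defs.conv haar (Defs.conv haar (kerF F) (kerF G)) (kerF H).
Proof.
rewrite !(conv_ker_of hB hnu hh mn); apply: (eq_ker_of nu_r mn) => p q w [/= pp qq pq] Xw.
rewrite /cmul.
under eq_bigr do rewrite mulr_sumr.
under [RHS]eq_bigr do rewrite mulr_suml.
rewrite [RHS]exchange_big /=; apply: eq_big_seq => z /EY_atP[_ ->].
by apply: eq_bigr => u _; rewrite mulrA.
Qed.

Lemma conv_ker_of_linl (c : C) F G H :
  Defs.conv haar (c *: kerF F + kerF G) (kerF H) =
  c *: Defs.conv haar (kerF F) (kerF H) + Defs.conv haar (kerF G) (kerF H).
Proof.
rewrite ker_of_lin !(conv_ker_of hB hnu hh mn) ker_of_lin.
apply: (eq_ker_of nu_r mn) => p q w _ _; rewrite /cmul mulr_sumr -big_split /=.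
by apply: eq_bigr => z _; rewrite mulrDl mulrA.
Qed.

Lemma conv_ker_of_linr (c : C) F G H :
  Defs.conv haar (kerF H) (c *: kerF F + kerF G) =
  c *: Defs.conv haar (kerF H) (kerF F) + Defs.conv haar (kerF H) (kerF G).
Proof.
rewrite ker_of_lin !(conv_ker_of hB hnu hh mn) ker_of_lin.
apply: (eq_ker_of nu_r mn) => p q w _ _; rewrite /cmul mulr_sumr -big_split /=.
by apply: eq_bigr => z _; rewrite mulrDr mulrCA.
Qed.

Lemma kstar_ker_of_lin (c : C) F G :
  kstar (c *: kerF F + kerF G) = conjc c *: kstar (kerF F) + kstar (kerF G).
Proof.
rewrite ker_of_lin !kstar_ker_of ker_of_lin; apply: (eq_ker_of nu_r mn) => p q w _ _.
by rewrite -conjCM; exact: (rmorphD (@conjc _)).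
Qed.

Lemma kstar_conv_ker_of F G :
  kstar (Defs.conv haar (kerF F) (kerF G)) =
  Defs.conv haar (kstar (kerF G)) (kstar (kerF F)).
Proof.
rewrite !kstar_ker_of !(conv_ker_of hB hnu hh mn) kstar_ker_of.
apply: (eq_ker_of nu_r mn) => p q w [/= _ _ pq] _.
rewrite /cmul conjC_sum -pq; apply: eq_bigr => z _.
by rewrite conjCM mulrC.
Qed.

(* Faithful representation of A by kernels with bounded coefficients; ke_closed
   makes the image complete, as the reduced norm is equivalent to the supremum
   of the coefficients. *)
Record kernel_embedding (A : staralg R) (j : A -> Defs.kernel B R) : Prop := {
  ke_zero : sa_set (0 : A) ;
  ke_add : forall x y : A, sa_set x -> sa_set y -> sa_set (x + y) ;
  ke_scale : forall (c : C) (x : A), sa_set x -> sa_set (c *: x) ;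
  ke_mul : forall x y : A, sa_set x -> sa_set y -> sa_set (sa_mul x y) ;
  ke_star : forall x : A, sa_set x -> sa_set (sa_star x) ;
  ke_ker : forall x : A, sa_set x -> exists2 F, bounded_coeffs m n F & j x = kerF F ;
  ke_lin : forall (c : C) (x y : A), sa_set x -> sa_set y ->
    j (c *: x + y) = c *: j x + j y ;
  ke_jmul : forall x y : A, sa_set x -> sa_set y ->
    j (sa_mul x y) = Defs.conv haar (j x) (j y) ;
  ke_jstar : forall x : A, sa_set x -> j (sa_star x) = kstar (j x) ;
  ke_inj : forall x : A, sa_set x -> j x = 0 -> x = 0 ;
  ke_closed : forall (u : nat -> A) (Fs : nat -> coeffs) F,
    (forall k, sa_set (u k)) -> (forall k, j (u k) = kerF (Fs k)) ->
    bounded_coeffs m n F ->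
    (forall e : R, 0 < e -> exists k0 : nat, forall k, (k0 <= k)%N ->
      entries_le m n (fun p q w => Fs k p q w - F p q w) e) ->
    exists2 l, sa_set l & j l = kerF F
}.

(** Each law is pulled back along the injective [j] from the corresponding law for [ker_of]. *)
Lemma kernel_star_algebra (A : staralg R) (j : A -> Defs.kernel B R) :
  kernel_embedding j -> is_star_algebra A.
Proof.
move=> [A0 AD AZ AM AS jK jL jM jS j0 _].
have inj (x y : A) : sa_set x -> sa_set y -> j x = j y -> x = y.
  move=> hx hy xy; apply/eqP; rewrite -subr_eq0 -scaleN1r addrC; apply/eqP.
  apply: j0; first by apply: AD => //; exact: AZ.
  by rewrite jL// xy scaleN1r addNr.
have Alin (c : C) (x y : A) : sa_set x -> sa_set y -> sa_set (c *: x + y).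
  by move=> hx hy; apply: AD => //; exact: AZ.
split => //.
- move=> x y z hx hy hz.
  have hyz := AM y z hy hz; have hxy := AM x y hx hy.
  apply: inj; [exact: AM|exact: AM|].
  rewrite jM// jM// [RHS]jM// jM//.
  have [F _ ->] := jK x hx; have [G _ ->] := jK y hy; have [H _ ->] := jK z hz.
  exact: conv_ker_of_assoc.
- move=> c x y z hx hy hz.
  have hxz := AM x z hx hz; have hyz := AM y z hy hz; have hc := Alin c x y hx hy.
  apply: inj; [exact: AM|exact: Alin|].
  rewrite jM// jL// [RHS]jL// !jM//.
  have [F _ ->] := jK x hx; have [G _ ->] := jK y hy; have [H _ ->] := jK z hz.
  exact: conv_ker_of_linl.
- move=> c x y z hx hy hz.
  have hzx := AM z x hz hx; have hzy := AM z y hz hy; have hc := Alin c x y hx hy.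
  apply: inj; [exact: AM|exact: Alin|].
  rewrite jM// jL// [RHS]jL// !jM//.
  have [F _ ->] := jK x hx; have [G _ ->] := jK y hy; have [H _ ->] := jK z hz.
  exact: conv_ker_of_linr.
- move=> c x y hx hy.
  have hc := Alin c x y hx hy; have hsx := AS x hx; have hsy := AS y hy.
  apply: inj; [exact: AS|exact: Alin|].
  rewrite jS// jL// [RHS]jL// !jS//.
  have [F _ ->] := jK x hx; have [G _ ->] := jK y hy.
  exact: kstar_ker_of_lin.
- move=> x y hx hy.
  have hsx := AS x hx; have hsy := AS y hy; have hxy := AM x y hx hy.
  apply: inj; [exact: AS|exact: AM|].
  rewrite jS// jM// [RHS]jM// !jS//.
  have [F _ ->] := jK x hx; have [G _ ->] := jK y hy.
  exact: kstar_conv_ker_of.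
- move=> x hx; have hs := AS x hx; apply: inj => //; first exact: AS.
  rewrite jS// jS//; apply/funext => a; apply/funext => b.
  exact: conjcK.
Qed.

Lemma kernel_cstar_algebra (A : staralg R) (j : A -> Defs.kernel B R) :
  kernel_embedding j ->
  is_star_algebra A /\ is_cstar_norm (fun x : A => reduced_norm haar (j x)).
Proof.
move=> h; have hA := kernel_star_algebra h; split => //.
case: h => _ _ _ _ _ jK jL jM jS j0 jcl.
exact: (kernel_cstar_norm hB hnu hh mn hA jK jL jM jS j0 jcl).
Qed.

End StarAlgebras.

(** * Boundary conditions at the two ends of the interval *)

Section Boundary.
Variables (R : realType) (B : bratteli).
Local Notation V := (vertex B).
Local Notation E := (edge B).
Local Notation C := R[i].
Variables (nu_r nu_s : V -> R).
Hypotheses (hB : standing_assumptions B) (hnu : is_state nu_r nu_s).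
Variable mu : V -> {measure set (ray_mspace B) -> \bar R}.
Hypothesis hmu : is_ray_measure nu_s mu.
Variables (m n : int).
Hypothesis mn : m < n.
Local Notation coeffs := (coeffs R B).
Local Notation phi := (phi_s mu).
Local Notation fmul := (cmul m n).
Local Notation smax p := (ray_smax (prng p)).
Local Notation smin p := (ray_smin (prng p)).
Implicit Types (F G : coeffs).

Lemma big_support (T : eqType) (J L : seq T) (f : T -> C) : uniq J -> uniq L ->
  {subset L <= J} -> (forall z, z \in J -> z \notin L -> f z = 0) ->
  \sum_(z <- J) f z = \sum_(z <- L) f z.
Proof.
move=> uJ uL LJ f0; rewrite (bigID (fun z => z \in L)) /= [X in _ + X]big_seq_cond.
rewrite [X in _ + X]big1 ?addr0; last by move=> z /andP[zJ zL]; exact: f0.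
rewrite -big_filter; apply: perm_big; apply: uniq_perm => //; first exact: filter_uniq.
by move=> z; rewrite mem_filter; apply: andb_idr; exact: LJ.
Qed.

Lemma Es_finite : finite_set (@Es B m n).
Proof.
apply: (@sub_finite_set _ _ (EY m n `*` EY m n)); first by move=> [p q] [].
by apply: finite_setX; exact: EY_finite.
Qed.

Definition G_class (P : ppair B) : seq (ppair B) :=
  [seq Z <- finmap.enum_fset (fset_set (@Es B m n)) | `[< G_ m n P Z >]].

Lemma mem_G_class P Z : (Z \in G_class P) = `[< G_ m n P Z >].
Proof.
rewrite mem_filter andb_idr// => /asboolP[_ hZ _].
by rewrite in_fset_set; [exact: mem_set|exact: Es_finite].
Qed.

Lemma G_class_uniq P : uniq (G_class P).
Proof. by rewrite filter_uniq// finmap.fset_uniq. Qed.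

(** The first components of the G-class of [P] are distinct by [Es_inj1] and are exactly the z with
    (P.1, z) in alpha_1(G). The hypothesis on [f] will come from (c) for the left factor of a
    product. *)
Lemma sum_G_class1 P (f : seq E -> C) : Es m n P ->
  (forall z, EY m n z -> prng z = prng P.1 -> ~ alpha1_G m n P.1 z -> f z = 0) ->
  \sum_(z <- EY_at m n (prng P.1)) f z = \sum_(Z <- G_class P) f Z.1.
Proof.
move=> hP f0; rewrite -(big_map fst xpredT f); apply: big_support.
- exact: EY_at_uniq.
- rewrite map_inj_in_uniq ?G_class_uniq// => Z Z'; rewrite !mem_G_class.
  by move=> /asboolP[_ hZ _] /asboolP[_ hZ' _]; exact: (Es_inj1 mn hZ hZ').
- move=> z /mapP[Z]; rewrite mem_G_class => /asboolP[_ [hZ _ _] [e _]] ->.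
  by apply/EY_atP.
move=> z /EY_atP[hz ez] nz; apply: f0 => // -[P' [Z [h e1 e2]]].
case/negP: nz; apply/mapP; exists Z => //; rewrite mem_G_class; apply/asboolP.
by have [hP' _ _] := h; rewrite (Es_inj1 mn hP hP').
Qed.

Lemma sum_G_class2 P (f : seq E -> C) : Es m n P ->
  (forall z, EY m n z -> prng z = prng P.2 -> ~ alpha2_G m n P.2 z -> f z = 0) ->
  \sum_(z <- EY_at m n (prng P.2)) f z = \sum_(Z <- G_class P) f Z.2.
Proof.
move=> hP f0; rewrite -(big_map snd xpredT f); apply: big_support.
- exact: EY_at_uniq.
- rewrite map_inj_in_uniq ?G_class_uniq// => Z Z'; rewrite !mem_G_class.
  by move=> /asboolP[_ hZ _] /asboolP[_ hZ' _]; exact: (Es_inj2 mn hZ hZ').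
- move=> z /mapP[Z]; rewrite mem_G_class => /asboolP[_ [_ hZ _] [_ e]] ->.
  by apply/EY_atP.
move=> z /EY_atP[hz ez] nz; apply: f0 => // -[P' [Z [h e1 e2]]].
case/negP: nz; apply/mapP; exists Z => //; rewrite mem_G_class; apply/asboolP.
by have [hP' _ _] := h; rewrite (Es_inj2 mn hP hP').
Qed.

(** The two lifts of [z] to [Es] coincide by [Es_inj1], so transitivity of G applies. *)
Lemma alpha1_trans (p z q : seq E) : alpha1_G m n p z -> alpha1_G m n z q ->
  alpha1_G m n p q.
Proof.
move=> [P [Z [h e1 e2]]] [Z' [Q [h' e1' e2']]]; exists P, Q; split => //.
have [_ hZ _] := h; have [hZ' _ _] := h'.
have ZZ : Z = Z' by apply: (Es_inj1 mn) => //; rewrite e2.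
by apply: G_trans h _; rewrite ZZ.
Qed.

Lemma alpha2_trans (p z q : seq E) : alpha2_G m n p z -> alpha2_G m n z q ->
  alpha2_G m n p q.
Proof.
move=> [P [Z [h e1 e2]]] [Z' [Q [h' e1' e2']]]; exists P, Q; split => //.
have [_ hZ _] := h; have [hZ' _ _] := h'.
have ZZ : Z = Z' by apply: (Es_inj2 mn) => //; rewrite e2.
by apply: G_trans h _; rewrite ZZ.
Qed.

Lemma alpha1_sym (p q : seq E) : alpha1_G m n p q -> alpha1_G m n q p.
Proof. by move=> [P [Q [/G_sym h <- <-]]]; exists Q, P. Qed.

Lemma alpha2_sym (p q : seq E) : alpha2_G m n p q -> alpha2_G m n q p.
Proof. by move=> [P [Q [/G_sym h <- <-]]]; exists Q, P. Qed.

Lemma G_pairs1 (P Q : ppair B) : G_ m n P Q -> pairsY m n (P.1, Q.1).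
Proof. by move=> [[? _ _] [? _ _] [? _]]. Qed.

Lemma G_pairs2 (P Q : ppair B) : G_ m n P Q -> pairsY m n (P.2, Q.2).
Proof. by move=> [[_ ? _] [_ ? _] [_ ?]]. Qed.

Record boundary_coeffs F : Prop := {
  bc_factor : forall p q, pairsY m n (p, q) -> exists2 g : R -> C,
    icont (nu_s (prng p)) g &
    forall w, Xplus (prng p) w -> F p q w = g (phi (prng p) w) ;
  bc_glue : forall P Q, G_ m n P Q -> F P.1 Q.1 (smax P.1) = F P.2 Q.2 (smin P.2) ;
  bc_max : forall p q, pairsY m n (p, q) -> ~ alpha1_G m n p q -> F p q (smax p) = 0 ;
  bc_min : forall p q, pairsY m n (p, q) -> ~ alpha2_G m n p q -> F p q (smin p) = 0
}.

Lemma phi_in v w : 0 <= phi v w <= nu_s v.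
Proof. by rewrite (phi_ge0 hnu hmu) (phi_le hnu hmu). Qed.

(** Continuity on rays comes from the factorisation through phi: rays agreeing to depth k have
    phi-values differing by at most the mass of a cylinder of that depth. *)
Lemma B_coefficientsP F : B_coefficients nu_s mu m n F <-> boundary_coeffs F.
Proof.
split=> [[_ ff fg fM fm]|[ff fg fM fm]]; split => //.
- by move=> p q /ff[g cg hg]; exists g => //; exact/within_icont.
- move=> p q pq; have [g cg hg] := ff p q pq.
  apply: within_ray_continuous => w Xw e e0.
  have [d d0 hd] := cg _ (phi_in (prng p) w) e e0.
  have [k hk] := nu_s_small hB hnu hmu (prng p) d0.
  exists k => w' Xw' h; rewrite !hg//; apply: hd; first exact: phi_in.
  rewrite distrC; apply: le_lt_trans (hk w Xw); exact: (phi_dist_cyl hnu hmu).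
- by move=> p q /ff[g cg hg]; exists g => //; exact/within_icont.
Qed.

Lemma boundary_bounded F : boundary_coeffs F -> bounded_coeffs m n F.
Proof.
move=> [ff _ _ _].
have hb (pq : ppair B) : exists M : R, 0 <= M /\ (pairsY m n pq ->
    forall w, Xplus (prng pq.1) w -> Normc.normc (F pq.1 pq.2 w) <= M).
  have [h|h] := pselect (pairsY m n pq); last by exists 0; split.
  have h' : pairsY m n (pq.1, pq.2) by case: pq h.
  have [g cg hg] := ff _ _ h'.
  have [M M0 hM] := icont_bounded (state_s_ge0 hnu _) cg.
  by exists M; split => // _ w Xw; rewrite hg//; apply: hM; exact: phi_in.
have [b hM] : {b : ppair B -> R & forall pq, 0 <= b pq /\ (pairsY m n pq ->
    forall w, Xplus (prng pq.1) w -> Normc.normc (F pq.1 pq.2 w) <= b pq)}.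
  exact: (@choice _ _ (fun pq M => 0 <= M /\ (pairsY m n pq ->
    forall w, Xplus (prng pq.1) w -> Normc.normc (F pq.1 pq.2 w) <= M))).
exists (\sum_(pq \in @pairsY B m n) b pq).
  by apply: fsumr_ge0 => pq _; case: (hM pq).
move=> p q w pq Xw; apply: le_trans ((hM (p, q)).2 pq w Xw) _.
apply: (@ler_fsum_single _ _ _ b (p, q)) => //; first exact: pairsY_finite.
by move=> pq'; case: (hM pq').
Qed.

Lemma boundary0 : boundary_coeffs (fun _ _ _ => 0).
Proof. by split => // p q _; exists (fun=> 0) => //; exact: icont_cst. Qed.

Lemma boundary_lin (c : C) F G : boundary_coeffs F -> boundary_coeffs G ->
  boundary_coeffs (fun p q w => c * F p q w + G p q w).
Proof.
move=> [ff fg fM fm] [gf gg gM gm]; split.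
- move=> p q pq; have [g cg hg] := ff p q pq; have [h ch hh] := gf p q pq.
  exists (fun t => c * g t + h t).
    by apply: icontD => //; apply: icontM => //; exact: icont_cst.
  by move=> w Xw; rewrite hg// hh.
- by move=> P Q h; rewrite fg// gg.
- by move=> p q pq na; rewrite fM// gM// mulr0 addr0.
- by move=> p q pq na; rewrite fm// gm// mulr0 addr0.
Qed.

(** At either end the product sum runs over a G-class only, the same class for both ends, which
    gives the gluing. If (p, q) is not in alpha_i(G), then by transitivity (p, z) or (z, q) is not
    either, so every term vanishes. *)
Lemma boundary_cmul F G : boundary_coeffs F -> boundary_coeffs G ->
  boundary_coeffs (fmul F G).
Proof.
move=> [ff fg fM fm] [gf gg gM gm]; split.
- move=> p q [/= pp qq pq].
  have hz z : exists g : R -> C, icont (nu_s (prng p)) g /\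
      (z \in EY_at m n (prng p) -> forall w, Xplus (prng p) w ->
       F p z w * G z q w = g (phi (prng p) w)).
    have [/EY_atP[hz ez]|_] := boolP (z \in EY_at m n (prng p)); last first.
      by exists (fun=> 0); split => //; exact: icont_cst.
    have [g cg hg] := ff p z (And3 pp hz (esym ez)).
    have [h ch hh] := gf z q (And3 hz qq (etrans ez pq)).
    exists (fun t => g t * h t); split; first by apply: icontM => //; rewrite -ez.
    by move=> _ w Xw; rewrite hg// hh ez.
  have [g hg] : {g : seq E -> R -> C & forall z, icont (nu_s (prng p)) (g z) /\
      (z \in EY_at m n (prng p) -> forall w, Xplus (prng p) w ->
       F p z w * G z q w = g z (phi (prng p) w))}.
    exact: (@choice _ _ (fun z g => icont (nu_s (prng p)) g /\
      (z \in EY_at m n (prng p) -> forall w, Xplus (prng p) w ->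
       F p z w * G z q w = g (phi (prng p) w)))).
  exists (fun t => \sum_(z <- EY_at m n (prng p)) g z t).
    by apply: icont_sum => z; case: (hg z).
  by move=> w Xw; apply: eq_big_seq => z zp; case: (hg z) => _ ->.
- move=> P Q h; have [hP hQ _] := h; rewrite /cmul.
  have [[P1 P2 _] [Q1 Q2 _] [e1 e2]] := h.
  rewrite sum_G_class1//; last first.
    by move=> z hz ez na; rewrite fM ?mul0r//; split => //=.
  rewrite sum_G_class2//; last first.
    by move=> z hz ez na; rewrite fm ?mul0r//; split => //=.
  apply: eq_big_seq => Z; rewrite mem_G_class => /asboolP hPZ.
  have hZQ : G_ m n Z Q by apply: G_trans (G_sym hPZ) h.
  have := gg _ _ hZQ; have [_ _ [f1 f2]] := hPZ; rewrite -f1 -f2 => ->.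
  by rewrite fg.
- move=> p q [/= pp qq pq] na; rewrite /cmul big_seq big1// => z /EY_atP[hz ez].
  have [az|naz] := pselect (alpha1_G m n p z); last by rewrite fM ?mul0r//; split => //=.
  rewrite -ez gM ?mulr0//; first by split => //=; rewrite ez.
  by move=> bz; apply: na; exact: alpha1_trans bz.
- move=> p q [/= pp qq pq] na; rewrite /cmul big_seq big1// => z /EY_atP[hz ez].
  have [az|naz] := pselect (alpha2_G m n p z); last by rewrite fm ?mul0r//; split => //=.
  rewrite -ez gm ?mulr0//; first by split => //=; rewrite ez.
  by move=> bz; apply: na; exact: alpha2_trans bz.
Qed.

Lemma boundary_cstar F : boundary_coeffs F -> boundary_coeffs (cstar F).
Proof.
move=> [ff fg fM fm]; rewrite /cstar; split.
- move=> p q [/= pp qq pq]; have [g cg hg] := ff q p (And3 qq pp (esym pq)).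
  rewrite pq; exists (fun t => conjc (g t)); first exact: icont_conj.
  by move=> w Xw; rewrite hg.
- move=> P Q h; have [_ _ [e1 e2]] := h; rewrite e1 e2.
  by rewrite fg//; exact: G_sym.
- move=> p q [/= pp qq pq] na; rewrite pq fM ?conjc0//.
  by move=> /alpha1_sym.
- move=> p q [/= pp qq pq] na; rewrite pq fm ?conjc0//.
  by move=> /alpha2_sym.
Qed.

(** The coefficients converge uniformly on rays, which controls the functions g only at values of
    phi; density of these values extends the control to the whole interval. *)
Lemma boundary_closed (Fs : nat -> coeffs) F : (forall k, boundary_coeffs (Fs k)) ->
  (forall e : R, 0 < e -> exists k0 : nat, forall k, (k0 <= k)%N ->
      entries_le m n (fun p q w => Fs k p q w - F p q w) e) ->
  boundary_coeffs F.
Proof.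
move=> hF ucv.
have pcv p q w : pairsY m n (p, q) -> Xplus (prng p) w -> ccvg (fun k => Fs k p q w) (F p q w).
  by move=> pq Xw e /ucv[k0 hk]; exists k0 => k kk; exact: hk.
have Xmax (v : V) : Xplus v (ray_smax v) by case: (ray_smaxP v).
have Xmin (v : V) : Xplus v (ray_smin v) by case: (ray_sminP v).
split.
- move=> p q pq; set c := nu_s (prng p).
  have [g hg] : {g : nat -> R -> C & forall k, icont c (g k) /\
      forall w, Xplus (prng p) w -> Fs k p q w = g k (phi (prng p) w)}.
    apply: (@choice _ _ (fun k g => icont c g /\
      forall w, Xplus (prng p) w -> Fs k p q w = g (phi (prng p) w))) => k.
    by have [g cg hg] := bc_factor (hF k) pq; exists g.
  have ug (e : R) : 0 < e -> exists k0 : nat, forall a b, (k0 <= a)%N -> (k0 <= b)%N ->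
      forall t, 0 <= t <= c -> Normc.normc (g a t - g b t) < e.
    (* Four distances of at most e / 5 join [g a t] to [g b t]: two by continuity at t, two through
       the common limit F. *)
    move=> e0; have e50 : 0 < e / 5 by lra.
    have [k0 hk] := ucv _ e50; exists k0 => a b ka kb t tc.
    have [d1 d10 h1] := (hg a).1 t tc _ e50; have [d2 d20 h2] := (hg b).1 t tc _ e50.
    have [t0 t1] := andP tc.
    (* A single ray must serve the continuity moduli of both functions. *)
    have d0 : 0 < Num.min d1 d2 by rewrite lt_min d10.
    have [w Xw] := phi_dense hB hnu hmu t0 t1 d0.
    rewrite distrC lt_min => /andP[w1 w2].
    have ha := h1 _ (phi_in _ w) w1; have hb := h2 _ (phi_in _ w) w2.
    have fa := hk a ka p q w pq Xw; have fb := hk b kb p q w pq Xw.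
    rewrite -(hg a).2// in ha; rewrite -(hg b).2// in hb.
    rewrite normcB in hb; rewrite normcB in fb.
    have n1 := normc_dist (g a t) (Fs a p q w) (g b t).
    have n2 := normc_dist (Fs a p q w) (F p q w) (g b t).
    have n3 := normc_dist (F p q w) (Fs b p q w) (g b t).
    lra.
  pose gl t : C := xget 0 [set l | ccvg (fun k => g k t) l].
  have glP t : 0 <= t <= c -> ccvg (fun k => g k t) (gl t).
    move=> tc; have [l hl] : exists l, ccvg (fun k => g k t) l.
      by apply: ccauchy => e /ug[k0 hk]; exists k0 => a b ka kb; exact: hk.
    exact: (xgetI 0 hl).
  exists gl; last first.
    move=> w Xw; apply: ccvg_unique (pcv p q w pq Xw) _.
    rewrite (_ : (fun k => _) = fun k => g k (phi (prng p) w)).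
      by apply: glP; exact: phi_in.
    by apply/funext => k; rewrite (hg k).2.
  (* Replacing [gl] by [g k0] costs 2 e / 5 at each of the two points, and continuity of [g k0]
     strictly less than the remaining e / 5. *)
  move=> t tc e e0; have e50 : 0 < e / 5 by lra.
  have [k0 hk] := ug _ e50.
  have near u : 0 <= u <= c -> Normc.normc (g k0 u - gl u) <= e / 5 + e / 5.
    move=> uc; have [k1 h1] := glP u uc _ e50.
    apply: le_trans (normc_dist _ (g (maxn k0 k1) u) _) _; apply: lerD.
      by apply/ltW/hk => //; exact: leq_maxl.
    by apply: h1; exact: leq_maxr.
  have [d d0 hd] := (hg k0).1 t tc _ e50; exists d => // u uc tu.
  have h1 := near t tc; have h2 := near u uc; have h3 := hd u uc tu.
  rewrite normcB in h1.
  have n1 := normc_dist (gl t) (g k0 t) (gl u).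
  have n2 := normc_dist (g k0 t) (g k0 u) (gl u).
  lra.
- move=> P Q h; have h1 := pcv _ _ _ (G_pairs1 h) (Xmax _).
  apply: ccvg_unique h1 _; rewrite (_ : (fun k => _) = fun k => Fs k P.2 Q.2 (smin P.2)).
    exact: pcv (G_pairs2 h) (Xmin _).
  by apply/funext => k; rewrite (bc_glue (hF k) h).
- move=> p q pq na; apply: ccvg_eq0 (pcv p q _ pq (Xmax _)) => k.
  exact: (bc_max (hF k)).
- move=> p q pq na; apply: ccvg_eq0 (pcv p q _ pq (Xmin _)) => k.
  exact: (bc_min (hF k)).
Qed.

End Boundary.

(** * The exact sequence *)

Section Spans.
Variables (R : realType) (L : lmodType R[i]).
Implicit Types (S W : set L).

Lemma lin_span_sub S W : W 0 -> (forall c x y, W x -> W y -> W (c *: x + y)) ->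
  S `<=` W -> lin_span S `<=` W.
Proof.
move=> W0 WL SW x [k [c [u [hu ->]]]]; apply: (big_ind W) => //.
  by move=> y z Wy Wz; rewrite -[y]scale1r; exact: WL.
by move=> i _; rewrite -[_ *: _]addr0; apply: WL => //; exact: SW.
Qed.

Lemma lin_span_sum S (I : eqType) (J : seq I) (f : I -> L) :
  (forall i, i \in J -> S (f i)) -> lin_span S (\sum_(i <- J) f i).
Proof.
move=> hf; rewrite big_tnth.
exists (size J), (fun=> 1), (fun i => f (tnth (in_tuple J) i)); split.
  by move=> i; apply: hf; exact: mem_tnth.
by apply: eq_bigr => i _; rewrite scale1r.
Qed.

Lemma lin_span_gen S x : S x -> lin_span S x.
Proof.
move=> Sx; exists 1%N, (fun=> 1), (fun=> x); split => //.
by rewrite big_ord1 scale1r.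
Qed.

End Spans.

Section C0Functions.
Variables (R : realType) (c : R).
Hypothesis c0 : 0 <= c.
Local Notation C := R[i].

Lemma C0_of_icont (g : R -> C) : icont c g ->
  (forall t, ~ (0 < t /\ t < c) -> g t = 0) -> C0_itv c g.
Proof.
move=> cg g0; rewrite (_ : g = cut c g).
  by apply: C0_cut => //; apply: g0; rewrite ltxx; case.
apply/funext => t; rewrite /cut; case: ifPn => // nt; apply: g0.
by move=> /andP; exact/negP.
Qed.

Lemma C0M (g h : R -> C) : C0_itv c g -> C0_itv c h -> C0_itv c (fun t => g t * h t).
Proof.
move=> Cg Ch; apply: C0_of_icont; first by apply: icontM; exact: C0_icont.
by move=> t nt; rewrite Cg.2// mul0r.
Qed.

Lemma C0_sum (I : eqType) (J : seq I) (g : I -> R -> C) :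
  (forall i, i \in J -> C0_itv c (g i)) -> C0_itv c (fun t => \sum_(i <- J) g i t).
Proof.
elim: J => [_|i J IH h].
  rewrite (_ : (fun t => _) = fun=> 0); first exact: C0_0.
  by apply/funext => t; rewrite big_nil.
rewrite (_ : (fun t => _) = fun t => 1 * g i t + \sum_(i <- J) g i t).
  apply: C0_lin => //; first by apply: h; rewrite inE eqxx.
  by apply: IH => k kJ; apply: h; rewrite inE kJ orbT.
by apply/funext => t; rewrite big_cons mul1r.
Qed.

Lemma C0_conj (g : R -> C) : C0_itv c g -> C0_itv c (fun t => conjc (g t)).
Proof.
move=> Cg; apply: C0_of_icont; first by apply: icont_conj; exact: C0_icont.
by move=> t nt; rewrite Cg.2// conjc0.
Qed.

Lemma icont_scalar (a : R) : icont c (fun t => (a * t)%:C).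
Proof.
move=> t _ e e0; have a1 : 0 < `|a| + 1 by rewrite ltr_wpDl.
exists (e / (`|a| + 1)); first by rewrite divr_gt0.
move=> u _; rewrite ltr_pdivlMr// => h.
rewrite -rmorphB normcE_sqrt sqn_real sqrtr_sqr -mulrBr normrM.
by apply: le_lt_trans h; rewrite mulrC ler_wpM2l// lerDl.
Qed.

End C0Functions.

Section Extension.
Variables (R : realType) (B : bratteli).
Local Notation V := (vertex B).
Local Notation E := (edge B).
Local Notation C := R[i].
Variables (nu_r nu_s : V -> R).
Hypotheses (hB : standing_assumptions B) (hnu : is_state nu_r nu_s).
Variable haar : bipath B -> {measure set (bipath_mspace B) -> \bar R}.
Hypothesis hh : is_haar_system nu_r haar.
Variable mu : V -> {measure set (ray_mspace B) -> \bar R}.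
Hypothesis hmu : is_ray_measure nu_s mu.
Variables (m n : int).
Hypothesis mn : m < n.
Local Notation coeffs := (coeffs R B).
Local Notation kerF := (ker_of nu_r m n).
Local Notation phi := (phi_s mu).
Local Notation fmul := (cmul m n).
Local Notation smax p := (ray_smax (prng p)).
Local Notation smin p := (ray_smin (prng p)).
Local Notation SA := (sum_AY_C0 nu_r nu_s haar m n).
Local Notation BM := (B_mn nu_r nu_s haar mu m n).
Local Notation CG := (CstarG B R m n).
Local Notation boundary := (boundary_coeffs nu_s mu m n).
Implicit Types (F G : coeffs).

Let Xmax (v : V) : Xplus v (ray_smax v).
Proof. by case: (ray_smaxP v). Qed.

Let Xmin (v : V) : Xplus v (ray_smin v).
Proof. by case: (ray_sminP v). Qed.

Lemma boundary_ext F G :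
  (forall p q w, pairsY m n (p, q) -> Xplus (prng p) w -> F p q w = G p q w) ->
  boundary F -> boundary G.
Proof.
move=> FG [ff fg fM fm]; split.
- by move=> p q pq; have [g cg hg] := ff p q pq; exists g => // w Xw; rewrite -FG// hg.
- by move=> P Q h; rewrite -!FG ?fg//; [exact: G_pairs2|exact: G_pairs1].
- by move=> p q pq na; rewrite -FG// fM.
- by move=> p q pq na; rewrite -FG// fm.
Qed.

Lemma B_setP (a : BM) : sa_set a <-> exists2 F, boundary F & (a : Defs.kernel B R) = kerF F.
Proof.
split=> [[F /(B_coefficientsP hB hnu hmu) bF ->]|[F bF ->]].
  by exists F => //; rewrite sum_a_tensor.
exists F; first exact/(B_coefficientsP hB hnu hmu).
by rewrite sum_a_tensor.
Qed.

Lemma B_set_ker F : boundary F -> sa_set (kerF F : BM).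
Proof. by move=> bF; apply/B_setP; exists F. Qed.

Lemma ker_of0 : kerF (fun _ _ _ => 0) = 0.
Proof.
apply/funext => x; apply/funext => y; rewrite /ker_of mulr0.
by case: ifP.
Qed.

Lemma B_embedding : @kernel_embedding R B nu_r haar m n BM (fun a => a).
Proof.
split=> //.
- by apply/B_setP; exists (fun _ _ _ => 0); [exact: boundary0|rewrite ker_of0].
- move=> x y /B_setP[F bF ->] /B_setP[G bG ->].
  rewrite -[kerF F]scale1r ker_of_lin; apply: B_set_ker; exact: boundary_lin.
- move=> c x /B_setP[F bF ->]; rewrite -[_ *: _]addr0 -ker_of0 ker_of_lin.
  by apply: B_set_ker; apply: boundary_lin => //; exact: boundary0.
- move=> x y /B_setP[F bF ->] /B_setP[G bG ->].
  rewrite /= (conv_ker_of hB hnu hh mn); apply: B_set_ker; exact: boundary_cmul.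
- move=> x /B_setP[F bF ->]; rewrite /= kstar_ker_of; apply: B_set_ker.
  exact: boundary_cstar.
- by move=> x /B_setP[F bF ->]; exists F => //; exact: (boundary_bounded hnu hmu).
- move=> u Fs F hu uF bF ucv; exists (kerF F) => //; apply: B_set_ker.
  apply: (boundary_closed hB hnu hmu _ ucv) => k.
  (* The given [Fs k] merely has the same kernel as some family with boundary conditions;
     [ker_of_inj] identifies the two where it matters. *)
  have /B_setP[F' bF' e] := hu k; apply: boundary_ext bF' => p q w pq Xw.
  apply: (ker_of_inj hB hnu mn _ pq Xw); by rewrite -e uF.
Qed.

(** * C*(G) as an algebra of kernels *)

Definition first_lift (p : seq E) : ppair B := xget ([::], [::]) [set P | Es m n P /\ P.1 = p].
Definition second_lift (p : seq E) : ppair B := xget ([::], [::]) [set P | Es m n P /\ P.2 = p].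

Lemma first_liftK P : Es m n P -> first_lift P.1 = P.
Proof.
move=> hP; have [h e] := xgetPex ([::], [::]) (ex_intro [set Q | Es m n Q /\ Q.1 = P.1] P (conj hP erefl)).
exact: Es_inj1 mn h hP e.
Qed.

Lemma second_liftK P : Es m n P -> second_lift P.2 = P.
Proof.
move=> hP; have [h e] := xgetPex ([::], [::]) (ex_intro [set Q | Es m n Q /\ Q.2 = P.2] P (conj hP erefl)).
exact: Es_inj2 mn h hP e.
Qed.

(** The value to prescribe at the s-maximal end for an element over [z]: the transport of [z] along
    alpha_1, extended by 0 as (c) demands. *)
Definition max_value (z : CG) (p q : seq E) : C :=
  if `[< alpha1_G m n p q >] then z (first_lift p) (first_lift q) else 0.
Definition min_value (z : CG) (p q : seq E) : C :=
  if `[< alpha2_G m n p q >] then z (second_lift p) (second_lift q) else 0.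

Lemma max_valueE (z : CG) P Q : G_ m n P Q -> max_value z P.1 Q.1 = z P Q.
Proof.
move=> h; have [hP hQ _] := h; rewrite /max_value asboolT; last by exists P, Q.
by rewrite !first_liftK.
Qed.

Lemma min_valueE (z : CG) P Q : G_ m n P Q -> min_value z P.2 Q.2 = z P Q.
Proof.
move=> h; have [hP hQ _] := h; rewrite /min_value asboolT; last by exists P, Q.
by rewrite !second_liftK.
Qed.

(* Functions on G, carried over to pairs of paths by alpha_1 and extended to
   kernels whose coefficients do not depend on the tail. *)
Definition groupoid_ker (z : CG) : Defs.kernel B R := kerF (fun p q _ => max_value z p q).

Lemma CstarG_mulE (z z' : CG) P Q : G_ m n P Q ->
  sa_mul z z' P Q = \sum_(Z <- G_class m n P) z P Z * z' Z Q.
Proof.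
move=> h; rewrite /= [RHS]fsbig_seq ?G_class_uniq//.
rewrite (_ : [set Z | _] = [set` G_class m n P])//.
apply/seteqP; split=> Z /=; rewrite mem_G_class.
  by move=> [? _]; apply/asboolP.
by move=> /asboolP hZ; split => //; apply: G_trans (G_sym hZ) h.
Qed.

(** Injectivity of alpha_1 lifts a chain p, z, q of alpha_1-related paths to a chain in G, hence
    multiplicativity. Coefficients constant in the tail remain so in the limit, hence closedness. *)
Lemma CstarG_embedding : @kernel_embedding R B nu_r haar m n CG groupoid_ker.
Proof.
have mz (z : CG) p q : ~ alpha1_G m n p q -> max_value z p q = 0.
  by move=> na; rewrite /max_value asboolF.
split.
- by [].
- move=> x y hx hy p q nG; transitivity (x p q + y p q); first by [].
  by rewrite hx// hy// addr0.
- move=> c x hx p q nG; transitivity (c * x p q); first by [].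
  by rewrite hx// mulr0.
- move=> x y hx hy p q nG /=; apply: fsbig1 => z [h1 h2].
  by case: nG; exact: G_trans h2.
- move=> x hx p q nG /=; rewrite hx ?conjc0//.
  by move=> /G_sym.
- move=> x hx; eexists; last by [].
  exists (\sum_(pq \in @pairsY B m n) Normc.normc (max_value x pq.1 pq.2)).
    by apply: fsumr_ge0 => pq _; exact: normc_ge0.
  move=> p q w pq Xw.
  apply: (@ler_fsum_single _ _ _ (fun pq => Normc.normc (max_value x pq.1 pq.2)) (p, q)) => //.
    exact: pairsY_finite.
  by move=> pq'; exact: normc_ge0.
- move=> c x y hx hy; rewrite /groupoid_ker ker_of_lin; apply: (eq_ker_of nu_r mn).
  move=> p q w _ _; rewrite /max_value; case: asboolP => // _.
  by rewrite mulr0 addr0.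
- move=> x y hx hy; rewrite /groupoid_ker (conv_ker_of hB hnu hh mn).
  apply: (eq_ker_of nu_r mn) => p q w _ _; rewrite /cmul.
  have [[P [Q [h e1 e2]]]|na] := pselect (alpha1_G m n p q).
    have [hP hQ _] := h; rewrite -e1 -e2 max_valueE// CstarG_mulE//.
    rewrite sum_G_class1//; last by move=> z _ _ na; rewrite mz// mul0r.
    apply: eq_big_seq => Z; rewrite mem_G_class => /asboolP hZ.
    by rewrite !max_valueE//; exact: G_trans (G_sym hZ) h.
  rewrite mz// big1// => z _.
  have [az|nz] := pselect (alpha1_G m n p z); last by rewrite mz// mul0r.
  rewrite (mz y) ?mulr0// => bz; apply: na; exact: alpha1_trans bz.
- move=> x hx; rewrite /groupoid_ker kstar_ker_of; apply: (eq_ker_of nu_r mn).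
  move=> p q w _ _; rewrite /max_value; case: asboolP => [a|na].
    by rewrite asboolT//; exact: alpha1_sym.
  by rewrite asboolF ?conjc0// => /alpha1_sym.
- move=> x hx x0; apply/funext => P; apply/funext => Q.
  have [h|nh] := pselect (G_ m n P Q); last exact: hx.
  rewrite -(max_valueE x h); rewrite /groupoid_ker -ker_of0 in x0.
  exact: (ker_of_inj hB hnu mn x0 (G_pairs1 h) (Xmax _)).
- move=> u Fs F hu uF bF ucv.
  have pcv p q w : pairsY m n (p, q) -> Xplus (prng p) w ->
      ccvg (fun k => max_value (u k) p q) (F p q w).
    move=> pq Xw e /ucv[k0 hk]; exists k0 => k kk.
    by rewrite (ker_of_inj hB hnu mn (uF k) pq Xw); exact: hk.
  (* The limit coefficients do not depend on the ray, so they are read at the s-maximal one. *)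
  pose z : CG := fun P Q => if `[< G_ m n P Q >] then F P.1 Q.1 (smax P.1) else 0.
  exists z; first by move=> P Q nG; rewrite /z asboolF.
  apply: (eq_ker_of nu_r mn) => p q w pq Xw.
  have [[P [Q [h e1 e2]]]|na] := pselect (alpha1_G m n p q).
    rewrite -e1 -e2 in pq Xw *; rewrite max_valueE// /z asboolT//.
    exact: ccvg_unique (pcv _ _ _ pq (Xmax _)) (pcv _ _ _ pq Xw).
  rewrite mz//; apply/esym; apply: ccvg_eq0 (pcv _ _ _ pq Xw) => k; exact: mz.
Qed.

(** * The ideal as families of functions vanishing at both ends *)

Definition C0_family (g : seq E -> seq E -> R -> C) : Prop :=
  forall p q, pairsY m n (p, q) -> C0_itv (nu_s (prng p)) (g p q).

(** The element of A^Y_{m,n,v} at the parameter t, as a kernel with coefficients constant in the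
    ray: the variable t has yet to be replaced by phi. *)
Definition level_coeffs (g : seq E -> seq E -> R -> C) (v : V) (t : R) : coeffs :=
  fun p q _ => if prng p == v then g p q t else 0.

Definition sum_of (g : seq E -> seq E -> R -> C) : SA :=
  fun v t => kerF (level_coeffs g v t).

Lemma a_ker_of (p q : seq E) : EY m n p -> EY m n q ->
  a_ nu_r m n p q = kerF (fun p' q' _ => if (p' == p) && (q' == q) then 1 else 0).
Proof.
move=> hp hq; apply/funext => x; apply/funext => y; rewrite /a_ /ker_of.
case: asboolP => [[xy sx sy e]|nh].
  have [_ _ [Xx Xy _]] := xy.
  by rewrite asboolT ?sx ?sy ?eqxx ?mulr1//; split => //; rewrite ?sx ?sy.
case: asboolP => // c; have [Xx Xy px py e] := c.
case: ifP => [/andP[/eqP sx /eqP sy]|_]; last by rewrite mulr0.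
by case: nh; split => //; exact: (kcond_tail_equivY mn c).
Qed.

Lemma AY_ker_of v a : AY nu_r m n v a -> exists A : seq E -> seq E -> C,
  a = kerF (fun p q _ => if prng p == v then A p q else 0).
Proof.
apply: (@lin_span_sub R _ _ [set a | exists A : seq E -> seq E -> C,
  a = kerF (fun p q _ => if prng p == v then A p q else 0)]).
- exists (fun _ _ => 0); rewrite -ker_of0; apply: (eq_ker_of nu_r mn) => p q w _ _.
  by case: ifP.
- move=> c x y [A1 ->] [A2 ->]; exists (fun p q => c * A1 p q + A2 p q).
  rewrite ker_of_lin; apply: (eq_ker_of nu_r mn) => p q w _ _.
  by case: ifP => //; rewrite mulr0 addr0.
- move=> x [p [q [hp hq pv qv ->]]].
  exists (fun p' q' => if (p' == p) && (q' == q) then 1 else 0).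
  rewrite a_ker_of//; apply: (eq_ker_of nu_r mn) => p' q' w _ _.
  by case: eqP => [->|_] /=; rewrite ?pv ?eqxx// if_same.
Qed.

Lemma nu_s_ge0 v : 0 <= nu_s v.
Proof. exact: state_s_ge0 hnu v. Qed.

Lemma tensor_ker_of v h : tensor_C0 (AY nu_r m n v) (nu_s v) h ->
  exists2 g, C0_family g & h = sum_of g v.
Proof.
apply: (@lin_span_sub R _ _ [set h | exists2 g, C0_family g & h = sum_of g v]).
- exists (fun _ _ _ => 0); first by move=> p q _; exact: C0_0.
  apply/funext => t; rewrite /sum_of -[LHS]ker_of0; apply: (eq_ker_of nu_r mn) => p q w _ _.
  by rewrite /level_coeffs; case: ifP.
- move=> c x y [g1 h1 ->] [g2 h2 ->]; exists (fun p q t => c * g1 p q t + g2 p q t).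
    by move=> p q pq; apply: C0_lin; [exact: nu_s_ge0|exact: h1|exact: h2].
  apply/funext => t.
  transitivity (c *: kerF (level_coeffs g1 v t) + kerF (level_coeffs g2 v t)); first by [].
  rewrite ker_of_lin; apply: (eq_ker_of nu_r mn) => p q w _ _.
  by rewrite /level_coeffs; case: ifP => //; rewrite mulr0 addr0.
- move=> x [a /AY_ker_of[A ->] [g Cg ->]].
  exists (fun p q t => if prng p == v then A p q * g t else 0).
    move=> p q pq; case: eqP => [->|_]; last exact: C0_0.
    rewrite (_ : (fun t => _) = fun t => A p q * g t + 0).
      by apply: C0_lin => //; [exact: nu_s_ge0|exact: C0_0].
    by apply/funext => t; rewrite addr0.
  apply/funext => t; rewrite /elem_tensor kerFZ; apply: (eq_ker_of nu_r mn) => p q w _ _.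
  by rewrite /level_coeffs; case: ifP => _; rewrite ?mulr0// mulrC.
Qed.

Lemma level_coeffs_off g v t : ~ level_vertices n v -> kerF (level_coeffs g v t) = 0.
Proof.
move=> nv; rewrite -ker_of0; apply: (eq_ker_of nu_r mn) => p q w [/= pp _ _] _.
rewrite /level_coeffs; case: eqP => // pv; case: nv.
by have [_ <-] := paths_vlevel mn (EY_paths pp); rewrite pv.
Qed.

(** The component at v sees only pairs of paths ending at v, so a single family indexed by pairs
    encodes all components. *)
Lemma sum_setP (h : SA) : sa_set h <-> exists2 g, C0_family g & h = sum_of g.
Proof.
split=> [[hv h0]|[g Cg ->]].
  have [g hg] : {g : V -> seq E -> seq E -> R -> C &
      forall v, C0_family (g v) /\ h v = sum_of (g v) v}.
    apply: (@choice _ _ (fun v g => C0_family g /\ h v = sum_of g v)) => v.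
    have [lv|nv] := pselect (level_vertices n v).
      by have [g Cg e] := tensor_ker_of (hv v lv); exists g.
    exists (fun _ _ _ => 0); split; first by move=> p q _; exact: C0_0.
    by rewrite h0//; apply/funext => t; rewrite /sum_of level_coeffs_off.
  (* The families chosen for the separate vertices are assembled according to the end of p. *)
  exists (fun p => g (prng p) p).
    by move=> p q pq; have [h' _] := hg (prng p); exact: h'.
  apply/funext => v; have [_ ->] := hg v; apply/funext => t.
  apply: (eq_ker_of nu_r mn) => p q w _ _; rewrite /level_coeffs.
  by case: eqP => // ->.
split=> v lv; last first.
  by apply/funext => t; rewrite /sum_of level_coeffs_off.
pose PS := finmap.enum_fset (fset_set (@pairsY B m n)).
pose Lv := [seq pq <- PS | prng pq.1 == v].
have PSP pq : (pq \in PS) = (pq \in pairsY m n).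
  by rewrite in_fset_set//; exact: pairsY_finite.
rewrite (_ : sum_of g v =
    \sum_(pq <- Lv) elem_tensor (a_ nu_r m n pq.1 pq.2) (g pq.1 pq.2)).
  apply: lin_span_sum => -[p q]; rewrite mem_filter PSP => /andP[/= /eqP pv /set_mem pq].
  have [/= hp hq e] := pq.
  exists (a_ nu_r m n p q); last by exists (g p q) => //; rewrite -pv; exact: Cg.
  by apply: lin_span_gen; exists p, q; split => //; rewrite -e.
apply/funext => t.
have -> : (\sum_(pq <- Lv) elem_tensor (a_ nu_r m n pq.1 pq.2) (g pq.1 pq.2)) t =
    \sum_(pq <- Lv) g pq.1 pq.2 t *: a_ nu_r m n pq.1 pq.2.
  exact: (big_morph (fun h : R -> Defs.kernel B R => h t)).
rewrite /sum_of -(sum_a_tensor nu_r mn) fsbig_finite; last exact: pairsY_finite.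
rewrite -/PS /Lv big_filter [RHS]big_mkcond /=; apply: eq_bigr => -[p q] _ /=.
apply/funext => x; apply/funext => y; rewrite /a_tensor /level_coeffs.
by case: ifP => // _; rewrite mul0r.
Qed.

(** The identification of a (x) g with a (x) (g o phi): the component at r(x_n) is evaluated at phi
    of the tail. *)
Definition sum_embed (h : SA) : Defs.kernel B R :=
  fun x y => h (rng (x n)) (phi (rng (x n)) (tail n x)) x y.

Definition phi_coeffs (g : seq E -> seq E -> R -> C) : coeffs :=
  fun p q w => g p q (phi (prng p) w).

Lemma sum_embed_of g : sum_embed (sum_of g) = kerF (phi_coeffs g).
Proof.
apply/funext => x; apply/funext => y.
rewrite /sum_embed /sum_of /ker_of /level_coeffs /phi_coeffs.
by case: asboolP => // _; rewrite prng_segment// eqxx.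
Qed.

Lemma boundary_phi_coeffs g : C0_family g -> boundary (phi_coeffs g).
Proof.
move=> Cg.
have z0 p q : pairsY m n (p, q) -> phi_coeffs g p q (smin p) = 0.
  by move=> /Cg /C0_ends[h _]; rewrite /phi_coeffs (phi_smin hB hnu hmu).
have z1 p q : pairsY m n (p, q) -> phi_coeffs g p q (smax p) = 0.
  by move=> /Cg /C0_ends[_ h]; rewrite /phi_coeffs (phi_smax hnu hmu).
split.
- by move=> p q pq; exists (g p q) => //; apply: C0_icont; exact: Cg.
- by move=> P Q h; rewrite z1 ?z0//; [exact: G_pairs2|exact: G_pairs1].
- by move=> p q pq _; exact: z1.
- by move=> p q pq _; exact: z0.
Qed.

(** As phi is 0 and nu_s at the extremal rays, each g vanishes at both ends and extends by 0 to the
    line. This serves both exactness in the middle and closedness of the ideal. *)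
Lemma boundary_zero_ends F : boundary F ->
  (forall p q, pairsY m n (p, q) -> F p q (smax p) = 0 /\ F p q (smin p) = 0) ->
  exists2 h : SA, sa_set h & sum_embed h = kerF F.
Proof.
move=> [ff _ _ _] F0.
have [g hg] : {g : ppair B -> R -> C & forall pq, pairsY m n pq ->
    icont (nu_s (prng pq.1)) (g pq) /\
    forall w, Xplus (prng pq.1) w -> F pq.1 pq.2 w = g pq (phi (prng pq.1) w)}.
  apply: (@choice _ _ (fun pq g => pairsY m n pq -> icont (nu_s (prng pq.1)) g /\
    forall w, Xplus (prng pq.1) w -> F pq.1 pq.2 w = g (phi (prng pq.1) w))) => -[p q].
  have [pq|npq] := pselect (pairsY m n (p, q)); last by exists (fun=> 0) => /npq.
  by have [g cg h] := ff p q pq; exists g.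
have g0 p q : pairsY m n (p, q) -> g (p, q) 0 = 0 /\ g (p, q) (nu_s (prng p)) = 0.
  move=> pq; have [_ h] := hg _ pq; have [h1 h2] := F0 p q pq.
  have := h _ (Xmax _); have := h _ (Xmin _); rewrite /= h1 h2.
  by rewrite (phi_smin hB hnu hmu) (phi_smax hnu hmu).
exists (sum_of (fun p q => cut (nu_s (prng p)) (g (p, q)))).
  apply/sum_setP; eexists; last by [].
  move=> p q pq; have [h0 h1] := g0 p q pq; have [cg _] := hg _ pq.
  by apply: C0_cut => //; exact: nu_s_ge0.
rewrite sum_embed_of; apply: (eq_ker_of nu_r mn) => p q w pq Xw.
have [h0 h1] := g0 p q pq; have [_ h] := hg _ pq.
by rewrite /phi_coeffs cutE ?(phi_in hnu hmu)// -h.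
Qed.

(** Continuity of g and density of the values of phi. *)
Lemma C0_phi_inj c v (g : R -> C) : c = nu_s v -> C0_itv c g ->
  (forall w, Xplus v w -> g (phi v w) = 0) -> forall t, g t = 0.
Proof.
move=> -> Cg gw t.
have [/andP[t0 tv]|nt] := boolP (0 < t < nu_s v); last first.
  by rewrite Cg.2// => /andP; exact/negP.
apply: Normc.eq0_normc; apply/eqP; rewrite eq_le normc_ge0 andbT.
apply/ler_addgt0Pr => e e0; rewrite add0r.
have tc : 0 <= t <= nu_s v by rewrite !ltW.
have [d d0 hd] := C0_icont Cg tc e0.
have [w Xw] := phi_dense hB hnu hmu (ltW t0) (ltW tv) d0.
rewrite distrC => wt'; have := hd _ (phi_in hnu hmu v w) wt'.
by rewrite gw// subr0 => /ltW.
Qed.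

Definition mul_family (g g' : seq E -> seq E -> R -> C) p q t : C :=
  \sum_(z <- EY_at m n (prng p)) g p z t * g' z q t.

Lemma sum_of_mul g g' : sa_mul (sum_of g) (sum_of g') = sum_of (mul_family g g').
Proof.
apply/funext => v; apply/funext => t; rewrite /= /sum_of (conv_ker_of hB hnu hh mn).
apply: (eq_ker_of nu_r mn) => p q w _ _; rewrite /cmul /level_coeffs /mul_family.
case: eqP => [pv|_]; last by rewrite big1// => z _; rewrite mul0r.
by apply: eq_big_seq => z /EY_atP[_ ->]; rewrite pv eqxx.
Qed.

Lemma mul_family_C0 g g' : C0_family g -> C0_family g' -> C0_family (mul_family g g').
Proof.
move=> Cg Cg' p q [/= pp qq pq]; apply: C0_sum; first exact: nu_s_ge0.
move=> z /EY_atP[hz ez]; apply: C0M; first exact: nu_s_ge0.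
  by apply: Cg; split.
by rewrite -ez; apply: Cg'; split => //=; rewrite ez.
Qed.

Lemma sum_embedding : @kernel_embedding R B nu_r haar m n SA sum_embed.
Proof.
have Hlin c g1 g2 : c *: sum_of g1 + sum_of g2 = sum_of (fun p q t => c * g1 p q t + g2 p q t).
  apply/funext => v; apply/funext => t.
  transitivity (c *: kerF (level_coeffs g1 v t) + kerF (level_coeffs g2 v t)); first by [].
  rewrite ker_of_lin; apply: (eq_ker_of nu_r mn) => p q w _ _.
  by rewrite /level_coeffs; case: ifP => //; rewrite mulr0 addr0.
have Clin c g1 g2 : C0_family g1 -> C0_family g2 ->
    C0_family (fun p q t => c * g1 p q t + g2 p q t).
  by move=> h1 h2 p q pq; apply: C0_lin; [exact: nu_s_ge0|exact: h1|exact: h2].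
have H0 : sum_of (fun _ _ _ => 0) = 0.
  apply/funext => v; apply/funext => t; rewrite -[RHS]ker_of0.
  by apply: (eq_ker_of nu_r mn) => p q w _ _; rewrite /level_coeffs if_same.
have C00 : C0_family (fun _ _ _ => 0) by move=> p q _; exact: C0_0.
split.
- by apply/sum_setP; exists (fun _ _ _ => 0).
- move=> x y /sum_setP[g1 h1 ->] /sum_setP[g2 h2 ->]; apply/sum_setP.
  by rewrite -[sum_of g1]scale1r Hlin; exists (fun p q t => 1 * g1 p q t + g2 p q t); first exact: Clin.
- move=> c x /sum_setP[g1 h1 ->]; apply/sum_setP.
  by rewrite -[_ *: _]addr0 -H0 Hlin; exists (fun p q t => c * g1 p q t + 0); first exact: Clin.
- move=> x y /sum_setP[g1 h1 ->] /sum_setP[g2 h2 ->]; apply/sum_setP.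
  by rewrite sum_of_mul; exists (mul_family g1 g2); first exact: mul_family_C0.
- move=> x /sum_setP[g h ->]; apply/sum_setP.
  exists (fun p q t => conjc (g q p t)).
    move=> p q [/= pp qq pq]; rewrite pq; apply: C0_conj; first exact: nu_s_ge0.
    exact: h.
  apply/funext => v; apply/funext => t; rewrite /= /sum_of kstar_ker_of.
  apply: (eq_ker_of nu_r mn) => p q w [/= _ _ pq] _; rewrite /level_coeffs pq.
  by case: ifP; rewrite ?conjc0.
- move=> x /sum_setP[g h ->]; rewrite sum_embed_of; eexists; last by [].
  by apply: (boundary_bounded hnu hmu); exact: boundary_phi_coeffs.
- by [].
- move=> x y /sum_setP[g1 h1 ->] /sum_setP[g2 h2 ->].
  rewrite sum_of_mul !sum_embed_of (conv_ker_of hB hnu hh mn).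
  apply: (eq_ker_of nu_r mn) => p q w _ _; rewrite /phi_coeffs /mul_family /cmul.
  by apply: eq_big_seq => z /EY_atP[_ ->].
- move=> x /sum_setP[g h ->]; apply/funext => a; apply/funext => b.
  rewrite sum_embed_of kstar_ker_of /sum_embed /= /sum_of kstar_ker_of /ker_of.
  case: asboolP => // c; rewrite /level_coeffs /phi_coeffs -(kcond_prng mn c).
  by rewrite prng_segment// eqxx.
- move=> x /sum_setP[g h ->]; rewrite sum_embed_of -ker_of0 => e.
  rewrite -H0; apply/funext => v; apply/funext => t; apply: (eq_ker_of nu_r mn).
  move=> p q w pq Xw; rewrite /level_coeffs; case: ifP => // _.
  apply: (C0_phi_inj erefl (h p q pq)) => w' Xw'.
  exact: (ker_of_inj hB hnu mn e pq Xw').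
- move=> u Fs F hu uF bF ucv.
  (* Boundary conditions and vanishing at both ends survive uniform limits, so the limit comes back
     from a family by [boundary_zero_ends]. *)
  have hF k : boundary (Fs k) /\ forall p q, pairsY m n (p, q) ->
      Fs k p q (smax p) = 0 /\ Fs k p q (smin p) = 0.
    have /sum_setP[g h e] := hu k; have e' := uF k; rewrite e sum_embed_of in e'.
    split; first by apply: boundary_ext (boundary_phi_coeffs h) => p q w;
      exact: (ker_of_inj hB hnu mn e').
    move=> p q pq; have [g0 g1] := C0_ends (h p q pq).
    rewrite -!(ker_of_inj hB hnu mn e' pq)// /phi_coeffs.
    by rewrite (phi_smin hB hnu hmu) (phi_smax hnu hmu).
  apply: boundary_zero_ends.
    by apply: (boundary_closed hB hnu hmu _ ucv) => k; case: (hF k).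
  move=> p q pq.
  have pcv w : Xplus (prng p) w -> ccvg (fun k => Fs k p q w) (F p q w).
    by move=> Xw e /ucv[k0 hk]; exists k0 => k kk; exact: hk.
  split; [apply: ccvg_eq0 (pcv _ (Xmax _))|apply: ccvg_eq0 (pcv _ (Xmin _))] => k;
    by have [_ /(_ p q pq)[]] := hF k.
Qed.

(** * The quotient map and exactness *)

Definition end_values (a : BM) : CG := fun P Q =>
  if `[< G_ m n P Q >] then coef nu_r m n a P.1 Q.1 (smax P.1) else 0.

Lemma end_values_ker F P Q : G_ m n P Q ->
  end_values (kerF F) P Q = F P.1 Q.1 (smax P.1).
Proof.
move=> h; rewrite /end_values asboolT//.
exact: (coefK hB hnu mn _ (G_pairs1 h) (Xmax _)).
Qed.

Lemma end_values_off (a : BM) P Q : ~ G_ m n P Q -> end_values a P Q = 0.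
Proof. by move=> nh; rewrite /end_values asboolF. Qed.

Lemma end_values_hom : @star_hom R BM CG end_values.
Proof.
split.
- by move=> x _ P Q nh; exact: end_values_off.
- move=> c x y _ _; apply/funext => P; apply/funext => Q.
  transitivity (c * end_values x P Q + end_values y P Q); last by [].
  rewrite /end_values; case: asboolP => _; last by rewrite mulr0 addr0.
  by rewrite /coef mulrCA -mulrDr.
- move=> x y /B_setP[F bF ->] /B_setP[G bG ->].
  apply/funext => P; apply/funext => Q.
  have [h|nh] := pselect (G_ m n P Q); last first.
    rewrite end_values_off//; apply/esym; apply: fsbig1 => Z [h1 h2].
    by case: nh; exact: G_trans h2.
  rewrite CstarG_mulE// /sa_mul [X in end_values X](conv_ker_of hB hnu hh mn).
  rewrite end_values_ker// /cmul; have [hP hQ [e1 e2]] := h.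
  have [[P1 P2 _] [Q1 Q2 _] _] := h.
  rewrite sum_G_class1//; last first.
    by move=> z hz ez na; rewrite (bc_max bF) ?mul0r//; split => //=.
  apply: eq_big_seq => Z; rewrite mem_G_class => /asboolP hZ.
  have hZQ : G_ m n Z Q by apply: G_trans (G_sym hZ) h.
  by rewrite !end_values_ker//; case: hZ => _ _ [-> _].
- move=> x /B_setP[F bF ->]; apply/funext => P; apply/funext => Q.
  rewrite /sa_star [X in end_values X]kstar_ker_of /=.
  have [h|nh] := pselect (G_ m n P Q); last first.
    by rewrite !end_values_off ?conjc0// => /G_sym.
  rewrite end_values_ker// end_values_ker; last exact: G_sym.
  by case: h => _ _ [-> _].
Qed.

Lemma end_values_surj (z : CG) : sa_set z -> exists2 y : BM, sa_set y & end_values y = z.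
Proof.
move=> hz.
(* Affine in phi, from [min_value] at 0 to [max_value] at nu_s. Gluing forces both values on G, and
   (c) and (d) force 0 elsewhere. *)
pose F : coeffs := fun p q w =>
  min_value z p q + ((nu_s (prng p))^-1 * phi (prng p) w)%:C *
    (max_value z p q - min_value z p q).
have Fmax p q : F p q (smax p) = max_value z p q.
  rewrite /F (phi_smax hnu hmu) mulVf ?gt_eqF ?(nu_s_gt0 hB hnu)//.
  by rewrite mul1r addrC subrK.
have Fmin p q : F p q (smin p) = min_value z p q.
  by rewrite /F (phi_smin hB hnu hmu) mulr0 mul0r addr0.
have bF : boundary F.
  split.
  - move=> p q pq; exists (fun t => min_value z p q + ((nu_s (prng p))^-1 * t)%:C *
      (max_value z p q - min_value z p q)) => //.
    apply: icontD; first exact: icont_cst.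
    by apply: icontM; [exact: icont_scalar|exact: icont_cst].
  - by move=> P Q h; rewrite Fmax Fmin max_valueE// min_valueE.
  - by move=> p q pq na; rewrite Fmax /max_value asboolF.
  - by move=> p q pq na; rewrite Fmin /min_value asboolF.
exists (kerF F); first exact: B_set_ker.
apply/funext => P; apply/funext => Q.
have [h|nh] := pselect (G_ m n P Q); last by rewrite end_values_off// hz.
by rewrite end_values_ker// Fmax max_valueE.
Qed.

Lemma sum_embed_hom : @star_hom R SA BM sum_embed.
Proof.
have [_ _ _ _ _ _ jL jM jS _ _] := sum_embedding; split => //.
by move=> x /sum_setP[g h ->]; rewrite sum_embed_of; apply: B_set_ker; exact: boundary_phi_coeffs.
Qed.

(** Vanishing at the s-maximal end is the hypothesis on alpha_1(G) and (c) off it. At the s-minimal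
    end, gluing transfers it on alpha_2(G), and (d) covers the rest. *)
Lemma end_values_exact (y : BM) : sa_set y ->
  (end_values y = 0 <-> exists2 x : SA, sa_set x & sum_embed x = y).
Proof.
move=> /B_setP[F bF ->]; split=> [F0|[x /sum_setP[g h ->] <-]].
  apply: boundary_zero_ends => // p q pq.
  have G0 P Q : G_ m n P Q -> F P.1 Q.1 (smax P.1) = 0.
    by move=> h; rewrite -end_values_ker// F0.
  split.
    have [[P [Q [h <- <-]]]|na] := pselect (alpha1_G m n p q); first exact: G0.
    exact: (bc_max bF).
  have [[P [Q [h <- <-]]]|na] := pselect (alpha2_G m n p q).
    by rewrite -(bc_glue bF h) G0.
  exact: (bc_min bF).
rewrite sum_embed_of; apply/funext => P; apply/funext => Q.
have [hPQ|nh] := pselect (G_ m n P Q); last exact: end_values_off.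
rewrite end_values_ker// /phi_coeffs (phi_smax hnu hmu).
by have [_] := C0_ends (h _ _ (G_pairs1 hPQ)).
Qed.

Lemma boundary_extension_exact : @cstar_short_exact R SA BM CG sum_embed end_values.
Proof.
have [sSA nSA] := kernel_cstar_algebra hB hnu hh mn sum_embedding.
have [sBM nBM] := kernel_cstar_algebra hB hnu hh mn B_embedding.
have [sCG nCG] := kernel_cstar_algebra hB hnu hh mn CstarG_embedding.
split.
- by split => //; eexists; exact: nSA.
- by split => //; eexists; exact: nBM.
- by split => //; eexists; exact: nCG.
- exact: sum_embed_hom.
- exact: end_values_hom.
- have [jD jZ jL j0] : [/\ forall x y : SA, sa_set x -> sa_set y -> sa_set (x + y),
      forall (c : C) (x : SA), sa_set x -> sa_set (c *: x),
      forall (c : C) (x y : SA), sa_set x -> sa_set y ->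
        sum_embed (c *: x + y) = c *: sum_embed x + sum_embed y &
      forall x : SA, sa_set x -> sum_embed x = 0 -> x = 0].
    by case: sum_embedding.
  move=> x y hx hy xy; apply/eqP; rewrite -subr_eq0 -scaleN1r addrC; apply/eqP.
  apply: j0; first by apply: jD => //; exact: jZ.
  by rewrite jL// xy scaleN1r addNr.
- exact: end_values_surj.
- exact: end_values_exact.
Qed.

Lemma sum_embed_inj_elem (p q : seq E) (g : R -> C) : pairsY m n (p, q) ->
  sum_embed (sum_inj (prng p) (elem_tensor (a_ nu_r m n p q) g)) =
  a_tensor nu_r m n p q (fun w => g (phi (prng p) w)).
Proof.
move=> pq; apply/funext => x; apply/funext => y; rewrite /sum_embed /sum_inj /a_tensor.
have [e|ne] := eqVneq (rng (x n)) (prng p); first by rewrite e.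
rewrite /a_ asboolF ?mulr0// => -[_ sx _ _].
by move/eqP: ne; apply; rewrite -sx prng_segment.
Qed.

End Extension.

(** Besides exactness, the C*-norm of [B_mn] is shown to be the reduced norm of the groupoid
    algebra, and [iota] is pinned down as the identification on elementary tensors, which span its
    domain. *)
Theorem corollary8p12 (R : realType) (B : bratteli)
    (nu_r nu_s : vertex B -> R)
    (haar : bipath B -> {measure set (bipath_mspace B) -> \bar R})
    (mu : vertex B -> {measure set (ray_mspace B) -> \bar R}) :
  standing_assumptions B ->
  is_state nu_r nu_s ->
  is_haar_system nu_r haar ->
  is_ray_measure nu_s mu ->
  forall m n : int, m < n ->
  exists (iota : sum_AY_C0 nu_r nu_s haar m n -> B_mn nu_r nu_s haar mu m n)
         (pi : B_mn nu_r nu_s haar mu m n -> CstarG B R m n),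
    [/\ cstar_short_exact iota pi,
        @is_cstar_norm R (B_mn nu_r nu_s haar mu m n) (reduced_norm haar)
      & forall (p q : seq (edge B)) (g : R -> R[i]),
          pairsY m n (p, q) -> C0_itv (nu_s (prng p)) g ->
          iota (sum_inj (prng p) (elem_tensor (a_ nu_r m n p q) g))
          = a_tensor nu_r m n p q (fun w => g (phi_s mu (prng p) w))].
Proof.
move=> hB hnu hh hmu m n mn.
exists (@sum_embed R B nu_r nu_s haar mu m n), (@end_values R B nu_r nu_s haar mu m n); split.
- exact: boundary_extension_exact.
- by have [] := kernel_cstar_algebra hB hnu hh mn (B_embedding hB hnu hh hmu mn).
- by move=> p q g pq _; exact: sum_embed_inj_elem.
Qed.
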